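(* Under the standing setting and Assumptions (Compact), (Irreducible) and (Killing), let $\alpha(dx)=\varphi^*(x)\mu(dx)$ and $\alpha^*(dx)=\varphi(x)\mu(dx)$, and let $\gamma>0$ be a constant such that $\|e^{\lambda_1t}Q_tf-M^{-1}\varphi\int_E\varphi^*f\,d\mu\|_{L^2_\mu}\le e^{-\gamma t}(1+M^{-1})\|f\|_{L^2_\mu}$ for all $f\in L^2(E,\mu)$ and all sufficiently large $t$. Then for every $f\in L^2(E,\mu)$ there exist $T>0$ and $C_f>0$ such that \[\Big\|\,\mathbb E_{\cdot}[f(Z_t)\mid t<\tau]-\alpha(f)\Big\|_{L^1(E,\alpha^* )}\le C_fe^{-\gamma t}\qquad\text{for all }t\ge T.\]
   Context: Let $H$ be a separable real Hilbert space and $(Z_t)_{t\ge0}$ a continuous time-homogeneous Markov process on $H$ with laws $(\mathbb P_x)_{x\in H}$ ($Z_0=x$ $\mathbb P_x$-a.s.), expectation $\mathbb E_x$, and Markov semigroup $P_tf(x)=\mathbb E_x[f(Z_t)]$; $\nu(f)=\int f\,d\nu$. Assumption (Compact): there is an invariant probability measure $\mu$ of $(P_t)$ such that for every $t>0$, $P_t$ extends to a compact operator on $L^2(H,\mu)$. Assumption (Irreducible): $P_t1_F(x)>0$ for all $x\in H$, $t>0$, and measurable $F\subset H$ with $\mu(F)>0$. Fix a bounded connected set $E\subset H$ contained in the support of $\mu$; $L^p(E,\mu)$ is the closure of bounded measurable functions on $E$ in the norm $\|f\|_{L^p_\mu}^p=\int_E|f|^pd\mu$. Let $\tau=\inf\{t>0:Z_t\in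 H\setminus E\}$ and $Q_tf(x)=\mathbb E_x[f(Z_t)1_{\{t<\tau\}}]$, $x\in E$. Assumption (Killing): for all $x\in E$ and $t>0$, $\mathbb P_x[\tau<\infty]=1$ and $\mathbb P_x[t<\tau]>0$. Spectral objects: $(Q_t)$ is a strongly continuous semigroup of compact positive operators on $L^2(E,\mu)$ with generator $\mathcal L_E$, and $s(\mathcal L_E)=\sup\operatorname{spec}\mathcal L_E$ is a simple eigenvalue. Put $\lambda_1=-s(\mathcal L_E)$. Let $\varphi>0$ be an eigenfunction of $\mathcal L_E$ with eigenvalue $-\lambda_1$ and $\varphi^*>0$ an eigenfunction of the adjoint (so $Q_t^*\varphi^*=e^{-\lambda_1t}\varphi^*$), normalized by $\int_E\varphi\,d\mu=\int_E\varphi^*\,d\mu=1$; set $M=\int_E\varphi\varphi^*\,d\mu$. *)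

(* Defs.v *)
From HB Require Import structures.
From mathcomp Require Import all_boot all_order all_algebra.
From mathcomp Require Import all_classical all_reals all_analysis.
From mathcomp Require Import measurable_realfun.
Set Implicit Arguments. Unset Strict Implicit. Unset Printing Implicit Defensive.
Import Order.TTheory GRing.Theory Num.Theory.
Import numFieldNormedType.Exports.
Local Open Scope classical_set_scope.
Local Open Scope ring_scope.

Notation BH H := (g_sigma_algebraType (@open H)).

Section Defs.
Variables (R : realType) (H : normedModType R).

Definition is_separable_Hilbert : Prop :=
  (forall u : nat -> H, cauchy (u @ \oo) -> cvg (u @ \oo)) /\
  (forall x y : H, `|x + y| ^+ 2 + `|x - y| ^+ 2 = 2 * (`|x| ^+ 2 + `|y| ^+ 2)) /\
  (exists u : nat -> H, forall (x : H) (e : R), 0 < e -> exists n, `|x - u n| < e).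

Definition bmeas (f : BH H -> R) : Prop :=
  measurable_fun setT f /\ exists M : R, forall x, `|f x| <= M.

Variables (dO : measure_display) (Omega : measurableType dO).
Variables (P : H -> probability Omega R) (Z : R -> Omega -> H).

Definition Psg (t : R) (f : BH H -> R) (x : H) : R :=
  fine (\int[P x]_w (f (Z t w))%:E)%E.

(* time-homogeneous Markov property w.r.t. the natural filtration of Z *)
Definition markov_property : Prop :=
  forall (x : H) (n : nat) (s t : R) (r : 'I_n -> R) (g : 'I_n -> BH H -> R)
         (f : BH H -> R),
    0 <= s -> 0 <= t -> (forall i, 0 <= r i <= s) ->
    (forall i, bmeas (g i)) -> bmeas f ->
    (\int[P x]_w ((\prod_(i < n) g i (Z (r i) w)) * f (Z (s + t) w))%:E =
     \int[P x]_w ((\prod_(i < n) g i (Z (r i) w)) * Psg t f (Z s w))%:E)%E.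

(* L^2(E,mu) membership and norm, L^p(E,mu) being the closure of bounded functions *)
Definition L2E (mu : {measure set (BH H) -> \bar R}) (E : set (BH H)) (f : BH H -> R) : Prop :=
  measurable_fun E f /\ (\int[mu]_(x in E) (f x ^+ 2)%:E < +oo)%E.

Definition L2n (mu : {measure set (BH H) -> \bar R}) (E : set (BH H)) (f : BH H -> R) : R :=
  Num.sqrt (fine (\int[mu]_(x in E) (f x ^+ 2)%:E)%E).

Definition msupport (mu : {measure set (BH H) -> \bar R}) : set H :=
  [set x | forall U : set H, open U -> U x -> (0 < mu U)%E].

Definition tau (E : set H) (w : Omega) : \bar R :=
  ereal_inf ((fun s : R => s%:E) @` [set s | 0 < s /\ ~ E (Z s w)]).

Definition Qsg (E : set H) (t : R) (f : BH H -> R) (x : H) : R :=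
  fine (\int[P x]_w (f (Z t w) * \1_[set w' | (t%:E < tau E w')%E] w)%:E)%E.

Definition condE (E : set H) (t : R) (f : BH H -> R) (x : H) : R :=
  Qsg E t f x / fine (P x [set w | (t%:E < tau E w)%E]).

(* generator L_E of (Q_t) on L^2(E,mu): gen f g  <->  f in D(L_E) and L_E f = g *)
Definition genE (mu : {measure set (BH H) -> \bar R}) (E : set (BH H))
  (f g : BH H -> R) : Prop :=
  L2E mu E f /\ L2E mu E g /\
  (fun h : R => L2n mu E (fun x => (Qsg E h f x - f x) / h - g x)) @ 0^'+ --> 0.

Definition specE (mu : {measure set (BH H) -> \bar R}) (E : set (BH H)) (l : R) : Prop :=
  ~ ((forall g, L2E mu E g -> exists f Lf, genE mu E f Lf /\
        L2n mu E (fun x => l * f x - Lf x - g x) = 0) /\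
     (forall f Lf, genE mu E f Lf -> L2n mu E (fun x => l * f x - Lf x) = 0 ->
        L2n mu E f = 0)).

End Defs.

(* Main.v *)
Require Import Defs.
From HB Require Import structures.
From mathcomp Require Import all_boot all_order all_algebra.
From mathcomp Require Import all_classical all_reals all_analysis.
From mathcomp Require Import measurable_realfun ring lra.
Import Order.TTheory GRing.Theory Num.Theory.
Import numFieldNormedType.Exports.
Local Open Scope classical_set_scope.
Local Open Scope ring_scope.
Set Implicit Arguments. Unset Strict Implicit. Unset Printing Implicit Defensive.

(** Put b_t(x) = e^(lam t) P_x(t < tau), so that E_x[f | t < tau] - alpha(f) is
    e^(lam t) Q_t(f - alpha(f)) / b_t.  The spectral gap controls the numerator in L2
    and gives b_n -> phi/M almost everywhere, but phi/b_t need not be bounded.  Let F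
    be the set of points of E where b_n < phi/k for some n: its measure tends to 0 as
    k grows, so by compactness of P_1 the operator W = 1_F e^lam Q_1 has arbitrarily
    small norm on L2.  Iterating phi = e^lam Q_1 phi as long as one stays in F yields
    phi <= k b_n + W^n phi.  The first term cancels the denominator and is controlled
    by the gap; by Cauchy-Schwarz under the conditional law and invariance of mu, the
    second contributes at most e^(-gamma t) once the norm of W is small enough.

    The argument needs Q_1 Q_n 1 <= Q_(n+1) 1, whereas the Markov property is given for
    finitely many times only and tau depends on uncountably many.  The gap is bridged
    by Choquet's capacitability theorem: up to small mass, the complement of E may be
    replaced by a closed subset, whose hitting event is determined by dyadic times.
    Only this inequality is proved; duality with phis turns the resulting
    e^lam Q_1 phi <= phi into an almost everywhere equality. *)

(** * Suslin sets and capacitability *)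

(** The weight [1 / b_t] is unbounded, and for nonnegative [g] the conditional expectation [Y =
    E_x[g | t < tau]] is controlled only through [Y^2 P_x(t < tau) <= Q_t (g^2)], whose right side
    is integrable. Smallness of [W^n phi] in L2 therefore does not bound [Y W^n phi] by itself:
    [Y^2] has to meet a survival probability. The bound [W^n 1 <= b_n] supplies it once [W^n] is
    applied to [2 Y f <= theta f^2 + Y^2 / theta] with [Y] frozen at the point of evaluation. The
    price is that [W^n] now acts on squares, which are merely integrable, and on L1 the norm of [W]
    is only known to be at most [e^|lam|]. Hence [W] must contract L2 not just by [e^(-gamma)] but
    by a rate that also pays for this growth.

    Capacitability concerns one finite measure, while each starting point has its own law. It is
    applied to the mixture of these laws over [E]; this is why the inequality for [Q_1 Q_n 1], and
    every later comparison, holds almost everywhere only. Such comparisons survive an application of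
    [Q_1] because [mu] is invariant. *)

Section Suslin.
Context {T : topologicalType}.

(** The Suslin operation on closed sets: a union over infinite branches of intersections along their
    finite prefixes. The scheme need not decrease along prefixes. *)
Definition suslin (A : set T) := exists F : seq nat -> set T,
  (forall s, closed (F s)) /\
  A = [set x | exists sg : nat -> nat, forall k, F (mkseq sg k) x].

Lemma suslin_closed (A : set T) : closed A -> suslin A.
Proof.
move=> cA; exists (fun=> A); split=> //; apply/seteqP; split=> x /=.
  by move=> Ax; exists (fun=> 0%N).
by move=> [sg /(_ 0%N)].
Qed.

Lemma mkseqS_head (sg : nat -> nat) k :
  mkseq sg k.+1 = sg 0%N :: mkseq (fun i => sg i.+1) k.
Proof. by rewrite /mkseq /= (iotaDl 1 0 k) -map_comp. Qed.

(** The first entry of a branch selects the set, the remaining entries are a branch for it. *)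
Lemma suslin_bigcup (A : nat -> set T) : (forall n, suslin (A n)) ->
  suslin (\bigcup_n A n).
Proof.
move=> /choice[F FA].
pose G s := if s is n :: s' then F n s' else setT.
exists G; split.
  by case=> [|n s]; rewrite /G; [exact: closedT | exact: (FA n).1].
apply/seteqP; split=> x /=.
  move=> [n _]; rewrite (FA n).2 => -[sg Fx].
  exists (fun i => if i is i'.+1 then sg i' else n) => -[|k]; first exact: I.
  by rewrite mkseqS_head; exact: Fx.
move=> [sg Fx]; exists (sg 0%N) => //; rewrite (FA _).2.
exists (fun i => sg i.+1) => k.
have := Fx k.+1.
by rewrite mkseqS_head.
Qed.

(** One branch codes countably many: entry [i] of the [n]-th branch is stored at the code of the
    pair [(n, i)]. A node imposes exactly the conditions whose entries it has already read. *)
Lemma suslin_bigcap (A : nat -> set T) : (forall n, suslin (A n)) ->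
  suslin (\bigcap_n A n).
Proof.
move=> /choice[F FA].
pose sub (s : seq nat) (n j : nat) := mkseq (fun i => nth 0%N s (pickle (n, i))) j.
exists (fun s => [set x | forall n j,
   (forall i, (i < j)%N -> (pickle (n, i) < size s)%N) -> F n (sub s n j) x]); split.
  move=> s; rewrite (_ : [set _ | _] = \bigcap_(p in [set p : nat * nat |
      forall i, (i < p.2)%N -> (pickle (p.1, i) < size s)%N]) F p.1 (sub s p.1 p.2)).
    by apply: closed_bigI => p _; case: (FA p.1).
  apply/seteqP; split=> x /=; first by move=> h [n j] /= hj; exact: h.
  by move=> h n j hj; exact: (h (n, j)).
apply/seteqP; split=> x /=.
  move=> Ax; have {Ax} : forall n, exists sg : nat -> nat, forall k, F n (mkseq sg k) x.
    by move=> n; have := Ax n I; rewrite (FA n).2.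
  move=> /choice[sg Fx].
  exists (fun m => if unpickle m is Some p then sg p.1 p.2 else 0%N) => k n j hj.
  rewrite /sub (_ : mkseq _ j = mkseq (sg n) j)//; apply/eq_in_map => i.
  rewrite mem_iota add0n => /andP[_ /hj]; rewrite size_mkseq => ik.
  by rewrite nth_mkseq// pickleK.
move=> [sg h] n _; rewrite (FA n).2; exists (fun i => sg (pickle (n, i))) => j.
(* A prefix long enough to contain the codes of the first [j] entries of branch [n]. *)
have [k hk] : exists k, forall i, (i < j)%N -> (pickle (n, i) < k)%N.
  elim: j => [|j [k hk]]; first by exists 0%N.
  exists (maxn k (pickle (n, j)).+1) => i; rewrite ltnS leq_eqVlt => /predU1P[->|/hk ik].
    by rewrite leq_max leqnn orbT.
  by rewrite leq_max ik.
have := h k n j; rewrite size_mkseq => /(_ hk).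
rewrite /sub (_ : mkseq _ j = mkseq (fun i => sg (pickle (n, i))) j)//.
apply/eq_in_map => i; rewrite mem_iota add0n => /andP[_ /hk ik].
by rewrite nth_mkseq.
Qed.

End Suslin.

Lemma open_closed_bigcup (R : realType) (H : normedModType R) (A : set H) : open A ->
  exists C : nat -> set H, (forall n, closed (C n)) /\ A = \bigcup_n C n.
Proof.
move=> oA; exists (fun n => [set x | forall y, ~ A y -> n.+1%:R^-1 <= `|x - y|]); split.
  move=> n; rewrite (_ : [set _ | _] = ~` \bigcup_(y in ~` A) ball y n.+1%:R^-1).
    by apply: open_closedC; apply: bigcup_open => y _; exact: ball_open.
  apply/seteqP; split=> x /=.
    move=> h [y Ay]; rewrite -ball_normE /= distrC => xy.
    by have := h y Ay; rewrite leNgt xy.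
  move=> h y Ay; rewrite leNgt; apply/negP => xy; apply: h; exists y => //.
  by rewrite -ball_normE /= distrC.
apply/seteqP; split=> x.
  move=> Ax; have /nbhs_ballP[e /= e0 eA] : nbhs x A by exact: open_nbhs_nbhs.
  have [n ne] : exists n, n.+1%:R^-1 < e.
    near \oo => n; exists n; near: n.
    exact: near_infty_natSinv_lt (PosNum e0).
  exists n => // y Ay; rewrite leNgt; apply/negP => xy; apply: Ay; apply: eA.
  by rewrite -ball_normE /=; exact: lt_trans ne.
move=> [n _] /= h; apply: contrapT => /h; rewrite subrr normr0 leNgt.
by rewrite invr_gt0 ltr0n.
Unshelve. all: by end_near. Qed.

(** Suslin sets are not closed under complement, so the induction runs over the sets that are Suslin
    together with their complement. They form a sigma-algebra, which contains the open sets because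
    these are countable unions of closed ones. *)
Lemma borel_suslin (R : realType) (H : normedModType R) (A : set (BH H)) :
  measurable A -> suslin (A : set H).
Proof.
move=> mA; suff: (@suslin H A /\ @suslin H (~` A)) by case.
apply: (mA [set B | @suslin H B /\ @suslin H (~` B)]); split; last first.
  move=> B oB; split; last by apply: suslin_closed; exact: open_closedC.
  have [C [cC ->]] := open_closed_bigcup oB.
  by apply: suslin_bigcup => n; exact: suslin_closed.
split.
- by rewrite /= setC0; split; apply: suslin_closed; [exact: closed0|exact: closedT].
- by move=> B [sB sCB]; rewrite /= setTD setCK.
- move=> F hF /=; split; first by apply: suslin_bigcup => n; case: (hF n).
  by rewrite setC_bigcup; apply: suslin_bigcap => n; case: (hF n).
Qed.

(** * Koenig's lemma and Choquet's capacitability theorem *)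

(** The bound [b] makes the tree finitely branching. A node with good extensions of every length has
    a child with the same property, and following such children gives the branch. *)
Lemma konig (G : seq nat -> Prop) (b : nat -> nat) :
  (forall j, exists s, [/\ size s = j, (forall i, (i < j)%N -> (nth 0 s i <= b i)%N) &
     forall k, (k <= j)%N -> G (take k s)]) ->
  exists sg : nat -> nat, forall k, G (mkseq sg k).
Proof.
move=> hG.
pose good s j := [/\ size s = j, (forall i, (i < j)%N -> (nth 0 s i <= b i)%N) &
     forall k, (k <= j)%N -> G (take k s)].
pose ext s := forall j, (size s <= j)%N -> exists s', good s' j /\ take (size s) s' = s.
have ext0 : ext [::] by move=> j _; have [s' ?] := hG j; exists s'; rewrite take0.
have extS s : ext s -> exists m, ext (rcons s m).
  move=> es; apply: contrapT => /forallNP noext.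
  have {noext} /choice[J hJ] : forall m, exists j, (size s < j)%N /\
      forall s', good s' j -> take (size s).+1 s' <> rcons s m.
    move=> m; have /existsNP[j /not_implyP[sj hs]] := noext m.
    rewrite size_rcons in sj; exists j; split=> // s' gs' ts'; apply: hs.
    by exists s'; rewrite size_rcons.
  (* If every child died at some length [J m], a good sequence of length [N] through [s] would
     outlive all the finitely many admissible children, including its own. *)
  pose N := (\max_(m < (b (size s)).+1) J m)%N.
  have JN m : (m <= b (size s))%N -> (J m <= N)%N.
    by move=> mb; have := @leq_bigmax_cond _ xpredT (fun m : 'I_(b (size s)).+1 => J m)
       (Ordinal (mb : (m < (b (size s)).+1)%N)) isT.
  have sN : (size s < N)%N by apply: leq_trans (JN 0%N _) => //; case: (hJ 0%N).
  have [s' [[ss' bs' Gs'] ts']] := es N (ltnW sN).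
  pose m := nth 0%N s' (size s).
  have mb : (m <= b (size s))%N by exact: bs'.
  have [sJ /(_ (take (J m) s'))] := hJ m; apply.
    split; first by rewrite size_takel// ss' JN.
      by move=> i iJ; rewrite nth_take// bs'//; apply: leq_trans iJ (JN _ mb).
    move=> k kJ; rewrite take_takel//; apply: Gs'; exact: leq_trans kJ (JN _ mb).
  by rewrite take_takel// (take_nth 0%N) ?ss'// ts'.
have /choice[nx hnx] : forall s, exists m, ext s -> ext (rcons s m).
  move=> s; have [es|nes] := pselect (ext s); last by exists 0%N.
  by have [m hm] := extS s es; exists m.
pose st := fix st k := if k is k'.+1 then rcons (st k') (nx (st k')) else [::].
have est k : ext (st k) by elim: k => //= k IH; exact: hnx.
exists (fun i => nx (st i)) => k.
have -> : mkseq (fun i => nx (st i)) k = st k.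
  by elim: k => //= k IH; rewrite mkseqS IH.
have [s' [[_ _ /(_ _ (leqnn _)) Gs'] ts']] := est k _ (leqnn _).
by rewrite -ts'.
Qed.

Lemma take_mkseq (sg : nat -> nat) k j : (k <= j)%N ->
  take k (mkseq sg j) = mkseq sg k.
Proof. by move=> kj; rewrite /mkseq -map_take take_iota (minn_idPl kj). Qed.

(** Finiteness is what keeps the approximations in [capacitable] closed. *)
Lemma finite_bounded_seq (b : nat -> nat) j : finite_set
  [set s : seq nat | size s = j /\ forall i, (i < j)%N -> (nth 0%N s i <= b i)%N].
Proof.
elim: j => [|j IH].
  apply: (@sub_finite_set _ _ [set [::]]) => // s [/size0nil -> _] //.
apply: (@sub_finite_set _ _ [set rcons s m | s in
    [set s : seq nat | size s = j /\ forall i, (i < j)%N -> (nth 0%N s i <= b i)%N]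
    & m in `I_(b j).+1]); last by apply: finite_image2 => //; exact: finite_II.
move=> s [] /=; elim/last_ind: s => // s m _; rewrite size_rcons => -[[ss] bs].
exists s.
  split=> // i ij; have := bs i (ltnW ij).
  by rewrite nth_rcons ss ij.
exists m => //; have := bs j (ltnSn j).
by rewrite nth_rcons ss ltnn eqxx.
Qed.

Section Capacity.
Context {d : measure_display} {W : measurableType d} {R : realType}.
Variables (m : {measure set W -> \bar R}) (T : topologicalType) (h : set T -> set W).
Hypothesis mfin : (m setT < +oo)%E.
Hypothesis h_mono : forall A B, A `<=` B -> h A `<=` h B.
Hypothesis h_cup : forall B : nat -> set T, h (\bigcup_n B n) `<=` \bigcup_n h (B n).
Hypothesis h_meas : forall C, closed C -> measurable (h C).
Hypothesis h_cap : forall D : nat -> set T, (forall n, closed (D n)) ->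
  (forall n, D n.+1 `<=` D n) -> \bigcap_n h (D n) `<=` h (\bigcap_n D n).
Variables (Y : set W) (mY : measurable Y).

(** Outer measure above [a], phrased through measurable covers because [h B] need not be measurable
    unless [B] is closed. *)
Let big (a : R) B := forall U, measurable U -> h B `&` Y `<=` U -> (a%:E < m U)%E.

Let m_lty U : measurable U -> (m U < +oo)%E.
Proof. by move=> mU; apply: le_lt_trans mfin; apply: le_measure; rewrite ?inE. Qed.

Let big_sub a A B : A `<=` B -> big a A -> big a B.
Proof.
move=> AB bA U mU hU; apply: bA => //; apply: subset_trans hU.
by apply: setSI; exact: h_mono.
Qed.

(** Outer measure is continuous along increasing unions: if each [h (B n)] had a cover of mass at
    most [a], the lower limit [\bigcup_n V n] of these covers would cover the union with mass at
    most [a]. *)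
Let big_cup a (B : nat -> set T) : (forall i j, (i <= j)%N -> B i `<=` B j) ->
  big a (\bigcup_n B n) -> exists n, big a (B n).
Proof.
move=> ndB bB; apply: contrapT => /forallNP nb.
have /choice[U hU] : forall n, exists U, [/\ measurable U, h (B n) `&` Y `<=` U &
    (m U <= a%:E)%E].
  move=> n; have /existsNP[U /not_implyP[mU /not_implyP[hU]]] := nb n.
  by move/negP; rewrite -leNgt => ma; exists U.
pose V n := \bigcap_(l in [set l | (n <= l)%N]) U l.
have mV n : measurable (V n).
  by apply: bigcap_measurable => [|k _]; [exists n => /=|case: (hU k)].
have mcV : measurable (\bigcup_n V n) by apply: bigcupT_measurable.
have VU : h (\bigcup_n B n) `&` Y `<=` \bigcup_n V n.
  move=> w [/h_cup [n _ hn] Yw]; exists n => // l /= nl.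
  have [_ + _] := hU l; apply; split=> //.
  exact: h_mono (ndB _ _ nl) _ hn.
have := bB _ mcV VU; rewrite ltNge => /negP; apply.
have := nondecreasing_cvg_mu (mu := m) mV mcV.
have ndV : {homo V : n m / (n <= m)%N >-> (n <= m)%O}.
  move=> i j ij; apply/subsetPset => w Vw l /= jl; apply: Vw => /=.
  exact: leq_trans jl.
move=> /(_ ndV) cV; apply: (cvge_le _ cV); apply: nearW => n /=.
have [mU _ Ua] := hU n; apply: le_trans Ua.
by apply: le_measure; rewrite ?inE//; move=> w; apply => /=.
Qed.

(** The entries of the branches are bounded one position at a time, each bound taken so large that
    the outer measure stays above [m Y - e]. Branches under these bounds form a compact set, which
    yields a closed subset of [A]. *)
Lemma capacitable (A : set T) (e : R) : suslin A -> Y `<=` h A -> 0 < e ->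
  exists K, [/\ closed K, K `<=` A & (m (Y `\` h K) <= e%:E)%E].
Proof.
move=> [F [cF AE]] YA e0.
pose a := fine (m Y) - e.
have mYf : m Y \is a fin_num by rewrite ge0_fin_numE// m_lty.
(* Points reached by a branch whose first entries are bounded by those of [L]; later entries are
   free. *)
pose AL (L : seq nat) := [set x | exists sg : nat -> nat,
  (forall i, (i < size L)%N -> (sg i <= nth 0%N L i)%N) /\ forall k, F (mkseq sg k) x].
have b0 : big a (AL [::]).
  move=> U mU hU; have YU : Y `<=` U.
    move=> w Yw; apply: hU; split=> //; apply: h_mono (YA _ Yw); rewrite AE => x [sg Fx].
    by exists sg.
  apply: (@lt_le_trans _ _ (m Y)); last by apply: le_measure; rewrite ?inE.
  by rewrite -(fineK mYf) lte_fin /a ltrBlDr ltrDl.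
have bS L : big a (AL L) -> exists n, big a (AL (rcons L n)).
  move=> bL; apply: big_cup.
    move=> i j ij x [sg [sgb Fx]]; exists sg; split=> // k.
    have := sgb k; rewrite !size_rcons !nth_rcons => + kL => /(_ kL).
    case: ltnP => // Lk; case: eqP => // _ /leq_trans; exact.
  apply: big_sub bL => x [sg [sgb Fx]]; exists (sg (size L)) => //; exists sg.
  split=> // k; rewrite size_rcons nth_rcons ltnS leq_eqVlt => /predU1P[->|kL].
    by rewrite ltnn eqxx.
  by rewrite kL; exact: sgb.
have /choice[nx hnx] : forall L, exists n, big a (AL L) -> big a (AL (rcons L n)).
  move=> L; have [eL|neL] := pselect (big a (AL L)); last by exists 0%N.
  by have [n hn] := bS L eL; exists n.
pose st := fix st k := if k is k'.+1 then rcons (st k') (nx (st k')) else [::].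
have est k : big a (AL (st k)) by elim: k => //= k IH; exact: hnx.
pose b i := nx (st i).
have stE k : st k = mkseq b k by elim: k => // k IH; rewrite mkseqS -IH.
pose S j := [set s : seq nat | size s = j /\ forall i, (i < j)%N -> (nth 0%N s i <= b i)%N].
(* A closed relaxation of [AL (st j)] that tests the levels of the scheme up to [j] only. It
   inherits [big a], and being closed it has a measurable image under [h]. *)
pose D j := \bigcup_(s in S j) \bigcap_(k in `I_j.+1) F (take k s).
have cD j : closed (D j).
  apply: closed_bigcup; first exact: finite_bounded_seq.
  by move=> s _; apply: closed_bigI.
have AD j : AL (st j) `<=` D j.
  move=> x [sg [sgb Fx]]; exists (mkseq sg j).
    split; first by rewrite size_mkseq.
    move=> i ij; rewrite nth_mkseq//; have := sgb i; rewrite stE size_mkseq => /(_ ij).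
    by rewrite nth_mkseq.
  by move=> k /=; rewrite ltnS => kj; rewrite take_mkseq.
have DS j : D j.+1 `<=` D j.
  move=> x [s [ss bs] Fx]; exists (take j s).
    split; first by rewrite size_takel// ss.
    by move=> i ij; rewrite nth_take// bs// ltnW.
  move=> k /=; rewrite ltnS => kj; rewrite take_takel//; apply: Fx => /=.
  by rewrite ltnS (leq_trans kj).
exists (\bigcap_n D n); split.
- exact: closed_bigI.
(* A point of all the [D j] passes the tests along bounded sequences of every length; [konig]
   assembles a single branch. *)
- rewrite AE => x Dx; apply: (@konig (fun s => F s x) b) => j.
  have [s [ss bs] Fx] := Dx j I; exists s; split=> // k kj; exact: Fx.
- have mh j : measurable (h (D j)) by exact: h_meas.
  have mhY : measurable (h (\bigcap_n D n) `&` Y).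
    by apply: measurableI => //; apply: h_meas; exact: closed_bigI.
  have ham : (a%:E <= m (h (\bigcap_n D n) `&` Y))%E.
    have hE : h (\bigcap_n D n) `&` Y = \bigcap_n (h (D n) `&` Y).
      apply/seteqP; split=> w /=.
        by move=> [hw Yw] n _; split=> //; apply: h_mono hw => x; exact.
      by move=> hw; split; [apply: h_cap => // n _; case: (hw n I)|case: (hw 0%N I)].
    rewrite hE in mhY *.
    have := nonincreasing_cvg_mu (mu := m) (F := fun n => h (D n) `&` Y) _ _ mhY.
    have h0 : (m (h (D 0%N) `&` Y) < +oo)%E by apply: m_lty; exact: measurableI.
    move=> /(_ h0) c; apply: (cvge_ge _ (c _ _)); last 2 first.
    + by move=> n; exact: measurableI.
    + move=> i j ij; apply/subsetPset; apply: setSI; apply: h_mono.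
      elim: j ij => [|j IH]; first by rewrite leqn0 => /eqP ->.
      rewrite leq_eqVlt => /predU1P[-> //|/IH ?]; exact: subset_trans (DS j) _.
    + apply: nearW => n /=; apply/ltW; have := est n; apply.
        exact: measurableI.
      by apply: setSI; apply: h_mono; exact: AD.
  have mhD : measurable (h (\bigcap_n D n)) by apply: h_meas; exact: closed_bigI.
  rewrite (measureD mY mhD (m_lty mY)).
  rewrite setIC leeBlDr; last by rewrite ge0_fin_numE//; apply: m_lty; exact: mhY.
  apply: le_trans (leeD (lexx e%:E) ham); rewrite -EFinD /a addrCA subrr addr0.
  by rewrite (fineK mYf).
Qed.

End Capacity.

(** * Hitting events and the Markov property of the killed process *)

Section Paths.
Context {R : realType} {H : normedModType R}.

(** Compactness of the time segment: each time has an index valid nearby, and monotonicity in [j]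
    merges finitely many of them. *)
Lemma path_cover (z : R -> H) (T : R) (G : nat -> set H) :
  {within [set t : R | 0 <= t], continuous z} ->
  (forall i j, (i <= j)%N -> G i `<=` G j) ->
  (forall r, 0 <= r <= T -> exists j, nbhs (z r) (G j)) ->
  exists j, forall r, 0 <= r <= T -> G j (z r).
Proof.
move=> /subspace_continuousP zc ndG hG.
have /compact_near_coveringP cov := @segment_compact R 0 T.
have [j _ hj] : \forall j \near \oo, `[0, T] `<=` [set r | 0 <= r -> G j (z r)].
  apply: (cov nat \oo (fun j r => 0 <= r -> G j (z r))).
  move=> r /=; rewrite in_itv/= => rT; have [j Gj] := hG r rT.
  have /andP[r0 _] := rT.
  have := zc r r0 _ Gj; rewrite /nbhs /= /within /= => rG.
  exists ([set s | 0 <= s -> G j (z s)], [set i | (j <= i)%N]).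
    by split=> //=; exists j.
  by move=> [s i] /= [hs ji] s0; exact: (ndG _ _ ji _ (hs s0)).
exists j => r rT; by apply: (hj j) => //=; case/andP: rT.
Qed.

(** Points at distance at least [1 / (k + 1)] from [C]. These closed sets exhaust the complement of
    a closed [C]. *)
Definition away (C : set H) (k : nat) : set H := ~` \bigcup_(c in C) ball c k.+1%:R^-1.

Lemma closed_away C k : closed (away C k).
Proof. by apply: open_closedC; apply: bigcup_open => y _; exact: ball_open. Qed.

Lemma away_sub C k : away C k `<=` ~` C.
Proof. by move=> x h Cx; apply: h; exists x => //; apply: ballxx; rewrite invr_gt0. Qed.

Lemma away_nd C i j : (i <= j)%N -> away C i `<=` away C j.
Proof.
move=> ij; apply: subsetC; apply: subset_bigcup => c _.
by apply: le_ball; rewrite lef_pV2 ?posrE// ler_nat ltnS.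
Qed.

Lemma away_nbhs C x : closed C -> ~ C x -> exists k, nbhs x (away C k).
Proof.
move=> cC nCx; have /nbhs_ballP[e /= e0 eC] : nbhs x (~` C).
  by apply: open_nbhs_nbhs; split=> //; exact: closed_openC.
have [k ke] : exists k, k.+1%:R^-1 < e / 2.
  near \oo => n; exists n; near: n.
  by apply: near_infty_natSinv_lt (PosNum (_ : 0 < e / 2)); exact: divr_gt0.
exists k; apply/nbhs_ballP; exists (e / 2) => /=; first exact: divr_gt0.
move=> y xy [c Cc cy]; apply: (eC c) => //.
apply: (ball_split xy); apply: ball_sym; apply: le_ball cy; exact: ltW.
Unshelve. all: by end_near. Qed.

Context {dO : measure_display} {Omega : measurableType dO}.
Variables (Z : R -> Omega -> H).
Hypothesis HZmeas : forall t, 0 <= t -> measurable_fun setT (Z t : Omega -> BH H).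
Hypothesis HZcont : forall w, {within [set t : R | 0 <= t], continuous (fun t => Z t w)}.

(** Here and in [stays] time 0 counts, whereas [tau] looks at positive times only. The initial point
    therefore has to be handled apart, through [HZ0]. *)
Definition hit T (B : set H) := [set w | exists2 r, 0 <= r <= T & B (Z r w)].

Definition stays T (B : set H) := [set w | forall r, 0 <= r <= T -> B (Z r w)].

Definition grid (u : R) (n : nat) (B : set H) :=
  [set w | forall i, (i <= n)%N -> B (Z (i%:R * u) w)].

Lemma setC_hit T B : ~` hit T B = stays T (~` B).
Proof.
apply/seteqP; split=> w /= h; first by move=> r rT Br; apply: h; exists r.
by move=> [r rT Br]; exact: (h r).
Qed.

Lemma hit_mono T A B : A `<=` B -> hit T A `<=` hit T B.
Proof. by move=> AB w [r rT Ar]; exists r => //; exact: AB. Qed.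

Lemma hit_bigcup T (B : nat -> set H) : hit T (\bigcup_n B n) `<=` \bigcup_n hit T (B n).
Proof. by move=> w [r rT [n _ Br]]; exists n => //; exists r. Qed.

(** A path missing the intersection is covered by the increasing open complements, hence by one of
    them. This is the continuity along decreasing closed sets that a capacity must have. *)
Lemma hit_bigcap T (D : nat -> set H) : (forall n, closed (D n)) ->
  (forall n, D n.+1 `<=` D n) -> \bigcap_n hit T (D n) `<=` hit T (\bigcap_n D n).
Proof.
move=> cD dD w hw; apply: contrapT => nh.
have ndD i j : (i <= j)%N -> D j `<=` D i.
  elim: j => [|j IH]; first by rewrite leqn0 => /eqP ->.
  rewrite leq_eqVlt => /predU1P[-> //|/IH ?]; exact: subset_trans (dD j) _.
have [j hj] : exists j, forall r, 0 <= r <= T -> (~` D j) (Z r w).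
  apply: (@path_cover (fun t => Z t w) T (fun j => ~` D j)) => //.
    by move=> i j ij; apply: subsetC; exact: ndD.
  move=> r rT; have /existsNP[j /not_implyP[_ nDj]] : ~ (\bigcap_n D n) (Z r w).
    by move=> Dr; apply: nh; exists r.
  by exists j; apply: open_nbhs_nbhs; split=> //; exact: closed_openC.
by have [r rT] := hw j I; exact: hj.
Qed.

(** By compactness, a path avoiding a closed set on a segment keeps a positive distance from it. *)
Lemma stays_away T C : closed C -> stays T (~` C) = \bigcup_k stays T (away C k).
Proof.
move=> cC; apply/seteqP; split=> w /=.
  move=> hw; have [k hk] := @path_cover (fun t => Z t w) T (away C) (@HZcont w)
     (away_nd (C := C)) (fun r rT => away_nbhs cC (hw r rT)).
  by exists k.
by move=> [k _ hk] r rT; apply: away_sub (hk r rT).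
Qed.

Lemma grid_nd u n B N : grid (u / 2 ^+ N.+1) (n * 2 ^ N.+1) B `<=`
  grid (u / 2 ^+ N) (n * 2 ^ N) B.
Proof.
move=> w h i iN; have := h (i * 2)%N; rewrite expnSr mulnA leq_mul2r iN orbT => /(_ isT).
rewrite natrM exprSr invfM -!mulrA (mulrCA 2) (mulrCA 2) divff ?mulr1//.
Qed.

(** Continuity and closedness reduce all times to dyadic multiples of [u]. The horizon is itself a
    multiple of [u], so that it lies on every grid. *)
Lemma staysE u n D : 0 < u -> closed D ->
  stays (n%:R * u) D = \bigcap_N grid (u / 2 ^+ N) (n * 2 ^ N) D.
Proof.
move=> u0 cD; have e0 N : 0 < u / 2 ^+ N by rewrite divr_gt0// exprn_gt0.
apply/seteqP; split=> w /= h.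
  move=> N _ i iN; apply: h; rewrite mulr_ge0 ?(ltW (e0 _))//=.
  rewrite mulrCA [leRHS]mulrC ler_pM2l// ler_pdivrMr ?exprn_gt0//.
  by rewrite -natrX -natrM ler_nat.
move=> r /andP[r0 rT]; apply: cD => B /= Br.
have /subspace_continuousP/(_ r r0 _ Br) := @HZcont w.
rewrite /nbhs /= /within /= => /nbhs_ballP[e /= e0' he].
have [N Ne] : exists N, u / 2 ^+ N < e.
  have : (fun N => u * (2^-1 : R) ^+ N) @ \oo --> u * 0.
    by apply: cvgMr; apply: cvg_expr; rewrite ger0_norm ?invr_ge0// invf_lt1// ltr1n.
  rewrite mulr0 => /cvgr0Pnorm_lt/(_ e e0')[N _ /(_ N (leqnn _))].
  by rewrite exprVn ger0_norm ?(ltW (e0 _))// => ?; exists N.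
(* The last grid time not after [r]: it stays within the horizon and is within one mesh of [r]. *)
pose i := Num.truncn (r / (u / 2 ^+ N)).
have q0 : 0 <= r / (u / 2 ^+ N) by rewrite divr_ge0// ltW.
have /andP[i1 i2] := truncn_itv q0.
rewrite -/i ler_pdivlMr// in i1; rewrite -/i ltr_pdivrMr// in i2.
exists (Z (i%:R * (u / 2 ^+ N)) w); split.
  apply: (h N I); rewrite -(ler_nat R) natrM natrX.
  rewrite -(ler_pM2r (e0 N)); apply: le_trans i1 (le_trans rT _).
  by rewrite -mulrA (mulrC u) mulrA mulrA mulfK// expf_neq0// mulrC.
apply: he; last by rewrite mulr_ge0// ltW.
rewrite /ball_ /= ger0_norm ?subr_ge0//.
apply: le_lt_trans Ne; rewrite lerBlDl; apply: le_trans (ltW i2) _.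
by rewrite -[i.+1]addn1 natrD mulrDl mul1r.
Qed.

Lemma measurable_Z t B : 0 <= t -> measurable (B : set (BH H)) ->
  measurable [set w | B (Z t w)].
Proof. by move=> t0 mB; rewrite -[X in measurable X]setTI; exact: HZmeas. Qed.

Lemma measurable_closed (C : set H) : closed C -> measurable (C : set (BH H)).
Proof.
move=> cC; rewrite -(setCK C); apply: measurableC.
by apply: sub_sigma_algebra; exact: closed_openC.
Qed.

Lemma measurable_start x : measurable [set w | Z 0 w = x].
Proof.
apply: (measurable_Z (lexx 0) (B := [set x])); apply: measurable_closed.
exact: (accessible_closed_set1 (hausdorff_accessible (@norm_hausdorff _ _))).
Qed.

Lemma measurable_grid u n B : 0 <= u -> measurable (B : set (BH H)) ->
  measurable (grid u n B).
Proof.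
move=> u0 mB; rewrite (_ : grid u n B =
    \bigcap_(i in `I_n.+1) [set w | B (Z (i%:R * u) w)]).
  apply: fin_bigcap_measurable; first exact: finite_II.
  by move=> i _; apply: measurable_Z => //; rewrite mulr_ge0.
by apply/seteqP; split=> w /= h i; have := h i; rewrite /= ltnS.
Qed.

Lemma measurable_stays u n D : 0 < u -> closed D -> measurable (stays (n%:R * u) D).
Proof.
move=> u0 cD; rewrite staysE//; apply: bigcapT_measurable => N.
apply: measurable_grid; last exact: measurable_closed.
by rewrite ltW// divr_gt0// exprn_gt0.
Qed.

Lemma measurable_nohit u n C : 0 < u -> closed C ->
  measurable (stays (n%:R * u) (~` C)).
Proof.
move=> u0 cC; rewrite stays_away//; apply: bigcupT_measurable => k.
by apply: measurable_stays => //; exact: closed_away.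
Qed.

End Paths.

Lemma integral_cst_prob d (T : measurableType d) (R : realType) (p : probability T R)
  (c : \bar R) : (\int[p]_w cst c w = c)%E.
Proof.
rewrite integral_cst//; transitivity (c * 1)%E; last by rewrite mule1.
by congr (_ * _)%E; exact: probability_setT.
Qed.

Lemma probability_setC0 d (T : measurableType d) (R : realType) (p : probability T R) A :
  measurable A -> p A = 1%E -> p (~` A) = 0%E.
Proof. by move=> mA pA; have := probability_setC p mA; rewrite pA subee. Qed.

(** * Markov property for sampled times, closed sets and complements of closed sets *)

Section Markov.
Context {R : realType} {H : normedModType R}.
Context {dO : measure_display} {Omega : measurableType dO}.
Variables (P : H -> probability Omega R) (Z : R -> Omega -> H).
Hypothesis HZmeas : forall t, 0 <= t -> measurable_fun setT (Z t : Omega -> BH H).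
Hypothesis HPmeas : forall A : set Omega, measurable A ->
  measurable_fun [set: BH H] (fun x : BH H => P x A).
Hypothesis HZcont : forall w, {within [set t : R | 0 <= t], continuous (fun t => Z t w)}.
Hypothesis HZ0 : forall x : H, P x [set w | Z 0 w = x] = 1%E.
Hypothesis Hmarkov : markov_property P Z.

Lemma measurable_integral_kernel (g : Omega -> \bar R) : (forall w, (0 <= g w)%E) ->
  measurable_fun setT g ->
  measurable_fun [set: BH H] (fun x : BH H => \int[P x]_w g w)%E.
Proof.
move=> g0 mg; apply: (@measurable_fun_integral_kernel _ _ (BH H) Omega R
  (fun x => P x : {measure set Omega -> \bar R})) => //.
Qed.

Lemma measurable_fun_Z t (f : BH H -> R) : 0 <= t -> measurable_fun setT f ->
  measurable_fun setT (fun w => f (Z t w)).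
Proof. by move=> t0 mf; apply: (measurableT_comp mf); exact: HZmeas. Qed.

Lemma measurable_fun_Ze t (f : BH H -> \bar R) : 0 <= t -> measurable_fun setT f ->
  measurable_fun setT (fun w => f (Z t w)).
Proof. by move=> t0 mf; apply: (measurableT_comp mf); exact: HZmeas. Qed.

Lemma measurable_Psg t (f : BH H -> R) : 0 <= t -> measurable_fun setT f ->
  (forall x, 0 <= f x) -> measurable_fun setT (Psg P Z t f : BH H -> R).
Proof.
move=> t0 mf f0; apply: (measurableT_comp (fine_measurable measurableT)).
apply: measurable_integral_kernel => [w|]; first by rewrite lee_fin.
by apply/measurable_EFinP; exact: measurable_fun_Z.
Qed.

Lemma integral_prob_bounded x (g : Omega -> R) (c : R) : measurable_fun setT g ->
  (forall w, 0 <= g w <= c) -> (0 <= \int[P x]_w (g w)%:E <= c%:E)%E.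
Proof.
move=> mg gc; apply/andP; split.
  by apply: integral_ge0 => w _; rewrite lee_fin; case/andP: (gc w).
apply: (@le_trans _ _ (\int[P x]_w (cst c%:E w))%E); last first.
  by rewrite integral_cst_prob.
apply: ge0_le_integral => //.
- by move=> w _; rewrite lee_fin; case/andP: (gc w).
- exact/measurable_EFinP.
- by move=> w _; rewrite lee_fin; case/andP: (gc w).
Qed.

Lemma Psg_bounded t (f : BH H -> R) (c : R) x : 0 <= t -> measurable_fun setT f ->
  (forall x, 0 <= f x <= c) -> 0 <= Psg P Z t f x <= c.
Proof.
move=> t0 mf fc; have /andP[h1 h2] := @integral_prob_bounded x (fun w => f (Z t w)) c
  (measurable_fun_Z t0 mf) (fun w => fc _).
rewrite /Psg fine_ge0//= -lee_fin fineK//.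
by rewrite ge0_fin_numE//; apply: le_lt_trans h2 (ltry _).
Qed.

Section Discrete.
Variables (D : set H) (mD : measurable (D : set (BH H))) (e : R) (e0 : 0 <= e).

(** The probability, from [x], of being in [D] at times [0, e, ..., n e], as [grid_survive]
    confirms. The backward recursion makes it a bounded measurable function, to which
    [markov_property] applies. *)
Fixpoint survive (n : nat) : BH H -> R :=
  if n is n'.+1 then fun x => \1_D x * Psg P Z e (survive n') x else \1_D.

Lemma surviveP n : measurable_fun setT (survive n) /\ forall x, 0 <= survive n x <= 1.
Proof.
elim: n => [|n [mS bS]] /=.
  split; first exact: measurable_indic.
  by move=> x; rewrite indicE; case: (x \in _); rewrite ?lexx ler01.
split.
  apply: measurable_funM; first exact: measurable_indic.
  by apply: measurable_Psg => // x; case/andP: (bS x).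
move=> x; have /andP[h1 h2] := Psg_bounded x e0 mS bS.
by rewrite indicE; case: (x \in _); rewrite ?mul0r ?mul1r ?lexx ?ler01 ?h1.
Qed.

Lemma survive_bmeas n : bmeas (survive n).
Proof.
have [mS bS] := surviveP n; split=> //; exists 1 => x.
by have /andP[h1 h2] := bS x; rewrite ger0_norm.
Qed.

Lemma indic_bmeas : bmeas (\1_D : BH H -> R).
Proof. exact: (survive_bmeas 0). Qed.

Lemma indic_survive n x : \1_D x * survive n x = survive n x.
Proof.
have idem : \1_D x * \1_D x = \1_D x :> R.
  by rewrite indicE; case: (_ \in _); rewrite ?mulr1 ?mulr0.
by case: n => [|n] //=; rewrite mulrA idem.
Qed.

(** Each use of the Markov property, with the past indicators as test functions, turns one step of
    [survive] into a further factor of the product; hence the induction on [n] with [m] free. *)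
Lemma survive_shift x m n :
  (\int[P x]_w ((\prod_(i < m.+1) \1_D (Z (i%:R * e) w)) * survive n (Z (m%:R * e) w))%:E =
   \int[P x]_w (\prod_(i < (m + n).+1) \1_D (Z (i%:R * e) w))%:E)%E.
Proof.
elim: n m => [|n IH] m.
  apply: eq_integral => w _; rewrite addn0 big_ord_recr /= -mulrA.
  by rewrite (indic_survive 0).
have idem w : (\prod_(i < m.+1) \1_D (Z (i%:R * e) w)) * survive n.+1 (Z (m%:R * e) w) =
    (\prod_(i < m.+1) \1_D (Z (i%:R * e) w)) * Psg P Z e (survive n) (Z (m%:R * e) w) :> R.
  rewrite big_ord_recr /= -!mulrA; congr (_ * _).
  by rewrite mulrA; congr (_ * _); rewrite indicE; case: (_ \in _); rewrite ?mulr1 ?mulr0.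
under eq_integral do rewrite idem.
have := @Hmarkov x m.+1 (m%:R * e) e (fun i => i%:R * e) (fun=> \1_D) (survive n) _ e0.
rewrite /= => <-.
- rewrite -addSnnS -IH; apply: eq_integral => w _.
  rewrite [in RHS]big_ord_recr /= -mulrA indic_survive.
  by congr (_ * survive n (Z _ w))%:E; rewrite -[m.+1]addn1 natrD mulrDl mul1r.
- by rewrite mulr_ge0.
- by move=> i; rewrite mulr_ge0//= ler_wpM2r// ler_nat -ltnS.
- by move=> _; exact: indic_bmeas.
- exact: survive_bmeas.
Qed.

Lemma prod_indic_grid n w :
  \prod_(i < n.+1) \1_D (Z (i%:R * e) w) = \1_(grid Z e n D) w :> R.
Proof.
have [h|h] := pselect (grid Z e n D w).
  rewrite indicE mem_set// big1// => i _; rewrite indicE mem_set//.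
  by apply: h; rewrite -ltnS.
rewrite indicE memNset//.
have /existsNP[i /not_implyP[iN nD]] := h.
rewrite (bigD1 (Ordinal (iN : (i < n.+1)%N)))//= indicE memNset ?mul0r//.
Qed.

Lemma grid_survive x n : P x (grid Z e n D) = (survive n x)%:E.
Proof.
have mG := measurable_grid HZmeas n e0 mD.
have := survive_shift x 0 n; rewrite add0n.
under [RHS]eq_integral do rewrite prod_indic_grid.
rewrite integral_indic// setIT => <-.
have mx := measurable_start HZmeas x.
have [mS bS] := surviveP n.
rewrite mul0r.
transitivity (\int[P x]_w (cst (survive n x)%:E w))%E; last first.
  by rewrite integral_cst_prob.
apply: ge0_ae_eq_integral => //.
- apply/measurable_EFinP; apply: measurable_funM.
    under eq_fun do rewrite big_ord1 /= mul0r.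
    by apply: measurable_fun_Z => //; exact: measurable_indic.
  exact: measurable_fun_Z.
- move=> w _; rewrite lee_fin mulr_ge0//; last by case/andP: (bS (Z 0 w)).
  by apply: prodr_ge0 => i _; rewrite indicE.
- by move=> w _; rewrite lee_fin; case/andP: (bS x).
- exists (~` [set w | Z 0 w = x]); split.
  + exact: measurableC.
  + exact: (probability_setC0 mx (HZ0 x)).
  + move=> w /=; apply: contra_not => Zx _.
    by rewrite big_ord1 /= mul0r indic_survive Zx.
Qed.

Lemma grid_markov x m n : P x (grid Z e (m + n) D) =
  (\int[P x]_(w in grid Z e m D) P (Z (m%:R * e) w) (grid Z e n D))%E.
Proof.
have mG k := measurable_grid HZmeas k e0 mD.
transitivity (\int[P x]_w (\1_(grid Z e (m + n) D) w)%:E)%E.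
  by rewrite integral_indic ?setIT//; exact: mG.
under eq_integral do rewrite -prod_indic_grid.
rewrite -survive_shift [RHS]integral_mkcond; apply: eq_integral => w _.
rewrite patchE prod_indic_grid grid_survive indicE.
by case: ifP => _; rewrite ?mul1r ?mul0r.
Qed.

End Discrete.

Section Continuous.
Variables (u : R) (u0 : 0 < u).

Let step N : 0 < u / 2 ^+ N. Proof. by rewrite divr_gt0// exprn_gt0. Qed.

Lemma measurable_prob_Z t A : 0 <= t -> measurable A ->
  measurable_fun setT (fun w => P (Z t w) A).
Proof. by move=> t0 mA; apply: (measurable_fun_Ze t0 (HPmeas mA)). Qed.

(** Staying in [D] implies every grid event, so [grid_markov] bounds the left side by the grid
    probability at each level [N]; these decrease to the right side. *)
Lemma stays_markov x a b D : closed D ->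
  (\int[P x]_(w in stays Z (a%:R * u)%R D) P (Z (a%:R * u)%R w) (stays Z (b%:R * u)%R D) <=
   P x (stays Z ((a + b)%:R * u)%R D))%E.
Proof.
move=> cD; have mD := measurable_closed cD.
have mS n := measurable_stays HZmeas HZcont n u0 cD.
have mG N n : measurable (grid Z (u / 2 ^+ N) n D) by apply: measurable_grid => //; exact: ltW.
have ht n : 0 <= n%:R * u by rewrite mulr_ge0// ltW.
rewrite [X in (_ <= P x X)%E]staysE//.
have := @nonincreasing_cvg_mu _ _ _ (P x) (fun N => grid Z (u / 2 ^+ N) ((a + b) * 2 ^ N) D).
move=> /(_ _ _ _ _) c; apply: (cvge_ge _ (c _ _ _ _)).
- apply: nearW => N /=; rewrite mulnDl grid_markov//; last exact: ltW.
  have -> : (a * 2 ^ N)%:R * (u / 2 ^+ N) = a%:R * u.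
    by rewrite natrM natrX mulrACA divff ?mulr1// expf_neq0.
  apply: (@le_trans _ _ (\int[P x]_(w in stays Z (a%:R * u)%R D)
      P (Z (a%:R * u)%R w) (grid Z (u / 2 ^+ N) (b * 2 ^ N) D))%E).
    apply: ge0_le_integral => //.
    + by apply: measurable_funTS; exact: measurable_prob_Z.
    + by apply: measurable_funTS; exact: measurable_prob_Z.
    + move=> w _; apply: le_measure; rewrite ?inE//.
      by rewrite staysE// => w'; apply.
  apply: ge0_subset_integral => //.
  + by apply: measurable_funTS; exact: measurable_prob_Z.
  + by rewrite staysE// => w'; apply.
- by rewrite (le_lt_trans (probability_le1 _ _))// ltry.
- by move=> N.
- by apply: bigcapT_measurable.
- by apply/nonincreasing_seqP => N; apply/subsetPset; exact: grid_nd.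
Qed.

(** The complement of [C] is exhausted by the closed sets [away C k], for which [stays_markov]
    holds; two monotone limits follow. *)
Lemma nohit_markov x a b C : closed C ->
  (\int[P x]_(w in stays Z (a%:R * u)%R (~` C)) P (Z (a%:R * u)%R w) (stays Z (b%:R * u)%R (~` C)) <=
   P x (stays Z ((a + b)%:R * u)%R (~` C)))%E.
Proof.
move=> cC.
have mS n k : measurable (stays Z (n%:R * u) (away C k)).
  by apply: measurable_stays => //; exact: closed_away.
have mN n : measurable (stays Z (n%:R * u) (~` C)) by exact: measurable_nohit.
have ht n : 0 <= n%:R * u by rewrite mulr_ge0// ltW.
have nd n i j : (i <= j)%N -> stays Z (n%:R * u) (away C i) `<=` stays Z (n%:R * u) (away C j).
  by move=> ij w h r rT; exact: away_nd (h r rT).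
have sub n k : stays Z (n%:R * u) (away C k) `<=` stays Z (n%:R * u) (~` C).
  by move=> w h r rT; exact: away_sub (h r rT).
(* The outer level [j] is fixed while the inner level [k >= j] tends to infinity; the limit in [j]
   comes afterwards. *)
have step1 j : (\int[P x]_(w in stays Z (a%:R * u)%R (away C j))
    P (Z (a%:R * u)%R w) (stays Z (b%:R * u)%R (~` C)) <=
    P x (stays Z ((a + b)%:R * u)%R (~` C)))%E.
  have := @cvg_monotone_convergence _ _ _ (P x) _ (mS a j)
    (fun k w => P (Z (a%:R * u)%R w) (stays Z (b%:R * u)%R (away C k))) _ _ _.
  move=> /(_ _ _ _) c.
  have lE w : limn (fun k => P (Z (a%:R * u)%R w) (stays Z (b%:R * u)%R (away C k))) =
      P (Z (a%:R * u)%R w) (stays Z (b%:R * u)%R (~` C)).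
    apply/cvg_lim => //; rewrite stays_away//; apply: nondecreasing_cvg_mu => //.
      by rewrite -stays_away.
    by move=> i k ik; apply/subsetPset; exact: nd.
  rewrite -(eq_integral _ _ (fun w _ => lE w)).
  apply: (cvge_le _ (c _ _ _)).
  - exists j => // k /= jk.
    have hk := stays_markov x a b (@closed_away _ _ C k).
    apply: le_trans (le_trans _ hk) _.
      apply: ge0_subset_integral => //; last exact: nd.
      by apply: measurable_funTS; exact: measurable_prob_Z.
    by apply: le_measure; rewrite ?inE.
  - by move=> k; apply: measurable_funTS; exact: measurable_prob_Z.
  - by [].
  - by move=> w _ i k ik; apply: le_measure; rewrite ?inE//; exact: nd.
have dE := stays_away HZcont (a%:R * u) cC.
rewrite [X in integral _ X _]dE.
have := @ge0_nondecreasing_set_cvg_integral _ _ _ (fun k => stays Z (a%:R * u)%R (away C k))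
  (fun w => P (Z (a%:R * u)%R w) (stays Z (b%:R * u)%R (~` C))) (P x).
move=> /(_ _ _ _ _) c; apply: (cvge_le _ (c _ _ _ _)).
- exact: nearW.
- by move=> i k ik; apply/subsetPset; exact: nd.
- by move=> k.
- by move=> k; apply: measurable_funTS; exact: measurable_prob_Z.
- by [].
Qed.

End Continuous.
End Markov.

Lemma le_measure_null d (T : measurableType d) (R : realType)
  (m : {measure set T -> \bar R}) (A B N : set T) :
  measurable A -> measurable B -> measurable N -> m N = 0%E -> A `<=` B `|` N ->
  (m A <= m B)%E.
Proof.
move=> mA mB mN N0 AB; rewrite -(measureU0 mB mN N0).
by apply: le_measure; rewrite ?inE//; exact: measurableU.
Qed.

Section Mixture.
Context {d d' : measure_display} {X : measurableType d} {Y : measurableType d'} {R : realType}.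
Variables (k : X -> {measure set Y -> \bar R}) (m : {measure set X -> \bar R}) (E : set X).

(** The law of the path started from [m] restricted to [E]: a single finite measure to which
    capacitability applies. The two proofs are arguments so that the measure structure can be
    attached to it. *)
Definition mixture of (forall A, measurable A -> measurable_fun setT (fun x => k x A))
    & measurable E :=
  fun A : set Y => (\int[m]_(x in E) k x A)%E.

Variables (mk : forall A, measurable A -> measurable_fun setT (fun x => k x A))
  (mE : measurable E).

Let mixture0 : mixture mk mE set0 = 0%E.
Proof. by rewrite /mixture integral0_eq// => x _; rewrite measure0. Qed.

Let mixture_ge0 A : (0 <= mixture mk mE A)%E.
Proof. by apply: integral_ge0 => x _. Qed.

Let mixture_sigma_additive : semi_sigma_additive (mixture mk mE).
Proof.
move=> F mF tF mUF; rewrite /mixture.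
rewrite (_ : (\int[m]_(x in E) k x (\bigcup_n F n))%E =
    (\sum_(0 <= i <oo) \int[m]_(x in E) k x (F i))%E).
  by apply: is_cvg_nneseries => n _ _; exact: integral_ge0.
rewrite -integral_nneseries//.
  apply: eq_integral => x _; symmetry; apply/cvg_lim => //.
  exact: measure_semi_sigma_additive.
by move=> n; apply: measurable_funTS; exact: mk.
Qed.

HB.instance Definition _ := isMeasure.Build d' Y R (mixture mk mE)
  mixture0 mixture_ge0 mixture_sigma_additive.

End Mixture.

(** * Supermultiplicativity of the survival probability *)

Section Killed.
Context {R : realType} {H : normedModType R}.
Context {dO : measure_display} {Omega : measurableType dO}.
Variables (P : H -> probability Omega R) (Z : R -> Omega -> H).
Hypothesis HZmeas : forall t, 0 <= t -> measurable_fun setT (Z t : Omega -> BH H).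
Hypothesis HPmeas : forall A : set Omega, measurable A ->
  measurable_fun [set: BH H] (fun x : BH H => P x A).
Hypothesis HZcont : forall w, {within [set t : R | 0 <= t], continuous (fun t => Z t w)}.
Hypothesis HZ0 : forall x : H, P x [set w | Z 0 w = x] = 1%E.
Hypothesis Hmarkov : markov_property P Z.
Variables (mu : probability (BH H) R) (E : set H).
Hypothesis HEmeas : measurable (E : set (BH H)).
Hypothesis Htaumeas : forall t : R, measurable [set w | (t%:E < tau Z E w)%E].

Definition alive (t : R) := [set w | (t%:E < tau Z E w)%E].

(** The killed semigroup on nonnegative extended functions. Unlike [Qsg] it applies no [fine], so
    monotone limits and infinite values cause no trouble. *)
Definition Qe (t : R) (f : BH H -> \bar R) (x : H) : \bar R :=
  (\int[P x]_(w in alive t) f (Z t w))%E.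

Lemma measurable_alive t : measurable (alive t).
Proof. exact: Htaumeas. Qed.

Lemma alive_in t w s : alive t w -> 0 < s <= t -> E (Z s w).
Proof.
move=> aw /andP[s0 st]; apply: contrapT => nE; move: aw; rewrite /alive/= ltNge.
move/negP; apply; apply: (@le_trans _ _ s%:E); last by rewrite lee_fin.
by apply: ereal_inf_lbound; exists s.
Qed.

(** Staying in [E] up to [T] gives only [T <= tau]; the margin [t < T] makes the inequality
    strict. *)
Lemma stays_alive t T w : t < T -> stays Z T E w -> alive t w.
Proof.
move=> tT sw; apply: (@lt_le_trans _ _ T%:E); first by rewrite lte_fin.
apply: le_ereal_inf_tmp => _ [s [s0 nE] <-]; rewrite lee_fin leNgt; apply/negP => sT.
by apply: nE; apply: sw; rewrite !ltW.
Qed.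

Lemma alive_nd s t : s <= t -> alive t `<=` alive s.
Proof. by move=> st w; apply: le_lt_trans; rewrite lee_fin. Qed.

Let mN x := measurableC (measurable_start HZmeas x).

Let N0 x : P x (~` [set w | Z 0 w = x]) = 0%E.
Proof. exact: probability_setC0 (measurable_start HZmeas x) (HZ0 x). Qed.

Lemma alive_stays t x w : E x -> Z 0 w = x -> alive t w -> stays Z t E w.
Proof.
move=> Ex Zx aw r /andP[r0 rt]; move: r0; rewrite le_eqVlt => /predU1P[<-|r0].
  by rewrite Zx.
by apply: alive_in aw _; rewrite r0.
Qed.

Lemma le_alive_nohit t x C : E x -> C `<=` ~` E -> measurable (stays Z t (~` C)) ->
  (P x (alive t) <= P x (stays Z t (~` C)))%E.
Proof.
move=> Ex CE mS; apply: (le_measure_null (N := ~` [set w | Z 0 w = x])) => //.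
- exact: measurable_alive.
- exact: N0.
- move=> w aw; have [Zx|] := pselect (Z 0 w = x); last by right.
  left=> r rt Cr; exact: (CE _ Cr) (alive_stays Ex Zx aw rt).
Qed.

Lemma measurable_Qe t f : 0 <= t -> (forall x, (0 <= f x)%E) -> measurable_fun setT f ->
  measurable_fun [set: BH H] (Qe t f : BH H -> \bar R).
Proof.
move=> t0 f0 mf; rewrite /Qe.
under eq_fun do rewrite integral_mkcond.
apply: (measurable_integral_kernel HPmeas); first exact: erestrict_ge0.
apply: (measurable_restrictT _ (measurable_alive t)).1.
by apply: measurable_funTS; exact: (measurable_fun_Ze HZmeas t0 mf).
Qed.

(** Survival implies avoiding [C], before the intermediate time and after it. Since [a > 0],
    survival also places the path in [E] at the intermediate time, from which the second comparison
    starts. *)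
Lemma Qe_alive_le_nohit (u : R) a b C x : 0 < u -> closed C -> C `<=` ~` E -> E x ->
  (0 < a)%N ->
  (Qe (a%:R * u) (fun y => P y (alive (b%:R * u))) x <=
   P x (stays Z ((a + b)%:R * u)%R (~` C)))%E.
Proof.
move=> u0 cC CE Ex a0; have au0 : 0 < a%:R * u by rewrite mulr_gt0// ltr0n.
have mN' n : measurable (stays Z (n%:R * u) (~` C)) by exact: measurable_nohit.
apply: le_trans (nohit_markov HZmeas HPmeas HZcont HZ0 Hmarkov u0 x a b cC).
have mA t := measurable_alive t.
have mf : measurable_fun (alive (a%:R * u))
    (fun w => P (Z (a%:R * u) w) (alive (b%:R * u))).
  by apply: measurable_funTS; apply: (measurable_prob_Z HZmeas HPmeas) => //; exact: ltW.
(* Discard the null event [Z 0 <> x]: on the rest [E x] takes care of time 0, which [alive] does not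
   see. *)
rewrite /Qe (ge0_negligible_integral (mN x) _ mf _ (N0 x))//.
have mD : measurable (alive (a%:R * u) `\` ~` [set w | Z 0 w = x]) by exact: measurableD.
apply: (@le_trans _ _ (\int[P x]_(w in alive (a%:R * u) `\` ~` [set w | Z 0 w = x])
   P (Z (a%:R * u)%R w) (stays Z (b%:R * u)%R (~` C)))%E).
  apply: ge0_le_integral => //.
  - by apply: measurable_funTS; apply: (measurable_prob_Z HZmeas HPmeas) => //; exact: ltW.
  - by apply: measurable_funTS; apply: (measurable_prob_Z HZmeas HPmeas) => //; exact: ltW.
  - move=> w [aw _]; apply: le_alive_nohit => //.
    by apply: (alive_in aw); rewrite au0 lexx.
apply: ge0_subset_integral => //.
  by apply: measurable_funTS; apply: (measurable_prob_Z HZmeas HPmeas) => //; exact: ltW.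
move=> w [aw /= /contrapT Zx] r rt Cr; exact: (CE _ Cr) (alive_stays Ex Zx aw rt).
Qed.

(* Capacitability replaces the complement of [E] by a closed subset with the same
   hitting event up to a small mass, and the hitting event of a closed set is
   determined by countably many times. *)
Lemma alive_super_step n m :
  {ae mu, forall x, E x ->
    (Qe 1 (fun y => P y (alive (n%:R + m.+1%:R^-1))) x <= P x (alive (n%:R + 1)))%E}.
Proof.
(* With this mesh, the times [1], [n + u] and [n + 1 + u] are all integer multiples of [u]. *)
pose u : R := m.+1%:R^-1; have u0 : 0 < u by rewrite invr_gt0.
pose b := (n * m.+1 + 1)%N.
have e1 : 1 = m.+1%:R * u by rewrite divff.
have eb : n%:R + u = b%:R * u by rewrite natrD mulrDl mul1r natrM mulfK.
have eT : (m.+1 + b)%:R * u = n%:R + 1 + u.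
  by rewrite natrD mulrDl -e1 -eb addrA (addrC 1).
have mA t := measurable_alive t.
pose h (x : BH H) := Qe 1 (fun y => P y (alive (n%:R + u))) x.
pose f (x : BH H) := P x (alive (n%:R + 1)).
have mh : measurable_fun setT h by apply: measurable_Qe => //; exact: HPmeas.
have mf : measurable_fun setT f by exact: HPmeas.
have ff x : f x \is a fin_num by exact: fin_num_measure.
(* The amount by which the inequality fails; its integral over [E] is shown to be below every
   [e > 0]. *)
pose g x := maxe (h x - f x)%E 0%E.
have mg : measurable_fun setT g.
  by apply: measurable_maxe => //; apply: emeasurable_funB.
have g0 x : (0 <= g x)%E by rewrite /g le_max lexx orbT.
pose M := [the {measure set Omega -> \bar R} of
  @mixture _ _ (BH H) Omega R (fun x : BH H => P x : {measure set Omega -> \bar R})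
    mu E HPmeas HEmeas].
have Mfin : (M setT < +oo)%E.
  rewrite [ltLHS](_ : _ = (\int[mu]_(x in E) cst 1 x)%E).
    rewrite integral_cst// mul1e; apply: le_lt_trans (ltry 1).
    exact: probability_le1.
  by apply: eq_integral => x _; exact: probability_setT.
have geps e : 0 < e -> (\int[mu]_(x in E) g x <= e%:E)%E.
  move=> e0.
  have T0 : 0 < (m.+1 + b)%:R * u by rewrite mulr_gt0// ltr0n.
  have hmeas C : closed C -> measurable (hit Z ((m.+1 + b)%:R * u) C).
    move=> cC; rewrite -[X in measurable X]setCK setC_hit; apply: measurableC.
    exact: measurable_nohit.
  (* A path dead at time [n + 1] has left [E] by time [n + 1 + u]; the extra [u] is the margin of
     [stays_alive]. *)
  have YA : ~` alive (n%:R + 1) `<=` hit Z ((m.+1 + b)%:R * u) (~` E).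
    move=> w nw; apply: contrapT => nh; apply: nw.
    have : stays Z ((m.+1 + b)%:R * u) (~` ~` E) w by rewrite -setC_hit.
    by rewrite setCK; apply: stays_alive; rewrite eT ltrDl.
  have [K [cK KE MK]] := @capacitable _ _ _ M H (hit Z ((m.+1 + b)%:R * u)) Mfin
    (@hit_mono _ _ _ _ Z _) (@hit_bigcup _ _ _ _ Z _) hmeas
    (@hit_bigcap _ _ _ _ Z HZcont _) _ (measurableC (mA (n%:R + 1))) (~` E) e
    (borel_suslin (measurableC HEmeas)) YA e0.
  apply: le_trans MK.
  have mYK : measurable (~` alive (n%:R + 1) `\` hit Z ((m.+1 + b)%:R * u) K).
    by apply: measurableD; [exact: measurableC|exact: hmeas].
  apply: ge0_le_integral => //.
  - exact: measurable_funTS.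
  - by apply: measurable_funTS; exact: HPmeas.
  (* A path avoiding [K] is either alive at [n + 1] or dead without having hit [K], and the mixture
     gives the latter event mass at most [e]. *)
  - move=> x Ex; rewrite /g ge_max measure_ge0 andbT leeBlDl//.
    have := Qe_alive_le_nohit b u0 cK KE Ex (ltn0Sn m).
    rewrite -e1 -eb => /le_trans; apply.
    apply: (@le_trans _ _ (P x (alive (n%:R + 1) `|`
       (~` alive (n%:R + 1) `\` hit Z ((m.+1 + b)%:R * u) K)))).
      apply: le_measure; rewrite ?inE.
      + exact: measurable_nohit.
      + exact: measurableU.
      + move=> w sw; have [aw|naw] := pselect (alive (n%:R + 1) w); [by left|right].
        by split=> //; rewrite -setC_hit in sw.
    exact: measureU2.
have gE0 : (\int[mu]_(x in E) `|g x| = 0)%E.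
  apply/eqP; rewrite eq_le; apply/andP; split; last by apply: integral_ge0.
  apply/lee_addgt0Pr => e e0; rewrite add0e.
  by under eq_integral do rewrite gee0_abs//; exact: geps.
have mgE : measurable_fun (E : set (BH H)) g by exact: measurable_funTS.
have [N [mN0 mu0 hN]] := (ae_eq_integral_abs mu HEmeas mgE).1 gE0.
exists N; split=> //; apply: subset_trans hN; apply: subsetC => x hx Ex.
have := hx Ex; rewrite /g /= => gx.
have : (h x - f x <= 0)%E by rewrite -gx le_max lexx.
by rewrite sube_le0.
Qed.

(** As [m] grows, [alive (n + 1 / (m + 1))] increases to [alive n], because [n < tau] is strict. *)
Lemma alive_super n :
  {ae mu, forall x, E x ->
    (Qe 1 (fun y => P y (alive n%:R)) x <= P x (alive (n%:R + 1)))%E}.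
Proof.
have := ae_foralln (fun m => alive_super_step n m).
apply: filterS => x hx Ex.
have mA t := measurable_alive t.
have nd i j : (i <= j)%N -> alive (n%:R + i.+1%:R^-1) `<=` alive (n%:R + j.+1%:R^-1).
  by move=> ij; apply: alive_nd; rewrite lerD2l lef_pV2 ?posrE// ler_nat ltnS.
have bE : \bigcup_m alive (n%:R + m.+1%:R^-1) = alive n%:R.
  apply/seteqP; split=> w /=.
    by move=> [m _]; apply: alive_nd; rewrite lerDl.
  move=> aw.
  have [r nr ra] : exists2 r : R, n%:R < r & (r%:E < tau Z E w)%E.
    move: aw; rewrite /alive /=; case: (tau Z E w) => [r| |] //=.
      rewrite lte_fin => nr; exists ((n%:R + r) / 2); rewrite ?lte_fin.
        by rewrite midf_lt.
      by rewrite midf_lt.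
    by move=> _; exists (n%:R + 1); rewrite ?ltry// ltrDl.
  have [m hm] : exists m, m.+1%:R^-1 < r - n%:R.
    near \oo => m; exists m; near: m.
    by apply: near_infty_natSinv_lt (PosNum (_ : 0 < r - n%:R)); rewrite subr_gt0.
  exists m => //; apply: le_lt_trans ra; rewrite lee_fin ltW//.
  by rewrite -ltrBrDl.
have := @cvg_monotone_convergence _ _ _ (P x) _ (mA 1)
    (fun m w => P (Z 1 w) (alive (n%:R + m.+1%:R^-1))).
move=> /(_ _ _ _) c.
have lE w : limn (fun m => P (Z 1 w) (alive (n%:R + m.+1%:R^-1))) = P (Z 1 w) (alive n%:R).
  apply/cvg_lim => //; rewrite -bE; apply: nondecreasing_cvg_mu => //.
    by apply: bigcupT_measurable.
  by move=> i k ik; apply/subsetPset; exact: nd.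
rewrite /Qe -(eq_integral _ _ (fun w _ => lE w)).
apply: (cvge_le _ (c _ _ _)).
- by apply: nearW => m; exact: hx.
- by move=> m; apply: measurable_funTS; exact: (measurable_prob_Z HZmeas HPmeas).
- by [].
- by move=> w _ i k ik; apply: le_measure; rewrite ?inE//; exact: nd.
Unshelve. all: by end_near. Qed.

End Killed.

(** * Invariance and compactness *)

Section Integration.
Import HBNNSimple.
Context {d : measure_display} {T : measurableType d} {R : realType}.

Lemma mct_cvg (m : {measure set T -> \bar R}) (D : set T) (g : nat -> T -> \bar R)
  (f : T -> \bar R) : measurable D -> (forall n, measurable_fun D (g n)) ->
  (forall n x, D x -> (0 <= g n x)%E) ->
  (forall x, D x -> forall i j, (i <= j)%N -> (g i x <= g j x)%E) ->
  (forall x, D x -> (fun n => g n x) @ \oo --> f x) ->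
  (fun n => \int[m]_(x in D) g n x)%E @ \oo --> (\int[m]_(x in D) f x)%E.
Proof.
move=> mD mg g0 nd cf.
rewrite (_ : (\int[m]_(x in D) f x)%E = (\int[m]_(x in D) limn (g ^~ x))%E).
  exact: cvg_monotone_convergence.
by apply: eq_integral => x; rewrite inE => Dx; apply/esym/cvg_lim => //; exact: cf.
Qed.

(** Boundedness of the approximants matters: invariance and compactness are assumed for bounded
    functions. *)
Lemma ge0_approx (f : T -> \bar R) : (forall x, (0 <= f x)%E) -> measurable_fun setT f ->
  exists a : nat -> T -> R, [/\ forall n, measurable_fun setT (a n),
    forall n x, 0 <= a n x, forall n, exists M, forall x, a n x <= M,
    forall x i j, (i <= j)%N -> a i x <= a j x &
    forall x, (fun n => (a n x)%:E) @ \oo --> f x].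
Proof.
move=> f0 mf; pose a := nnsfun_approx measurableT mf.
exists (fun n => a n); split.
- by [].
- by [].
- move=> n; have [M [_ hM]] := simple_bounded (a n); exists (M + 1) => x.
  have := hM (M + 1); rewrite ltrDl ltr01 => /(_ isT x I).
  exact: le_trans (ler_norm _).
- move=> x i j ij; have := @nd_nnsfun_approx _ _ _ _ measurableT _ mf i j ij.
  by move=> /lefP.
- move=> x; exact: (@cvg_nnsfun_approx _ _ _ _ measurableT _ mf (fun x _ => f0 x) x I).
Qed.

Lemma cvg_sqe (u : nat -> \bar R) (l : \bar R) : u @ \oo --> l ->
  (fun n => (u n * u n)%E) @ \oo --> (l * l)%E.
Proof.
move=> ul; apply: (cvgeM _ ul ul).
by case: l {ul} => [r| |] //=; rewrite /mule_def/= ?andbF ?orbF//= andbF.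
Qed.

Lemma lee_sq (a b : \bar R) : (0 <= a)%E -> (a <= b)%E -> (a * a <= b * b)%E.
Proof. by move=> a0 ab; apply: lee_pmul. Qed.

Lemma sqe_ge0 (a : \bar R) : (0 <= a)%E -> (0 <= a * a)%E.
Proof. by move=> a0; exact: mule_ge0. Qed.

Lemma measurable_sqe (D : set T) (f : T -> \bar R) : measurable_fun D f ->
  measurable_fun D (fun x => (f x * f x)%E).
Proof. by move=> mf; apply: emeasurable_funM. Qed.

Lemma amgm_e (a : \bar R) (y : R) : (0 <= a)%E -> 0 <= y ->
  ((2 * y)%:E * a <= a * a + (y * y)%:E)%E.
Proof.
case: a => [r| |] //=; last first.
  by move=> _ y0; rewrite mulyy addye// leey.
rewrite lee_fin => r0 y0; rewrite -!EFinM -EFinD lee_fin -subr_ge0.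
by rewrite (_ : _ - _ = (r - y) ^+ 2) ?sqr_ge0//; ring.
Qed.

Lemma integral_amgm (m : {measure set T -> \bar R}) (D : set T) (f : T -> \bar R) (y : R) :
  measurable D -> measurable_fun D f -> (forall x, (0 <= f x)%E) -> 0 <= y ->
  ((2 * y)%:E * \int[m]_(x in D) f x <=
   \int[m]_(x in D) (f x * f x) + (y * y)%:E * m D)%E.
Proof.
move=> mD mf f0 y0.
have y2 : 0 <= 2 * y by rewrite mulr_ge0.
rewrite -ge0_integralZl_EFin// -integral_cst// -ge0_integralD//; first last.
- by move=> x _; rewrite lee_fin mulr_ge0.
- exact: measurable_sqe.
- by move=> x _; exact: sqe_ge0.
apply: ge0_le_integral => //.
- by move=> x _; apply: mule_ge0.
- exact: measurable_funeM.
- by apply: emeasurable_funD => //; exact: measurable_sqe.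
- by move=> x _; exact: amgm_e.
Qed.

(** [integral_amgm] optimised in [y]: the choice [y = X / S] gives the inequality, and [y = 1]
    excludes an infinite [X] beside a finite [V]. *)
Lemma cauchy_schwarz_mass (m : {measure set T -> \bar R}) (D : set T) (f : T -> \bar R) (S : R) :
  measurable D -> measurable_fun D f -> (forall x, (0 <= f x)%E) -> m D = S%:E ->
  ((\int[m]_(x in D) f x) * (\int[m]_(x in D) f x) <=
   S%:E * \int[m]_(x in D) (f x * f x))%E.
Proof.
move=> mD mf f0 mS.
have S0 : 0 <= S by rewrite -lee_fin -mS measure_ge0.
have X0 : (0 <= \int[m]_(x in D) f x)%E by apply: integral_ge0.
have V0 : (0 <= \int[m]_(x in D) (f x * f x))%E.
  by apply: integral_ge0 => x _; exact: sqe_ge0.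
have key := fun y => @integral_amgm m D f y mD mf f0.
rewrite mS in key.
move: S0; rewrite le_eqVlt => /predU1P[S0|S0].
  have -> : (\int[m]_(x in D) f x = 0)%E.
    by rewrite (ge0_negligible_integral mD)// ?setDv ?integral_set0// mS -S0.
  by rewrite mule0 mule_ge0// -S0.
move: X0 V0 key; set V := (\int[m]_(x in D) (_ * _))%E.
set X := (\int[m]_(x in D) _)%E => X0 V0 key.
case: V V0 key => [v| |] //; last first.
  by move=> _ _; rewrite gt0_muley ?lte_fin ?leey.
rewrite lee_fin => v0; case: X X0 => [r| |] //; last first.
  by move=> _ /(_ 1 ler01); rewrite mulr1 gt0_muley ?lte_fin//.
rewrite lee_fin => r0; have rS : 0 <= r / S by rewrite divr_ge0// ltW.
move=> /(_ _ rS).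
rewrite -!EFinM -EFinD !lee_fin.
have : r = r / S * S by rewrite divfK// gt_eqF.
move: (r / S) => z rE h.
have h2 : z * z * S <= v by rewrite rE in h; lra.
by rewrite rE; have := ler_wpM2l (ltW S0) h2; lra.
Qed.

End Integration.

Lemma sqr_le_approx (R : realFieldType) (a b c : R) : 0 <= a -> a <= c ->
  b ^+ 2 <= 2 * c ^+ 2 + 2 * (a - b) ^+ 2.
Proof.
move=> a0 ac; have c0 := le_trans a0 ac.
have : a ^+ 2 <= c ^+ 2 by rewrite ler_sqr.
by have := sqr_ge0 (a + (a - b)); rewrite !expr2; lra.
Qed.

Section Invariant.
Context {R : realType} {H : normedModType R}.
Context {dO : measure_display} {Omega : measurableType dO}.
Variables (P : H -> probability Omega R) (Z : R -> Omega -> H).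
Hypothesis HZmeas : forall t, 0 <= t -> measurable_fun setT (Z t : Omega -> BH H).
Hypothesis HPmeas : forall A : set Omega, measurable A ->
  measurable_fun [set: BH H] (fun x : BH H => P x A).
Variables (mu : probability (BH H) R).
Hypothesis Hinv : forall t f, 0 <= t -> bmeas f ->
     (\int[mu]_x (Psg P Z t f x)%:E = \int[mu]_x (f x)%:E)%E.

Definition Pe (t : R) (f : BH H -> \bar R) (x : H) : \bar R :=
  (\int[P x]_w f (Z t w))%E.

Lemma Pe_ge0 t f x : (forall x, (0 <= f x)%E) -> (0 <= Pe t f x)%E.
Proof. by move=> f0; apply: integral_ge0. Qed.

Lemma measurable_Pe t f : 0 <= t -> (forall x, (0 <= f x)%E) -> measurable_fun setT f ->
  measurable_fun [set: BH H] (Pe t f : BH H -> \bar R).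
Proof.
move=> t0 f0 mf; apply: (measurable_integral_kernel HPmeas) => //.
exact: (measurable_fun_Ze HZmeas t0 mf).
Qed.

Lemma Psg_Pe t (f : BH H -> R) (c : R) x : 0 <= t -> measurable_fun setT f ->
  (forall x, 0 <= f x <= c) -> (Psg P Z t f x)%:E = Pe t (EFin \o f) x.
Proof.
move=> t0 mf fc; have /andP[h1 h2] := @integral_prob_bounded _ _ _ _ P x
  (fun w => f (Z t w)) c (measurable_fun_Z HZmeas t0 mf) (fun w => fc _).
by rewrite /Psg fineK// ge0_fin_numE//; apply: le_lt_trans h2 (ltry _).
Qed.

Lemma ge0_bmeas (f : BH H -> R) (c : R) : measurable_fun setT f ->
  (forall x, 0 <= f x <= c) -> bmeas f.
Proof.
by move=> mf fc; split=> //; exists c => x; have /andP[? ?] := fc x; rewrite ger0_norm.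
Qed.

Lemma Pe_cvg t (a : nat -> BH H -> \bar R) f x : 0 <= t ->
  (forall n, measurable_fun setT (a n)) -> (forall n x, (0 <= a n x)%E) ->
  (forall x i j, (i <= j)%N -> (a i x <= a j x)%E) ->
  (forall x, (fun n => a n x) @ \oo --> f x) ->
  (fun n => Pe t (a n) x) @ \oo --> Pe t f x.
Proof.
move=> t0 ma a0 nd cf; apply: mct_cvg => //.
- by move=> n; exact: (measurable_fun_Ze HZmeas t0 (ma n)).
- by move=> w _ i j ij; exact: nd.
Qed.

Lemma Pe_nd t f g x : 0 <= t -> measurable_fun setT f -> measurable_fun setT g ->
  (forall x, (0 <= f x)%E) -> (forall x, (f x <= g x)%E) -> (Pe t f x <= Pe t g x)%E.
Proof.
move=> t0 mf mg f0 fg; apply: ge0_le_integral => //.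
- exact: (measurable_fun_Ze HZmeas t0 mf).
- exact: (measurable_fun_Ze HZmeas t0 mg).
Qed.

Lemma invariant_ge0 t (f : BH H -> \bar R) : 0 <= t -> (forall x, (0 <= f x)%E) ->
  measurable_fun setT f -> (\int[mu]_x Pe t f x = \int[mu]_x f x)%E.
Proof.
move=> t0 f0 mf; have [a [ma a0 aM nda ca]] := ge0_approx f0 mf.
pose b n x := (a n x)%:E.
have mb n : measurable_fun setT (b n) by exact/measurable_EFinP.
have b0 n x : (0 <= b n x)%E by rewrite lee_fin.
have ndb x i j : (i <= j)%N -> (b i x <= b j x)%E by move=> ij; rewrite lee_fin; exact: nda.
have eqn n : (\int[mu]_x Pe t (b n) x = \int[mu]_x b n x)%E.
  have [M hM] := aM n.
  have aM' x : 0 <= a n x <= M by rewrite a0 hM.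
  rewrite -(Hinv t0 (ge0_bmeas (ma n) aM')); apply: eq_integral => x _.
  by rewrite (Psg_Pe x t0 (ma n) aM').
have c1 : (fun n => \int[mu]_x Pe t (b n) x)%E @ \oo --> (\int[mu]_x Pe t f x)%E.
  apply: mct_cvg => //.
  - by move=> n; exact: measurable_Pe.
  - by move=> n x _; exact: Pe_ge0.
  - by move=> x _ i j ij; apply: Pe_nd => // y; exact: ndb.
  - by move=> x _; apply: Pe_cvg.
have c2 : (fun n => \int[mu]_x b n x)%E @ \oo --> (\int[mu]_x f x)%E.
  apply: mct_cvg => //.
  - by move=> x _ i j ij; exact: ndb.
  - by move=> x _; exact: ca.
have eqf : (fun n => \int[mu]_x Pe t (b n) x)%E = (fun n => \int[mu]_x b n x)%E.
  exact/funext.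
rewrite eqf in c1.
exact: etrans (esym (cvg_lim (@ereal_hausdorff R) c1)) (cvg_lim (@ereal_hausdorff R) c2).
Qed.

Lemma Pe_sq t f x : 0 <= t -> (forall x, (0 <= f x)%E) -> measurable_fun setT f ->
  (Pe t f x * Pe t f x <= Pe t (fun y => f y * f y) x)%E.
Proof.
move=> t0 f0 mf; rewrite -[leRHS]mul1e.
apply: cauchy_schwarz_mass => //; first exact: (measurable_fun_Ze HZmeas t0 mf).
exact: probability_setT.
Qed.

(** Since [fine] sends an infinite integral to 0, a small [L2n] is informative only once the
    integral is known to be finite; boundedness of [v] ensures it. *)
Lemma L2n_lt (v : BH H -> R) (D : set (BH H)) (c e : R) : measurable D ->
  measurable_fun setT v -> (forall x, `|v x| <= c) -> 0 <= e -> L2n mu D v < e ->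
  (\int[mu]_(x in D) (v x ^+ 2)%:E <= (e ^+ 2)%:E)%E.
Proof.
move=> mD mv vc e0; rewrite /L2n.
have I0 : (0 <= \int[mu]_(x in D) (v x ^+ 2)%:E)%E.
  by apply: integral_ge0 => x _; rewrite lee_fin sqr_ge0.
have Ifin : (\int[mu]_(x in D) (v x ^+ 2)%:E)%E \is a fin_num.
  rewrite ge0_fin_numE//; apply: (@le_lt_trans _ _ (\int[mu]_(x in D) cst (c ^+ 2)%:E x)%E).
    apply: ge0_le_integral => //.
    - by move=> x _; rewrite lee_fin sqr_ge0.
    - by apply: measurable_funTS; apply/measurable_EFinP; exact: measurable_funX.
    - by move=> x _; rewrite lee_fin -(real_normK (num_real (v x))) ler_sqr ?nnegrE// (le_trans _ (vc x)).
  rewrite integral_cst//; apply: (@le_lt_trans _ _ ((c ^+ 2)%:E * 1)%E); last by rewrite mule1 ltry.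
  by apply: lee_wpmul2l; [rewrite lee_fin sqr_ge0|exact: probability_le1].
rewrite -{2}(fineK Ifin) lee_fin => h.
rewrite -(@sqr_sqrtr _ (fine _)) ?fine_ge0// ler_sqr ?nnegrE ?sqrtr_ge0//; exact: ltW.
Qed.

Section Compact.
Hypothesis Hcompact : forall t (u : nat -> BH H -> R), 0 < t ->
     (forall n, bmeas (u n) /\ L2n mu setT (u n) <= 1) ->
     exists s : nat -> nat, (forall n, (s n < s n.+1)%N) /\
       forall e : R, 0 < e -> exists N, forall m n, (N <= m)%N -> (N <= n)%N ->
         L2n mu setT (fun x => Psg P Z t (u (s m)) x - Psg P Z t (u (s n)) x) < e.
Variables (t : R) (F : nat -> set (BH H)).
Hypotheses (t0 : 0 < t) (mF : forall k, measurable (F k)).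
Hypothesis F0 : (fun k => mu (F k)) @ \oo --> 0%E.

Let t0' := ltW t0.

(* A sequence violating the bound for every k would, after normalization, have a
   subsequence with convergent image, hence one uniformly close to a single bounded
   function, whose mass on F k tends to 0. *)
Lemma compact_small_bounded (e : R) : 0 < e -> exists k, forall (h : BH H -> R) c,
  measurable_fun setT h -> (forall x, 0 <= h x <= c) ->
  (\int[mu]_(x in F k) (Psg P Z t h x ^+ 2)%:E <= e%:E * \int[mu]_x (h x ^+ 2)%:E)%E.
Proof.
move=> e0; apply: contrapT => /forallNP nh.
have {nh} /choice[p hp] : forall k, exists p : (BH H -> R) * R,
   [/\ measurable_fun setT p.1, forall x, 0 <= p.1 x <= p.2 &
    (e%:E * \int[mu]_x (p.1 x ^+ 2)%:E < \int[mu]_(x in F k) (Psg P Z t p.1 x ^+ 2)%:E)%E].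
  move=> k; have /existsNP[h /existsNP[c /not_implyP[mh /not_implyP[hc]]]] := nh k.
  by move=> /negP; rewrite -ltNge => ?; exists (h, c).
pose h k := (p k).1; pose c k := (p k).2.
have mh k : measurable_fun setT (h k) by case: (hp k).
have hc k x : 0 <= h k x <= c k by case: (hp k) => _ + _; exact.
have hlt k : (e%:E * \int[mu]_x (h k x ^+ 2)%:E <
   \int[mu]_(x in F k) (Psg P Z t (h k) x ^+ 2)%:E)%E by case: (hp k).
have h0 k x : 0 <= h k x by case/andP: (hc k x).
have msq (f : BH H -> R) : measurable_fun setT f -> measurable_fun setT (fun x => (f x ^+ 2)%:E).
  by move=> mf; apply/measurable_EFinP; exact: measurable_funX.
have I0 (D : set (BH H)) (f : BH H -> R) : (0 <= \int[mu]_(x in D) (f x ^+ 2)%:E)%E.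
  by apply: integral_ge0 => x _; rewrite lee_fin sqr_ge0.
have mPsg k : measurable_fun setT (Psg P Z t (h k) : BH H -> R).
  by apply: (measurable_Psg HZmeas HPmeas).
have PsgF k (D : set (BH H)) : measurable D -> (\int[mu]_(x in D) (Psg P Z t (h k) x ^+ 2)%:E <=
    \int[mu]_x (h k x ^+ 2)%:E)%E.
  move=> mD; apply: (@le_trans _ _ (\int[mu]_x (Psg P Z t (h k) x ^+ 2)%:E)%E).
    apply: ge0_subset_integral => //; first exact: msq.
    by move=> x _; rewrite lee_fin sqr_ge0.
  rewrite -(@invariant_ge0 t (fun x => (h k x ^+ 2)%:E))//; last 2 first.
  - by move=> x; rewrite lee_fin sqr_ge0.
  - exact: msq.
  apply: ge0_le_integral => //.
  - by move=> x _; rewrite lee_fin sqr_ge0.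
  - exact: msq.
  - apply: measurable_Pe => //; last exact: msq.
    by move=> x; rewrite lee_fin sqr_ge0.
  - move=> x _; rewrite expr2 EFinM (Psg_Pe x t0' (mh k) (hc k)).
    have hE0 y : (0 <= (EFin \o h k) y)%E by rewrite /= lee_fin.
    have mhE : measurable_fun setT (EFin \o h k) by exact/measurable_EFinP.
    have := Pe_sq x t0' hE0 mhE.
    by rewrite (_ : (fun y => _) = (fun y => (h k y ^+ 2)%:E))//; apply/funext.
have Ifin k : (\int[mu]_x (h k x ^+ 2)%:E)%E \is a fin_num.
  rewrite ge0_fin_numE//; apply: (@le_lt_trans _ _ (\int[mu]_x cst (c k ^+ 2)%:E x)%E).
    apply: ge0_le_integral => //.
    - by move=> x _; rewrite lee_fin sqr_ge0.
    - exact: msq.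
    - by move=> x _; rewrite lee_fin; have /andP[? ?] := hc k x; rewrite ler_sqr ?nnegrE// (@le_trans _ _ (h k x)).
  by rewrite integral_cst_prob ltry.
pose q k := Num.sqrt (fine (\int[mu]_x (h k x ^+ 2)%:E)%E).
(* A function of zero norm cannot violate the bound, because [P_t] contracts L2. *)
have q0 k : 0 < q k.
  rewrite sqrtr_gt0 lt_neqAle fine_ge0// andbT; apply/negP => /eqP q0.
  have := hlt k; rewrite ltNge => /negP; apply.
  by rewrite -(fineK (Ifin k)) -q0 mule0; apply: le_trans (PsgF k _ (mF k)) _; rewrite -(fineK (Ifin k)) -q0.
pose u k x := h k x / q k.
have mu_ k : measurable_fun setT (u k) by apply: measurable_funM.
have uc k x : 0 <= u k x <= c k / q k.
  by have /andP[h1 h2] := hc k x; rewrite /u divr_ge0 ?(ltW (q0 k))//= ler_pM2r// invr_gt0.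
have Iu k (D : set (BH H)) (f : BH H -> R) : measurable D -> measurable_fun setT f ->
   (\int[mu]_(x in D) ((f x / q k) ^+ 2)%:E = ((q k)^-1 ^+ 2)%:E * \int[mu]_(x in D) (f x ^+ 2)%:E)%E.
  move=> mD mf; rewrite -ge0_integralZl_EFin//.
  - by apply: eq_integral => x _; rewrite exprMn mulrC EFinM.
  - by move=> x _; rewrite lee_fin sqr_ge0.
  - by apply: measurable_funTS; exact: msq.
  - exact: sqr_ge0.
have qsq k : (q k) ^+ 2 = fine (\int[mu]_x (h k x ^+ 2)%:E)%E by rewrite sqr_sqrtr ?fine_ge0.
have L2u k : L2n mu setT (u k) = 1.
  rewrite /L2n Iu// -(fineK (Ifin k)) -EFinM /= -qsq -exprMn mulVf ?gt_eqF//.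
  by rewrite expr1n sqrtr1.
have Pu k x : Psg P Z t (u k) x = Psg P Z t (h k) x / q k.
  apply/EFin_inj; rewrite (Psg_Pe x t0' (mu_ k) (uc k)) (mulrC (Psg P Z t (h k) x)) EFinM (Psg_Pe x t0' (mh k) (hc k)).
  rewrite /Pe -ge0_integralZl_EFin//.
  - by apply: eq_integral => w _; rewrite /= /u -EFinM mulrC.
  - by move=> w _; rewrite lee_fin.
  - by apply/measurable_EFinP; exact: (measurable_fun_Z HZmeas t0' (mh k)).
  - by rewrite invr_ge0 ltW.
have big k : (e%:E < \int[mu]_(x in F k) (Psg P Z t (u k) x ^+ 2)%:E)%E.
  under eq_integral do rewrite Pu.
  rewrite Iu//; apply: (@le_lt_trans _ _ (((q k)^-1 ^+ 2)%:E * (e%:E * \int[mu]_x (h k x ^+ 2)%:E)))%E.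
    rewrite -(fineK (Ifin k)) -qsq -!EFinM lee_fin mulrCA -exprMn mulVf ?gt_eqF//.
    by rewrite expr1n mulr1.
  by rewrite lte_pmul2l ?lte_fin ?exprn_gt0 ?invr_gt0.
have [|s [sS hs]] := Hcompact (u := u) t0.
  by move=> n; rewrite L2u; split=> //; exact: ge0_bmeas (mu_ n) (uc n).
have sn n : (n <= s n)%N by elim: n => // n IH; apply: leq_ltn_trans IH (sS n).
(* With [B] below bounding the fixed function [P_t u_(s N)], the mass on [F (s n)] is at most
   [2 B^2 eta + 2 d^2 <= e / 2 + e / 4], against [big]. *)
pose d := Num.sqrt (e / 8).
have d0 : 0 < d by rewrite sqrtr_gt0 divr_gt0.
have [N hN] := hs d d0.
pose B := c (s N) / q (s N).
have B0 : 0 <= B by have /andP[h1 h2] := uc (s N) point; exact: le_trans h2.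
pose eta := e / (4 * (B ^+ 2 + 1)).
have eta0 : 0 < eta by rewrite divr_gt0// mulr_gt0// ltr_wpDl// sqr_ge0.
have [n Nn mun] : exists2 n, (N <= n)%N & (mu (F (s n)) <= eta%:E)%E.
  have [K _ hK] : \forall k \near \oo, (mu (F k) < eta%:E)%E.
    have nb : nbhs (0%E : \bar R) [set y : \bar R | (y < eta%:E)%E].
      by apply: open_nbhs_nbhs; split; [exact: open_ereal_lt_ereal|rewrite /= lte_fin].
    exact: (F0 nb).
  exists (maxn N K); first exact: leq_maxl.
  by apply/ltW/hK; rewrite /= (leq_trans _ (sn _))// leq_maxr.
have mPu k : measurable_fun setT (Psg P Z t (u k) : BH H -> R).
  by apply: (measurable_Psg HZmeas HPmeas) => // x; case/andP: (uc k x).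
have Pub k x : 0 <= Psg P Z t (u k) x <= c k / q k.
  exact: (Psg_bounded _ HZmeas x t0' (mu_ k) (uc k)).
pose v x := Psg P Z t (u (s N)) x - Psg P Z t (u (s n)) x.
have mv : measurable_fun setT (v : BH H -> R) by exact: measurable_funB.
have vI : (\int[mu]_x (v x ^+ 2)%:E <= (d ^+ 2)%:E)%E.
  apply: (L2n_lt (c := c (s N) / q (s N) + c (s n) / q (s n))) => //.
  - move=> x; apply: le_trans (ler_normB _ _) _; apply: lerD.
      by have /andP[? ?] := Pub (s N) x; rewrite ger0_norm.
    by have /andP[? ?] := Pub (s n) x; rewrite ger0_norm.
  - exact: ltW.
  - exact: hN.
have := big (s n); rewrite ltNge => /negP; apply.
apply: (@le_trans _ _ (\int[mu]_(x in F (s n)) ((2 * B ^+ 2)%:E + 2%:E * (v x ^+ 2)%:E))%E).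
  apply: ge0_le_integral => //.
  - by move=> x _; rewrite lee_fin sqr_ge0.
  - by apply: measurable_funTS; exact: msq.
  - apply: measurable_funTS; apply: emeasurable_funD => //.
    by apply: measurable_funeM; exact: msq.
  - move=> x _; rewrite -EFinM -EFinD lee_fin /v.
    have /andP[h1 h2] := Pub (s N) x.
    exact: sqr_le_approx h1 h2.
rewrite ge0_integralD//; last 3 first.
- by move=> x _; rewrite lee_fin mulr_ge0// sqr_ge0.
- by move=> x _; rewrite mule_ge0// lee_fin sqr_ge0.
- by apply: measurable_funTS; apply: measurable_funeM; exact: msq.
rewrite integral_cst// ge0_integralZl_EFin//; last 2 first.
- by move=> x _; rewrite lee_fin sqr_ge0.
- by apply: measurable_funTS; exact: msq.
have vI' : (\int[mu]_(x in F (s n)) (v x ^+ 2)%:E <= (d ^+ 2)%:E)%E.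
  apply: le_trans vI; apply: ge0_subset_integral => //; first exact: msq.
  by move=> x _; rewrite lee_fin sqr_ge0.
apply: (@le_trans _ _ ((2 * B ^+ 2)%:E * eta%:E + 2%:E * (d ^+ 2)%:E)%E).
  apply: leeD; apply: lee_wpmul2l => //.
  by rewrite lee_fin mulr_ge0// sqr_ge0.
rewrite -!EFinM -EFinD lee_fin /d sqr_sqrtr; last by rewrite divr_ge0// ltW.
rewrite /eta; have B2 := sqr_ge0 B; move: (B ^+ 2) B2 => z z0.
have w1 : z / (z + 1) <= 1 by rewrite ler_pdivrMr ?mul1r ?lerDl// ltr_wpDl.
have -> : 2 * z * (e / (4 * (z + 1))) = e / 2 * (z / (z + 1)).
  by field; rewrite gt_eqF// ltr_wpDl.
by have := ler_wpM2l (ltW e0) w1; lra.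
Qed.

(** In the bounded case [k] is chosen before the function and its bound, so it passes through a
    monotone limit. *)
Lemma compact_small (e : R) : 0 < e -> exists k, forall h : BH H -> \bar R,
  (forall x, (0 <= h x)%E) -> measurable_fun setT h ->
  (\int[mu]_(x in F k) (Pe t h x * Pe t h x) <= e%:E * \int[mu]_x (h x * h x))%E.
Proof.
move=> e0; have [k hk] := compact_small_bounded e0; exists k => h h0 mh.
have [a [ma a0 aM nda ca]] := ge0_approx h0 mh.
pose b n x := (a n x)%:E.
have mb n : measurable_fun setT (b n) by exact/measurable_EFinP.
have b0 n x : (0 <= b n x)%E by rewrite lee_fin.
have ndb x i j : (i <= j)%N -> (b i x <= b j x)%E by move=> ij; rewrite lee_fin; exact: nda.
have c1 : (fun n => \int[mu]_(x in F k) (Pe t (b n) x * Pe t (b n) x))%E @ \oo -->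
    (\int[mu]_(x in F k) (Pe t h x * Pe t h x))%E.
  apply: mct_cvg => //.
  - by move=> n; apply: measurable_funTS; apply: measurable_sqe; exact: measurable_Pe.
  - by move=> n x _; apply: sqe_ge0; exact: Pe_ge0.
  - move=> x _ i j ij; apply: lee_sq; first exact: Pe_ge0.
    by apply: Pe_nd => // y; exact: ndb.
  - by move=> x _; apply: cvg_sqe; exact: Pe_cvg.
apply: (cvge_le _ c1); apply: nearW => n.
have [M hM] := aM n.
have aM' x : 0 <= a n x <= M by rewrite a0 hM.
have := hk (a n) M (ma n) aM'.
rewrite (_ : (fun x : BH H => (Psg P Z t (a n) x ^+ 2)%:E) =
    (fun x : BH H => (Pe t (b n) x * Pe t (b n) x)%E)); last first.
  by apply/funext => x; rewrite expr2 EFinM (Psg_Pe x t0' (ma n) aM').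
move=> /le_trans; apply; apply: lee_wpmul2l; first by rewrite lee_fin ltW.
apply: ge0_le_integral => //.
- by move=> x _; rewrite lee_fin sqr_ge0.
- by apply/measurable_EFinP; exact: measurable_funX.
- exact: measurable_sqe.
- move=> x _; rewrite expr2 EFinM; apply: lee_sq; first exact: b0.
  apply: (cvge_ge _ (ca x)); exists n => // j /= nj; exact: ndb.
Qed.

End Compact.
End Invariant.

(** * Positive operators and the contribution of their iterates *)

Section Iterates.
Context {d : measure_display} {X : measurableType d} {R : realType}.
Variables (mu : {measure set X -> \bar R}) (E : set X).
Hypothesis mE : measurable E.

Definition nnm (f : X -> \bar R) := (forall x, (0 <= f x)%E) /\ measurable_fun setT f.

Lemma nnm_add f g : nnm f -> nnm g -> nnm (fun x => (f x + g x)%E).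
Proof.
by move=> [f0 mf] [g0 mg]; split; [move=> x; exact: adde_ge0|exact: emeasurable_funD].
Qed.

Lemma nnm_mul f g : nnm f -> nnm g -> nnm (fun x => (f x * g x)%E).
Proof.
by move=> [f0 mf] [g0 mg]; split; [move=> x; exact: mule_ge0|exact: emeasurable_funM].
Qed.

Lemma nnm_cst (c : R) : 0 <= c -> nnm (fun=> c%:E).
Proof. by move=> c0; split; [move=> x; rewrite lee_fin|exact: measurable_cst]. Qed.

Lemma nnm_scale (c : R) f : 0 <= c -> nnm f -> nnm (fun x => (c%:E * f x)%E).
Proof. by move=> c0; apply: nnm_mul; exact: nnm_cst. Qed.

Lemma nnm_restrict f : nnm f -> nnm (f \_ E).
Proof.
move=> [f0 mf]; split; first by apply: erestrict_ge0.
by apply: (measurable_restrictT _ mE).1; exact: measurable_funTS.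
Qed.

(** Beyond pointwise positivity ([nno_le]), [nno_mono] says that [W] ignores null sets; it is what
    allows an almost everywhere inequality to be iterated. *)
Record nn_operator (W : (X -> \bar R) -> X -> \bar R) : Prop := NNOperator {
  nno_nnm : forall f, nnm f -> nnm (W f);
  nno_add : forall f g x, nnm f -> nnm g -> W (fun y => f y + g y)%E x = (W f x + W g x)%E;
  nno_scale : forall (c : R) f x, 0 <= c -> nnm f ->
    W (fun y => c%:E * f y)%E x = (c%:E * W f x)%E;
  nno_le : forall f g x, nnm f -> nnm g -> (forall y, (f y <= g y)%E) -> (W f x <= W g x)%E;
  nno_mono : forall f g, nnm f -> nnm g -> {ae mu, forall x, E x -> (f x <= g x)%E} ->
    {ae mu, forall x, E x -> (W f x <= W g x)%E} }.

Lemma nn_operator_comp W V : nn_operator W -> nn_operator V -> nn_operator (W \o V).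
Proof.
move=> hW hV; split=> /=.
- by move=> f nf; apply: nno_nnm => //; exact: nno_nnm.
- move=> f g x nf ng; rewrite -(nno_add hW); try exact: nno_nnm.
  by congr (W _ x); apply/funext => y; rewrite (nno_add hV).
- move=> c f x c0 nf; rewrite -(nno_scale hW)//; last exact: nno_nnm.
  by congr (W _ x); apply/funext => y; rewrite (nno_scale hV).
- move=> f g x nf ng fg; apply: (nno_le hW); try exact: (nno_nnm hV).
  by move=> y; exact: (nno_le hV).
- move=> f g nf ng fg; apply: (nno_mono hW); try exact: (nno_nnm hV).
  exact: (nno_mono hV).
Qed.

Lemma nn_operator_iter W n : nn_operator W -> nn_operator (iter n W).
Proof.
move=> hW; elim: n => [|n IH]; first by split.
exact: (nn_operator_comp hW IH).
Qed.

Variables (W : (X -> \bar R) -> X -> \bar R) (hW : nn_operator W).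

Lemma iter_L1 (A : R) n f : 0 <= A ->
  (forall f, nnm f -> (\int[mu]_(x in E) W f x <= A%:E * \int[mu]_(x in E) f x)%E) ->
  nnm f -> (\int[mu]_(x in E) iter n W f x <= (A ^+ n)%:E * \int[mu]_(x in E) f x)%E.
Proof.
move=> A0 hA nf; elim: n => [|n IH]; first by rewrite expr0 mul1e.
rewrite iterS exprS EFinM -muleA.
apply: le_trans (hA _ (nno_nnm (nn_operator_iter n hW) nf)) _.
by apply: lee_wpmul2l => //; rewrite lee_fin.
Qed.

Lemma iter_L2 (A : R) n f : 0 <= A ->
  (forall f, nnm f ->
    (\int[mu]_(x in E) (W f x * W f x) <= A%:E * \int[mu]_(x in E) (f x * f x))%E) ->
  nnm f -> (\int[mu]_(x in E) (iter n W f x * iter n W f x) <=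
    (A ^+ n)%:E * \int[mu]_(x in E) (f x * f x))%E.
Proof.
move=> A0 hA nf; elim: n => [|n IH]; first by rewrite expr0 mul1e.
rewrite iterS exprS EFinM -muleA.
apply: le_trans (hA _ (nno_nnm (nn_operator_iter n hW) nf)) _.
by apply: lee_wpmul2l => //; rewrite lee_fin.
Qed.

(** [V] is applied to [2 y f <= th f^2 + y^2 / th]. As [y] is a constant for [V], it may afterwards
    be taken to be a value depending on [x]. *)
Lemma nno_amgm (V : (X -> \bar R) -> X -> \bar R) f (th y : R) x : nn_operator V ->
  0 < th -> nnm f -> 0 <= y ->
  ((2 * y)%:E * V f x <=
   th%:E * V (fun z => f z * f z) x + (y * y / th)%:E * V (fun=> 1) x)%E.
Proof.
move=> hV th0 nf y0.
have n1 : nnm (fun=> 1%E) by apply: nnm_cst.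
have nff := nnm_mul nf nf.
have yy0 : 0 <= y * y / th by rewrite divr_ge0 ?mulr_ge0// ltW.
have na : nnm (fun z => (th%:E * (f z * f z))%E) by apply: nnm_scale => //; exact: ltW.
have nb : nnm (fun=> ((y * y / th)%:E * 1)%E) by exact: nnm_scale.
have y2 : 0 <= 2 * y by rewrite mulr_ge0.
rewrite -(nno_scale hV _ y2 nf) -(nno_scale hV _ (ltW th0) nff).
rewrite -(nno_scale hV _ yy0 n1) -(nno_add hV _ na nb).
apply: (nno_le hV); [exact: nnm_scale|exact: nnm_add|].
move=> z; have f0 := nf.1 z; rewrite mule1; case: (f z) f0 => [a| |] //.
  rewrite lee_fin -!EFinM -EFinD lee_fin => a0.
  rewrite -subr_ge0 (_ : _ - _ = th * (a - y / th) ^+ 2); last by field; rewrite gt_eqF.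
  by rewrite mulr_ge0 ?sqr_ge0// ltW.
by move=> _; rewrite mulyy (@gt0_muley _ th%:E) ?lte_fin// addye// leey.
Qed.

Hypothesis muE1 : (mu E <= 1)%E.

(* Substituting the bound for [phi] into [iter n W phi] once more splits it into a
   bounded part, controlled by [iter n W 1], and a part that is small in L2. *)
Lemma iter_tail_bound (phi B Y G : X -> \bar R) (A r k v w th : R) n :
  1 <= A -> 0 < r -> 0 <= k -> 0 < th ->
  (forall f, nnm f -> (\int[mu]_(x in E) W f x <= A%:E * \int[mu]_(x in E) f x)%E) ->
  (forall f, nnm f -> (\int[mu]_(x in E) (W f x * W f x) <=
     (r ^+ 2)%:E * \int[mu]_(x in E) (f x * f x))%E) ->
  nnm phi -> nnm B -> nnm Y -> nnm G ->
  (forall x, (B x <= (A ^+ n)%:E)%E) ->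
  {ae mu, forall x, E x -> (phi x <= k%:E * B x + iter n W phi x)%E} ->
  {ae mu, forall x, E x -> Y x \is a fin_num} ->
  {ae mu, forall x, E x -> (Y x * Y x * iter n W (fun=> 1) x <= (A ^+ n)%:E * G x)%E} ->
  (\int[mu]_(x in E) (phi x * phi x) <= v%:E)%E -> (\int[mu]_(x in E) G x <= w%:E)%E ->
  (\int[mu]_(x in E) (iter n W phi x * Y x) <=
   (th * (2 * (k ^+ 2 * A ^+ (2 * n)) * r ^+ n + 2 * A ^+ n * r ^+ (2 * n) * v) +
    A ^+ n / th * w)%:E)%E.
Proof.
move=> A1 r0 k0 th0 hA hr nphi nB nY nG BA phiB Yfin YG phiv Gw.
have A0 : 0 <= A by apply: le_trans A1.
have hV := nn_operator_iter n hW.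
set V := iter n W in hV phiB YG *.
have n1 : nnm (fun=> 1%E) by apply: nnm_cst.
have nV f : nnm f -> nnm (V f) by exact: (nno_nnm hV).
have kA0 : 0 <= k * A ^+ n by rewrite mulr_ge0 ?exprn_ge0.
(* A majorant of [phi], from [B <= A ^+ n]; [psi2] then dominates its square by
   [(a + b)^2 <= 2 a^2 + 2 b^2]. *)
pose psi x := ((k * A ^+ n)%:E + V phi x)%E.
have npsi : nnm psi by apply: nnm_add; [exact: nnm_cst|exact: nV].
pose psi2 x := ((2 * (k * A ^+ n) ^+ 2)%:E * 1 + 2%:E * (V phi x * V phi x))%E.
have nVV := nnm_mul (nV _ nphi) (nV _ nphi).
have c20 : 0 <= 2 * (k * A ^+ n) ^+ 2 by rewrite mulr_ge0// sqr_ge0.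
have npsi2 : nnm psi2 by apply: nnm_add; apply: nnm_scale => //.
have phipsi : {ae mu, forall x, E x -> (V phi x <= V psi x)%E}.
  apply: (nno_mono hV) => //; apply: filterS phiB => x h Ex.
  apply: le_trans (h Ex) _; rewrite /psi leeD2r// EFinM.
  by apply: lee_wpmul2l; rewrite ?lee_fin.
have psi2le x : (V (fun z => psi z * psi z) x <= V psi2 x)%E.
  apply: (nno_le hV) => //; first exact: nnm_mul.
  move=> y; rewrite /psi /psi2; have := (nV _ nphi).1 y.
  case: (V phi y) => [a| |] //; last first.
    by move=> _; rewrite mulyy gt0_muley ?lte_fin// addey// leey.
  rewrite lee_fin => a0; rewrite -!EFinM -!EFinD lee_fin.
  rewrite -subr_ge0 mulr1 (_ : _ - _ = (k * A ^+ n - a) ^+ 2) ?sqr_ge0//; ring.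
(* [nno_amgm] with [y = Y x]: the term [Y^2 V 1] is absorbed by [G]. *)
have key : {ae mu, forall x, E x ->
    (V phi x * Y x <= th%:E * V psi2 x + (A ^+ n / th)%:E * G x)%E}.
  apply: filterS2 (filterI phipsi Yfin) YG => x [h1 h2] h3 Ex.
  have {}h1 := h1 Ex; have {}h2 := h2 Ex; have {}h3 := h3 Ex.
  have Y0 := nY.1 x; rewrite -(fineK h2) in h3 Y0 *.
  move: (fine (Y x)) Y0 h3 => y; rewrite lee_fin => y0 h3.
  have := @nno_amgm V psi th y x hV th0 npsi y0.
  have h4 : ((y * y / th)%:E * V (fun=> 1) x <= (A ^+ n / th)%:E * G x)%E.
    rewrite (mulrC (y * y)) (mulrC (A ^+ n)) !(EFinM th^-1) -!muleA.
    by apply: lee_wpmul2l; rewrite ?lee_fin ?invr_ge0 ?(ltW th0)// EFinM.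
  move=> h5; apply: (@le_trans _ _ ((2 * y)%:E * V psi x)%E).
    rewrite muleC; apply: lee_pmul => //.
    - by apply: (nV _ nphi).1.
    - by rewrite lee_fin ler_peMl// ler1n.
  apply: le_trans h5 _; apply: leeD => //.
  by apply: lee_wpmul2l; [rewrite lee_fin ltW|exact: psi2le].
have Iphi : (\int[mu]_(x in E) (V phi x * V phi x) <= ((r ^+ (2 * n)) * v)%:E)%E.
  apply: le_trans (iter_L2 n (sqr_ge0 r) hr nphi) _.
  rewrite -exprM EFinM; apply: lee_wpmul2l => //.
  by rewrite lee_fin exprn_ge0// ltW.
have V1 : (\int[mu]_(x in E) V (fun=> 1) x <= (r ^+ n)%:E)%E.
  have fE : mu E \is a fin_num by rewrite ge0_fin_numE// (le_lt_trans muE1)// ltry.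
  have mS : mu E = (fine (mu E))%:E by rewrite fineK.
  have := cauchy_schwarz_mass mE (measurable_funTS (nV _ n1).2) (nV _ n1).1 mS.
  have := iter_L2 n (sqr_ge0 r) hr n1.
  have -> : (\int[mu]_(x in E) (1 * 1) = mu E)%E.
    by rewrite mule1 integral_cst// mul1e.
  rewrite -mS -/V => h1 h2.
  have {h1 h2} : ((\int[mu]_(x in E) V (fun=> 1) x) * (\int[mu]_(x in E) V (fun=> 1) x) <=
      (r ^+ n)%:E * (r ^+ n)%:E)%E.
    apply: le_trans h2 _; rewrite -[leRHS]mul1e.
    apply: lee_pmul => //; first by apply: integral_ge0 => x _; exact: (nnm_mul (nV _ n1) (nV _ n1)).1.
    have re : (r ^+ 2) ^+ n = r ^+ n * r ^+ n by rewrite -exprM mulnC exprM expr2.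
    apply: le_trans h1 _; rewrite re EFinM -[leRHS]mule1; apply: lee_wpmul2l => //.
    by rewrite -EFinM lee_fin -expr2 sqr_ge0.
  have : (0 <= \int[mu]_(x in E) V (fun=> 1) x)%E by apply: integral_ge0 => x _; exact: (nV _ n1).1.
  case: (\int[mu]_(x in E) V (fun=> 1) x)%E => [a| |] //.
  rewrite -!EFinM !lee_fin -!expr2 => a0; rewrite ler_sqr ?nnegrE//.
  by rewrite exprn_ge0// ltW.
(* The constant part is small through [V 1]. The part [(V phi)^2] is only integrable: the outer [V]
   costs [A ^+ n] in L1, the inner one gains [r ^+ (2 * n)] from L2. *)
have Ipsi2 : (\int[mu]_(x in E) V psi2 x <=
    (2 * (k ^+ 2 * A ^+ (2 * n)) * r ^+ n + 2 * A ^+ n * r ^+ (2 * n) * v)%:E)%E.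
  rewrite (eq_integral (fun x => (2 * (k * A ^+ n) ^+ 2)%:E * V (fun=> 1) x +
      2%:E * V (fun z => V phi z * V phi z) x)%E); last first.
    move=> x _; rewrite (nno_add hV); try exact: nnm_scale.
    by rewrite !(nno_scale hV).
  have nVVV := nV _ nVV.
  rewrite ge0_integralD//; last 4 first.
  - by move=> x _; apply: mule_ge0; rewrite ?lee_fin// (nV _ n1).1.
  - by apply: measurable_funeM; apply: measurable_funTS; exact: (nV _ n1).2.
  - by move=> x _; apply: mule_ge0; rewrite ?lee_fin// nVVV.1.
  - by apply: measurable_funeM; apply: measurable_funTS; exact: nVVV.2.
  rewrite !ge0_integralZl_EFin//; last 4 first.
  - by move=> x _; exact: nVVV.1.
  - by apply: measurable_funTS; exact: nVVV.2.
  - by move=> x _; exact: (nV _ n1).1.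
  - by apply: measurable_funTS; exact: (nV _ n1).2.
  rewrite [leRHS]EFinD; apply: leeD.
    rewrite (EFinM _ (r ^+ n)) (_ : (k * A ^+ n) ^+ 2 = k ^+ 2 * A ^+ (2 * n)).
      by apply: lee_wpmul2l => //; rewrite lee_fin mulr_ge0// mulr_ge0 ?sqr_ge0// exprn_ge0.
    by rewrite exprMn -exprM mulnC.
  rewrite -!mulrA (EFinM 2); apply: lee_wpmul2l => //.
  apply: le_trans (iter_L1 n A0 hA nVV) _; rewrite EFinM; apply: lee_wpmul2l => //.
  by rewrite lee_fin exprn_ge0.
have nVp := nV _ npsi2.
have ge1 : 0 <= A ^+ n / th by rewrite divr_ge0 ?exprn_ge0// ltW.
apply: (@le_trans _ _ (\int[mu]_(x in E) (th%:E * V psi2 x + (A ^+ n / th)%:E * G x))%E).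
  apply: ae_ge0_le_integral => //.
  - by move=> x _; exact: (nnm_mul (nV _ nphi) nY).1.
  - by apply: measurable_funTS; exact: (nnm_mul (nV _ nphi) nY).2.
  - move=> x _; apply: adde_ge0; apply: mule_ge0; rewrite ?lee_fin ?(ltW th0)//.
      exact: nVp.1.
    exact: nG.1.
  - apply: measurable_funTS; apply: emeasurable_funD; apply: measurable_funeM.
      exact: nVp.2.
    exact: nG.2.
rewrite ge0_integralD//; last 4 first.
- by move=> x _; apply: mule_ge0; rewrite ?lee_fin ?(ltW th0)// nVp.1.
- by apply: measurable_funeM; apply: measurable_funTS; exact: nVp.2.
- by move=> x _; apply: mule_ge0; rewrite ?lee_fin// nG.1.
- by apply: measurable_funeM; apply: measurable_funTS; exact: nG.2.
rewrite !ge0_integralZl_EFin//; last 5 first.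
- by move=> x _; exact: nG.1.
- by apply: measurable_funTS; exact: nG.2.
- by move=> x _; exact: nVp.1.
- by apply: measurable_funTS; exact: nVp.2.
- exact: ltW.
rewrite [leRHS]EFinD !(EFinM th) (EFinM (A ^+ n / th)); apply: leeD; apply: lee_wpmul2l => //.
by rewrite lee_fin ltW.
Qed.

End Iterates.

(** * The killed semigroup on L2 *)

Section AlmostEverywhere.
Context {d : measure_display} {X : measurableType d} {R : realType}.
Variables (mu : {measure set X -> \bar R}) (E : set X).
Hypothesis mE : measurable E.

Lemma ae_eq0_integral (f : X -> \bar R) : nnm f -> (\int[mu]_(x in E) f x <= 0)%E ->
  {ae mu, forall x, E x -> f x = 0%E}.
Proof.
move=> [f0 mf] If; have mfE : measurable_fun E f by exact: measurable_funTS.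
have : (\int[mu]_(x in E) `|f x| = 0)%E.
  apply/eqP; rewrite eq_le; apply/andP; split; last by apply: integral_ge0.
  by under eq_integral do rewrite gee0_abs//.
by move=> /(ae_eq_integral_abs mu mE mfE).
Qed.

Lemma ae_fin_num_integral (f : X -> \bar R) : nnm f -> (\int[mu]_(x in E) f x < +oo)%E ->
  {ae mu, forall x, E x -> f x \is a fin_num}.
Proof.
move=> [f0 mf] If; apply: (integrable_ae mE); apply/integrableP; split.
  exact: measurable_funTS.
by under eq_integral do rewrite gee0_abs//.
Qed.

End AlmostEverywhere.

Section Operators.
Context {R : realType} {H : normedModType R}.
Context {dO : measure_display} {Omega : measurableType dO}.
Variables (P : H -> probability Omega R) (Z : R -> Omega -> H).
Hypothesis HZmeas : forall t, 0 <= t -> measurable_fun setT (Z t : Omega -> BH H).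
Hypothesis HPmeas : forall A : set Omega, measurable A ->
  measurable_fun [set: BH H] (fun x : BH H => P x A).
Variables (mu : probability (BH H) R).
Hypothesis Hinv : forall t f, 0 <= t -> bmeas f ->
     (\int[mu]_x (Psg P Z t f x)%:E = \int[mu]_x (f x)%:E)%E.
Variable (E : set H).
Hypothesis HEmeas : measurable (E : set (BH H)).
Hypothesis Htaumeas : forall t : R, measurable [set w | (t%:E < tau Z E w)%E].

Let EB : set (BH H) := E.

Section Qe.
Variables (t : R) (t0 : 0 < t).
Let t0' := ltW t0.
Let mA := measurable_alive Htaumeas t.

Let Q : (BH H -> \bar R) -> BH H -> \bar R := Qe P Z E t.

Let mZ (f : BH H -> \bar R) : nnm f -> measurable_fun (alive Z E t) (fun w => f (Z t w)).
Proof. by move=> [_ mf]; apply: measurable_funTS; exact: (measurable_fun_Ze HZmeas t0' mf). Qed.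

Let inE' w : alive Z E t w -> E (Z t w).
Proof. by move=> aw; apply: (alive_in aw); rewrite t0 lexx. Qed.

Lemma Qe_le_Pe (f : BH H -> \bar R) x : nnm f -> (Qe P Z E t f x <= Pe P Z t (f \_ EB) x)%E.
Proof.
move=> nf; have [g0 mg] := nnm_restrict HEmeas nf.
have mgZ := measurable_fun_Ze HZmeas t0' mg.
rewrite /Qe (eq_integral (fun w => (f \_ EB) (Z t w))).
  by apply: ge0_subset_integral.
by move=> w; rewrite inE => /inE' Ew; rewrite patchE mem_set.
Qed.

Lemma Qe_nnm (f : BH H -> \bar R) : nnm f -> nnm (Q f).
Proof.
by move=> [f0 mf]; split; [move=> x; apply: integral_ge0|exact: measurable_Qe].
Qed.

(** Killing only decreases the expectation, and the unkilled semigroup preserves the integral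
    against [mu]. *)
Lemma Qe_L1 (f : BH H -> \bar R) : nnm f -> (\int[mu]_(x in EB) Q f x <= \int[mu]_(x in EB) f x)%E.
Proof.
move=> nf; have [g0 mg] := nnm_restrict HEmeas nf.
have [Q0 mQ] := Qe_nnm nf.
rewrite [leRHS]integral_mkcond -(invariant_ge0 HZmeas HPmeas Hinv t0' g0 mg).
apply: (@le_trans _ _ (\int[mu]_x Q f x)%E); first exact: ge0_subset_integral.
apply: ge0_le_integral => //; first exact: measurable_Pe.
by move=> x _; exact: Qe_le_Pe.
Qed.

Lemma Qe_add (f g : BH H -> \bar R) x : nnm f -> nnm g ->
  Qe P Z E t (fun y => f y + g y)%E x = (Qe P Z E t f x + Qe P Z E t g x)%E.
Proof.
move=> nf ng; apply: ge0_integralD => //.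
- by move=> w _; exact: nf.1.
- exact: mZ.
- by move=> w _; exact: ng.1.
- exact: mZ.
Qed.

Lemma Qe_scale (c : R) (f : BH H -> \bar R) x : 0 <= c -> nnm f ->
  Qe P Z E t (fun y => c%:E * f y)%E x = (c%:E * Qe P Z E t f x)%E.
Proof.
move=> c0 nf; apply: ge0_integralZl_EFin => //.
- by move=> w _; exact: nf.1.
- exact: mZ.
Qed.

Lemma Qe_le (f g : BH H -> \bar R) x : nnm f -> nnm g -> (forall y, E y -> (f y <= g y)%E) ->
  (Qe P Z E t f x <= Qe P Z E t g x)%E.
Proof.
move=> nf ng fg; apply: ge0_le_integral => //.
- by move=> w _; exact: nf.1.
- exact: mZ.
- exact: mZ.
- by move=> w /inE'; exact: fg.
Qed.

(** Let [h] be infinite on the exceptional null set and 0 elsewhere. Then [f <= g + h] everywhere on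
    [E], while [Q h] vanishes almost everywhere by the L1 contraction. *)
Lemma Qe_mono (f g : BH H -> \bar R) : nnm f -> nnm g -> {ae mu, forall x, E x -> (f x <= g x)%E} ->
  {ae mu, forall x, E x -> (Q f x <= Q g x)%E}.
Proof.
move=> nf ng [N [mN N0 fgN]].
pose h : BH H -> \bar R := (cst +oo%E) \_ N.
have nh : nnm h.
  split; first by move=> x; rewrite /h patchE; case: ifP => _ //; exact: leey.
  by apply: (measurable_restrictT _ mN).1; exact: measurable_cst.
have Ih : (\int[mu]_(x in EB) Q h x <= 0)%E.
  apply: le_trans (Qe_L1 nh) _.
  apply: (@le_trans _ _ (\int[mu]_x h x)%E).
    by apply: ge0_subset_integral => //; [exact: nh.2|move=> x _; exact: nh.1].
  have -> : (\int[mu]_x h x = +oo * mu N)%E by rewrite /h -integral_mkcond integral_cst.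
  by rewrite [X in (_ * X)%E]N0 mule0.
have := ae_eq0_integral HEmeas (Qe_nnm nh) Ih; apply: filterS => x hx Ex.
have -> : Q g x = (Q g x + Q h x)%E by rewrite hx// adde0.
rewrite /Q -Qe_add//; apply: Qe_le => //; first exact: nnm_add.
move=> y Ey; rewrite /h patchE; case: ifPn => [_|yN].
  by rewrite addey ?leey// gt_eqF// (lt_le_trans (ltNyr 0))// ng.1.
rewrite adde0; apply: contrapT => nle; move/negP: yN; apply; apply/mem_set.
by apply: fgN => /= /(_ Ey).
Qed.

Lemma Qe_operator : nn_operator mu EB Q.
Proof.
split.
- exact: Qe_nnm.
- by move=> f g x; exact: Qe_add.
- by move=> c f x; exact: Qe_scale.
- by move=> f g x nf ng fg; apply: Qe_le.
- exact: Qe_mono.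
Qed.

(** The survival probability is kept as a factor: it later cancels one of the two denominators in
    the square of a conditional expectation. *)
Lemma Qe_cs (f : BH H -> \bar R) x : nnm f ->
  (Q f x * Q f x <= P x (alive Z E t) * Q (fun y => f y * f y) x)%E.
Proof.
move=> nf; have fS : P x (alive Z E t) \is a fin_num by exact: fin_num_measure.
have := @cauchy_schwarz_mass _ _ _ (P x) _ (fun w => f (Z t w)) (fine (P x (alive Z E t)))
  mA (mZ nf) (fun w => nf.1 _).
by rewrite fineK//; exact.
Qed.

Lemma Qe_sq_le (f : BH H -> \bar R) x : nnm f -> (Q f x * Q f x <= Q (fun y => f y * f y) x)%E.
Proof.
move=> nf; apply: le_trans (Qe_cs x nf) _; rewrite -[leRHS]mul1e.
apply: lee_wpmul2r; last exact: probability_le1.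
exact: (Qe_nnm (nnm_mul nf nf)).1.
Qed.

End Qe.

Section Step.
Variables (F : set (BH H)) (mF : measurable F) (FE : F `<=` EB) (c e : R).
Hypotheses (c0 : 0 <= c) (e0 : 0 <= e).
Hypothesis Fsmall : forall h : BH H -> \bar R, (forall x, (0 <= h x)%E) ->
  measurable_fun setT h ->
  (\int[mu]_(x in F) (Pe P Z 1 h x * Pe P Z 1 h x) <= e%:E * \int[mu]_x (h x * h x))%E.

Definition restricted_step (f : BH H -> \bar R) : BH H -> \bar R :=
  fun x => ((\1_F x * c)%:E * Qe P Z E 1 f x)%E.

Let ic0 x : 0 <= \1_F x * c. Proof. by rewrite mulr_ge0// indicE. Qed.

Let nic : nnm (fun x => (\1_F x * c)%:E).
Proof.
split; first by move=> x; rewrite lee_fin.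
by apply/measurable_EFinP; apply: measurable_funM => //; exact: measurable_indic.
Qed.

Lemma restricted_step_operator : nn_operator mu EB restricted_step.
Proof.
have hQ := Qe_operator ltr01; rewrite /restricted_step; split.
- by move=> f nf; apply: nnm_mul => //; exact: (nno_nnm hQ).
- move=> f g x nf ng; rewrite (nno_add hQ)// muleDr//.
  by apply: ge0_adde_def; rewrite inE; [exact: (nno_nnm hQ nf).1|exact: (nno_nnm hQ ng).1].
- by move=> a f x a0 nf; rewrite (nno_scale hQ)// muleCA.
- by move=> f g x nf ng fg; apply: lee_wpmul2l; [rewrite lee_fin|exact: (nno_le hQ)].
- move=> f g nf ng /(nno_mono hQ nf ng); apply: filterS => x h Ex.
  by apply: lee_wpmul2l; [rewrite lee_fin|exact: h].
Qed.

Lemma restricted_step_le (f : BH H -> \bar R) x : nnm f -> (restricted_step f x <= c%:E * Qe P Z E 1 f x)%E.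
Proof.
move=> nf; apply: lee_wpmul2r; first exact: (Qe_nnm ltr01 nf).1.
by rewrite lee_fin indicE; case: (_ \in _); rewrite ?mul1r ?mul0r.
Qed.

Lemma restricted_step_L1 (f : BH H -> \bar R) : nnm f ->
  (\int[mu]_(x in EB) restricted_step f x <= c%:E * \int[mu]_(x in EB) f x)%E.
Proof.
move=> nf; have nQ := Qe_nnm ltr01 nf.
have nW := nno_nnm restricted_step_operator nf.
apply: (@le_trans _ _ (c%:E * \int[mu]_(x in EB) Qe P Z E 1 f x)%E); last first.
  by apply: lee_wpmul2l; [rewrite lee_fin|exact: Qe_L1].
rewrite -ge0_integralZl_EFin//; last 2 first.
- by move=> x _; exact: nQ.1.
- by apply: measurable_funTS; exact: nQ.2.
apply: ge0_le_integral => //.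
- by move=> x _; exact: nW.1.
- by apply: measurable_funTS; exact: nW.2.
- by apply: measurable_funeM; apply: measurable_funTS; exact: nQ.2.
- by move=> x _; exact: restricted_step_le.
Qed.

(** The domination [Q_1 <= P_1] hands the smallness of [P_1] on [F], due to compactness, over to the
    killed step. *)
Lemma restricted_step_L2 (f : BH H -> \bar R) : nnm f ->
  (\int[mu]_(x in EB) (restricted_step f x * restricted_step f x) <=
   (c ^+ 2 * e)%:E * \int[mu]_(x in EB) (f x * f x))%E.
Proof.
move=> nf; have [g0 mg] := nnm_restrict HEmeas nf.
have nQ := Qe_nnm ltr01 nf.
have nW := nno_nnm restricted_step_operator nf.
have nP : nnm (Pe P Z 1 (f \_ EB) : BH H -> \bar R).
  by split; [move=> x; exact: Pe_ge0|exact: measurable_Pe].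
have nPP := nnm_mul nP nP.
have sqE : ((fun x => (f \_ EB) x * (f \_ EB) x) = ((fun x => f x * f x) \_ EB))%E.
  by apply/funext => x; rewrite !patchE; case: ifP => //; rewrite mule0.
have := Fsmall g0 mg; rewrite sqE -integral_mkcond => /(lee_wpmul2l _) h.
rewrite EFinM -muleA; apply: le_trans (h (c ^+ 2)%:E _); last by rewrite lee_fin sqr_ge0.
rewrite -ge0_integralZl_EFin ?sqr_ge0//; last 2 first.
- by move=> x _; exact: nPP.1.
- by apply: measurable_funTS; exact: nPP.2.
have -> : F = EB `&` F by rewrite setIidr.
rewrite [leRHS]integral_mkcondr.
apply: ge0_le_integral => //.
- by move=> x _; exact: (nnm_mul nW nW).1.
- by apply: measurable_funTS; exact: (nnm_mul nW nW).2.
- apply: measurable_funTS; apply: (measurable_restrictT _ mF).1.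
  by apply: measurable_funTS; apply: measurable_funeM; exact: nPP.2.
- move=> x _; rewrite /restricted_step patchE indicE; case: (x \in F); last first.
    by rewrite mul0r mul0e mule0.
  rewrite mul1r muleACA -EFinM -expr2; apply: lee_wpmul2l; first by rewrite lee_fin sqr_ge0.
  by apply: lee_sq; [exact: nQ.1|exact: Qe_le_Pe].
Qed.

End Step.
End Operators.

Lemma abs_fine_le (R : realType) (z : \bar R) : (`|fine z|%:E <= `|z|)%E.
Proof. by case: z => [r| |] /=; rewrite ?normr0 ?leey. Qed.

Lemma sqr_add_le (R : realFieldType) (a b : R) : (a + b) ^+ 2 <= 2 * a ^+ 2 + 2 * b ^+ 2.
Proof. by have := sqr_ge0 (a - b); rewrite !expr2; lra. Qed.

(** * Square-integrable functions on E and the killed semigroup acting on them *)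

Section L2Space.
Context {R : realType} {H : normedModType R}.
Variables (mu : probability (BH H) R) (E : set H).
Hypothesis HEmeas : measurable (E : set (BH H)).
Let EB : set (BH H) := E.

Lemma measurable_sqr (f : BH H -> R) : measurable_fun EB f ->
  measurable_fun EB (fun x => (f x ^+ 2)%:E).
Proof. by move=> mf; apply/measurable_EFinP; exact: measurable_funX. Qed.

Lemma integral_sqr_ge0 (f : BH H -> R) : (0 <= \int[mu]_(x in EB) (f x ^+ 2)%:E)%E.
Proof. by apply: integral_ge0 => x _; rewrite lee_fin sqr_ge0. Qed.

Lemma L2E_cst (c : R) : L2E mu EB (fun=> c).
Proof.
split=> //; rewrite (_ : (\int[mu]_(x in EB) _)%E = ((c ^+ 2)%:E * mu EB)%E).
  by apply: lte_mul_pinfty; rewrite ?lee_fin ?sqr_ge0// (le_lt_trans (probability_le1 mu HEmeas))// ltry.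
by rewrite -integral_cst.
Qed.

Lemma L2E_scale (c : R) f : L2E mu EB f -> L2E mu EB (fun x => c * f x).
Proof.
move=> [mf If]; split; first exact: measurable_funM.
under eq_integral do rewrite exprMn EFinM.
rewrite ge0_integralZl_EFin ?sqr_ge0//.
- by apply: lte_mul_pinfty; rewrite ?lee_fin ?sqr_ge0.
- by move=> x _; rewrite lee_fin sqr_ge0.
- exact: measurable_sqr.
Qed.

Lemma L2E_integral_add (f g : BH H -> R) : L2E mu EB f -> L2E mu EB g ->
  (\int[mu]_(x in EB) ((f x + g x) ^+ 2)%:E <=
   2%:E * \int[mu]_(x in EB) (f x ^+ 2)%:E + 2%:E * \int[mu]_(x in EB) (g x ^+ 2)%:E)%E.
Proof.
move=> [mf If] [mg Ig].
have s0 (h : BH H -> R) x : EB x -> (0 <= (h x ^+ 2)%:E)%E by rewrite lee_fin sqr_ge0.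
rewrite -!ge0_integralZl_EFin//; try exact: s0; try exact: measurable_sqr.
rewrite -ge0_integralD//; first last.
- by apply: measurable_funeM; exact: measurable_sqr.
- by move=> x Ex; apply: mule_ge0 => //; exact: s0.
- by apply: measurable_funeM; exact: measurable_sqr.
- by move=> x Ex; apply: mule_ge0 => //; exact: s0.
apply: ge0_le_integral => //.
- by move=> x _; rewrite lee_fin sqr_ge0.
- by apply: measurable_sqr; exact: measurable_funD.
- by apply: emeasurable_funD; apply: measurable_funeM; exact: measurable_sqr.
- by move=> x _; rewrite -!EFinM -EFinD lee_fin sqr_add_le.
Qed.

Lemma L2E_add (f g : BH H -> R) : L2E mu EB f -> L2E mu EB g -> L2E mu EB (fun x => f x + g x).
Proof.
move=> Lf Lg; split; first by apply: measurable_funD; [case: Lf|case: Lg].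
apply: le_lt_trans (L2E_integral_add Lf Lg) _; apply: lte_add_pinfty.
  by apply: lte_mul_pinfty => //; case: Lf.
by apply: lte_mul_pinfty => //; case: Lg.
Qed.

Lemma L2n_sqr f (c : R) : L2E mu EB f -> 0 <= c -> L2n mu EB f <= c ->
  (\int[mu]_(x in EB) (f x ^+ 2)%:E <= (c ^+ 2)%:E)%E.
Proof.
move=> [mf If] c0; rewrite /L2n => h.
have I0 := integral_sqr_ge0 f.
have Ifin : (\int[mu]_(x in EB) (f x ^+ 2)%:E)%E \is a fin_num by rewrite ge0_fin_numE.
rewrite -(fineK Ifin) lee_fin.
by rewrite -(@sqr_sqrtr _ (fine _)) ?fine_ge0// ler_sqr ?nnegrE ?sqrtr_ge0.
Qed.

Lemma integral_abs_le (f : BH H -> R) (c th : R) : measurable_fun EB f -> 0 < th ->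
  (\int[mu]_(x in EB) (f x ^+ 2)%:E <= c%:E)%E ->
  (\int[mu]_(x in EB) `|f x|%:E <= (th * c + th^-1)%:E)%E.
Proof.
move=> mf th0 If.
apply: (@le_trans _ _ (\int[mu]_(x in EB) (th%:E * (f x ^+ 2)%:E + cst (th^-1)%:E x))%E).
  apply: ge0_le_integral => //.
  - by apply/measurable_EFinP; exact: measurableT_comp.
  - by apply: emeasurable_funD => //; apply: measurable_funeM; exact: measurable_sqr.
  - move=> x _; rewrite -EFinM -EFinD lee_fin -(real_normK (num_real (f x))).
    have := normr_ge0 (f x); move: `|f x| => a a0.
    have ti : 0 < th^-1 by rewrite invr_gt0.
    have : 0 <= th * (a - th^-1) ^+ 2 by rewrite mulr_ge0 ?sqr_ge0// ltW.
    rewrite (_ : th * (a - th^-1) ^+ 2 = th * a ^+ 2 + th^-1 - 2 * a); last first.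
      by field; rewrite gt_eqF.
    by lra.
rewrite ge0_integralD//; first last.
- by move=> x _; rewrite lee_fin invr_ge0 ltW.
- by apply: measurable_funeM; exact: measurable_sqr.
- by move=> x _; rewrite mule_ge0// lee_fin ?sqr_ge0// ltW.
rewrite ge0_integralZl_EFin//; first last.
- exact: ltW.
- exact: measurable_sqr.
- by move=> x _; rewrite lee_fin sqr_ge0.
rewrite [leRHS]EFinD; apply: leeD.
  by rewrite EFinM; apply: lee_wpmul2l => //; rewrite lee_fin ltW.
rewrite integral_cst// -[leRHS]mule1; apply: lee_wpmul2l.
  by rewrite lee_fin invr_ge0 ltW.
exact: probability_le1.
Qed.

(** Extension by 0 turns a function measurable on [E] only into a nonnegative measurable function on
    the whole space, the kind [Qe] acts on. *)
Definition absE (f : BH H -> R) : BH H -> \bar R := (fun y => `|f y|%:E) \_ EB.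

Lemma absE_nnm (f : BH H -> R) : measurable_fun EB f -> nnm (absE f).
Proof.
move=> mf; split; first by apply: erestrict_ge0.
apply: (measurable_restrictT _ HEmeas).1.
by apply/measurable_EFinP; exact: measurableT_comp.
Qed.

Lemma integral_absE_sqr (f : BH H -> R) :
  (\int[mu]_(x in EB) (absE f x * absE f x) = \int[mu]_(x in EB) (f x ^+ 2)%:E)%E.
Proof.
apply: eq_integral => x xE; rewrite /absE patchE xE -EFinM.
by rewrite -expr2 real_normK// num_real.
Qed.

End L2Space.

Section Semigroup.
Context {R : realType} {H : normedModType R}.
Context {dO : measure_display} {Omega : measurableType dO}.
Variables (P : H -> probability Omega R) (Z : R -> Omega -> H).
Hypothesis HZmeas : forall t, 0 <= t -> measurable_fun setT (Z t : Omega -> BH H).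
Hypothesis HPmeas : forall A : set Omega, measurable A ->
  measurable_fun [set: BH H] (fun x : BH H => P x A).
Variables (mu : probability (BH H) R).
Hypothesis Hinv : forall t f, 0 <= t -> bmeas f ->
     (\int[mu]_x (Psg P Z t f x)%:E = \int[mu]_x (f x)%:E)%E.
Variable (E : set H).
Hypothesis HEmeas : measurable (E : set (BH H)).
Hypothesis Htaumeas : forall t : R, measurable [set w | (t%:E < tau Z E w)%E].

Let EB : set (BH H) := E.
Variables (t : R) (t0 : 0 < t).
Let t0' := ltW t0.
Let mA := measurable_alive Htaumeas t.
Let inE' w : alive Z E t w -> E (Z t w).
Proof. by move=> aw; apply: (alive_in aw); rewrite t0 lexx. Qed.

Lemma Qsg1 x : Qsg P Z E t (fun=> 1) x = fine (P x (alive Z E t)).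
Proof.
rewrite /Qsg; congr fine; under eq_integral do rewrite mul1r.
by rewrite integral_indic ?setIT.
Qed.

Lemma Qe1 x : Qe P Z E t (fun=> 1%E) x = P x (alive Z E t).
Proof. by rewrite /Qe integral_cst// mul1e. Qed.

(** The integrand of [Qsg] with [f] cut off outside [E]. It is unchanged, since survival up to
    [t > 0] forces [Z t] into [E], and becomes measurable on all of [Omega]. *)
Let G (f : BH H -> R) w := (f \_ EB) (Z t w) * \1_(alive Z E t) w.

Let QsgE f x : Qsg P Z E t f x = fine (\int[P x]_w (G f w)%:E)%E.
Proof.
rewrite /Qsg; congr fine; apply: eq_integral => w _; congr EFin.
rewrite /G /alive indicE; case: (boolP (w \in _)); rewrite ?mulr0// => /set_mem aw.
by rewrite patchE mem_set//; exact: inE'.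
Qed.

Let mG f : measurable_fun EB f -> measurable_fun setT (G f).
Proof.
move=> mf; apply: measurable_funM; last exact: measurable_indic.
apply: (measurable_fun_Z HZmeas t0').
by apply: (measurable_restrictT _ HEmeas).1.
Qed.

Lemma measurable_Qsg (f : BH H -> R) : measurable_fun EB f ->
  measurable_fun setT (Qsg P Z E t f : BH H -> R).
Proof.
move=> mf; have mg := mG mf.
rewrite (_ : (Qsg P Z E t f : BH H -> R) = (fun x : BH H =>
   fine (\int[P x]_w (fun w => (G f w)%:E)^\+ w - \int[P x]_w (fun w => (G f w)%:E)^\- w)%E)); last first.
  by apply/funext => x; rewrite QsgE integralE.
apply: (measurableT_comp (fine_measurable measurableT)).
have mGe : measurable_fun setT (fun w => (G f w)%:E) by exact/measurable_EFinP.
apply: emeasurable_funB; apply: (measurable_integral_kernel HPmeas) => //.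
- exact: measurable_funepos.
- exact: measurable_funeneg.
Qed.

Lemma Qsg_abs_le (f : BH H -> R) x : measurable_fun EB f ->
  (`|Qsg P Z E t f x|%:E <= Qe P Z E t (absE E f) x)%E.
Proof.
move=> mf; rewrite QsgE; apply: le_trans (abs_fine_le _) _.
have mGe : measurable_fun setT (fun w => (G f w)%:E) by apply/measurable_EFinP; exact: mG.
apply: le_trans (le_abse_integral _ _ mGe) _ => //.
rewrite /Qe [leRHS]integral_mkcond le_eqVlt; apply/orP; left; apply/eqP.
apply: eq_integral => w _; rewrite /G [RHS]patchE indicE.
case: (boolP (w \in _)) => [/set_mem aw|_]; last by rewrite mulr0 /= normr0.
by rewrite mulr1 /absE !patchE mem_set//; exact: inE'.
Qed.

Lemma Qsg_Qe (f : BH H -> R) x : measurable_fun EB f -> (forall y, E y -> 0 <= f y) ->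
  Qsg P Z E t f x = fine (Qe P Z E t (absE E f) x).
Proof.
move=> mf f0; rewrite QsgE; congr fine; rewrite /Qe [RHS]integral_mkcond.
apply: eq_integral => w _; rewrite /G [RHS]patchE indicE.
case: (boolP (w \in _)) => [/set_mem aw|_]; last by rewrite mulr0.
by have Ew := inE' aw; rewrite mulr1 /absE !patchE mem_set// ger0_norm// f0.
Qed.

(** By Cauchy-Schwarz the square of [Q_t f] is at most [Q_t (f^2)], and [Q_t] contracts L1. *)
Lemma L2E_Qsg (f : BH H -> R) : L2E mu EB f -> L2E mu EB (Qsg P Z E t f : BH H -> R).
Proof.
move=> [mf If]; have mQ := measurable_Qsg mf.
have na := absE_nnm HEmeas mf.
have nQ := Qe_nnm HZmeas HPmeas Htaumeas t0 na.
have nQ2 := Qe_nnm HZmeas HPmeas Htaumeas t0 (nnm_mul na na).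
split; first exact: measurable_funTS.
apply: le_lt_trans If; rewrite -[leRHS]integral_absE_sqr.
apply: le_trans (Qe_L1 HZmeas HPmeas Hinv HEmeas Htaumeas t0 (nnm_mul na na)).
apply: ge0_le_integral => //.
- by move=> x _; rewrite lee_fin sqr_ge0.
- by apply: measurable_sqr; exact: measurable_funTS.
- by apply: measurable_funTS; exact: nQ2.2.
- move=> x _; rewrite -(real_normK (num_real (Qsg _ _ _ _ _ _))) expr2 EFinM.
  apply: (le_trans (lee_sq _ (Qsg_abs_le x mf))); first by rewrite lee_fin.
  exact: (Qe_sq_le HZmeas HPmeas Htaumeas t0 x na).
Qed.

(** A crude bound by the conditional expectation of [|f| + |a|], ignoring all cancellation. It is
    used against the part of [phi] that is already exponentially small. *)
Lemma cond_dev_le (f : BH H -> R) (a : R) x : measurable_fun EB f ->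
  (0 < P x (alive Z E t))%E ->
  (`|condE P Z E t f x - a|%:E <=
   ((fine (P x (alive Z E t)))^-1)%R%:E * Qe P Z E t (fun y => absE E f y + `|a|%:E) x)%E.
Proof.
move=> mf S0.
have fS : P x (alive Z E t) \is a fin_num by exact: fin_num_measure.
have na := absE_nnm HEmeas mf.
have n1 : nnm (fun _ : BH H => `|a|%:E) by apply: nnm_cst.
rewrite (Qe_add _ HZmeas Htaumeas t0)//.
have -> : Qe P Z E t (fun=> `|a|%:E) x = (`|a|%:E * P x (alive Z E t))%E.
  by rewrite /Qe integral_cst.
rewrite /condE -/(alive Z E t).
move: S0; rewrite -(fineK fS); set S := fine _; rewrite lte_fin => S0.
have -> : Qsg P Z E t f x / S - a = S^-1 * (Qsg P Z E t f x - a * S).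
  by field; rewrite gt_eqF.
rewrite [fine S%:E]/= normrM ger0_norm ?invr_ge0 ?(ltW S0)// EFinM; apply: lee_wpmul2l.
  by rewrite lee_fin invr_ge0 ltW.
apply: (@le_trans _ _ (`|Qsg P Z E t f x|%:E + `|a * S|%:E)%E).
  by rewrite -EFinD lee_fin ler_normB.
apply: leeD; first exact: Qsg_abs_le.
by rewrite normrM (ger0_norm (ltW S0)) EFinM.
Qed.

End Semigroup.

Lemma sum_geometric_le (R : realFieldType) (C q : R) n : 0 <= C -> 0 <= q < 1 ->
  \sum_(0 <= i < n) C * q ^+ i <= C / (1 - q).
Proof.
move=> C0 /andP[q0 q1]; have q1' : 0 < 1 - q by rewrite subr_gt0.
suff -> : \sum_(0 <= i < n) C * q ^+ i = C * (1 - q ^+ n) / (1 - q).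
  rewrite ler_pM2r ?invr_gt0// ler_piMr// lerBlDr lerDl exprn_ge0//.
elim: n => [|n IH]; first by rewrite big_nil expr0 subrr mulr0 mul0r.
rewrite big_nat_recr//= IH exprS; field.
by rewrite gt_eqF.
Qed.

Lemma ae_and d (X : measurableType d) (R : realType) (mu : {measure set X -> \bar R})
  (A B : set X) : {ae mu, forall x, A x} -> {ae mu, forall x, B x} ->
  {ae mu, forall x, A x /\ B x}.
Proof. exact: filterI. Qed.

Lemma ae_and3 d (X : measurableType d) (R : realType) (mu : {measure set X -> \bar R})
  (A B C : set X) : {ae mu, forall x, A x} -> {ae mu, forall x, B x} ->
  {ae mu, forall x, C x} -> {ae mu, forall x, [/\ A x, B x & C x]}.
Proof. by move=> hA hB; apply: filterS3 hA hB => x. Qed.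

(** * Almost everywhere limits and a Fatou lemma for the killed semigroup *)

Section BorelCantelli.
Context {d : measure_display} {X : measurableType d} {R : realType}.
Variables (mu : {measure set X -> \bar R}) (E : set X).
Hypothesis mE : measurable E.

(** The sum of the squares has finite integral, so it is finite almost everywhere and its terms tend
    to 0. *)
Lemma ae_cvg0_of_L2 (g : nat -> X -> R) (C q : R) N : 0 <= C -> 0 <= q < 1 ->
  (forall n, measurable_fun E (g n)) ->
  (forall n, (N <= n)%N -> (\int[mu]_(x in E) (g n x ^+ 2)%:E <= (C * q ^+ n)%:E)%E) ->
  {ae mu, forall x, E x -> (fun n => g n x) @ \oo --> (0 : R)}.
Proof.
move=> C0 q01 mg Ig; have /andP[q0 q1] := q01.
pose h n x := (g (n + N)%N x ^+ 2)%:E.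
have h0 n x : (0 <= h n x)%E by rewrite lee_fin sqr_ge0.
have mh n : measurable_fun E (h n) by apply/measurable_EFinP; exact: measurable_funX.
pose S x := (\sum_(0 <= n <oo) h n x)%E.
have S0 x : (0 <= S x)%E by apply: nneseries_ge0.
have mS : measurable_fun E S.
  by apply: ge0_emeasurable_sum => //.
have IS : (\int[mu]_(x in E) S x < +oo)%E.
  rewrite integral_nneseries//.
  apply: (@le_lt_trans _ _ (C / (1 - q))%:E); last exact: ltry.
  apply: lime_le; first by apply: is_cvg_nneseries => n _ _; exact: integral_ge0.
  apply: nearW => n.
  apply: (@le_trans _ _ (\sum_(0 <= i < n) (C * q ^+ i)%:E)%E).
    apply: lee_sum => i _; apply: le_trans (Ig _ (leq_addl _ _)) _.
    rewrite lee_fin; apply: ler_wpM2l => //; rewrite exprD ler_piMr ?exprn_ge0//.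
    by rewrite exprn_ile1// ltW.
  by rewrite sumEFin lee_fin sum_geometric_le.
have Sfin : {ae mu, forall x, E x -> S x \is a fin_num}.
  apply: (integrable_ae mE); apply/integrableP; split=> //.
  by under eq_integral do rewrite gee0_abs//.
apply: filterS Sfin => x Sx Ex; have {}Sx := Sx Ex.
have tl := @nneseries_tail_cvg R (h ^~ x) xpredT _ (fun k _ => h0 k x).
apply/cvgr0Pnorm_lt => e e0.
have e20 : 0 < e ^+ 2 by rewrite exprn_gt0.
have nb : nbhs (0%E : \bar R) [set y : \bar R | (y < (e ^+ 2)%:E)%E].
  by apply: open_nbhs_nbhs; split; [exact: open_ereal_lt_ereal|rewrite /= lte_fin].
have [|K _ hK] := tl _ _ nb; first by rewrite ltey_eq Sx.
exists (K + N)%N => // n /= Kn.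
have nN : (N <= n)%N by apply: leq_trans Kn; exact: leq_addl.
have := hK (n - N)%N; rewrite /= leq_subRL// addnC => /(_ Kn) hn.
have : (h (n - N)%N x < (e ^+ 2)%:E)%E.
  apply: le_lt_trans hn.
  have := @nneseries_lim_ge R (h ^~ x) xpredT (n - N)%N (n - N).+1 (fun k _ _ => h0 k x).
  by rewrite big_nat1.
rewrite /h subnK// lte_fin -(real_normK (num_real (g n x))).
by rewrite ltr_sqr ?nnegrE// ltW.
Qed.

End BorelCantelli.

Section Fatou.
Context {R : realType} {H : normedModType R}.
Context {dO : measure_display} {Omega : measurableType dO}.
Variables (P : H -> probability Omega R) (Z : R -> Omega -> H).
Hypothesis HZmeas : forall t, 0 <= t -> measurable_fun setT (Z t : Omega -> BH H).
Hypothesis HPmeas : forall A : set Omega, measurable A ->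
  measurable_fun [set: BH H] (fun x : BH H => P x A).
Variables (mu : probability (BH H) R).
Hypothesis Hinv : forall t f, 0 <= t -> bmeas f ->
     (\int[mu]_x (Psg P Z t f x)%:E = \int[mu]_x (f x)%:E)%E.
Variable (E : set H).
Hypothesis HEmeas : measurable (E : set (BH H)).
Hypothesis Htaumeas : forall t : R, measurable [set w | (t%:E < tau Z E w)%E].

Let EB : set (BH H) := E.

(** The usual proof through the infima of tails, with one twist: [b n] converges to [f] only
    [mu]-almost everywhere while [Qe] integrates against [P x]. [Qe_mono] bridges the two. *)
Lemma Qe_fatou t (b c : nat -> BH H -> \bar R) (f l : BH H -> \bar R) : 0 < t ->
  (forall n, nnm (b n)) -> nnm f ->
  {ae mu, forall x : BH H, E x -> (fun n => b n x) @ \oo --> f x} ->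
  {ae mu, forall x : BH H, E x -> forall n, (Qe P Z E t (b n) x <= c n x)%E} ->
  {ae mu, forall x : BH H, E x -> (fun n => c n x) @ \oo --> l x} ->
  {ae mu, forall x : BH H, E x -> (Qe P Z E t f x <= l x)%E}.
Proof.
move=> t0 nb nf bf bc cl; have t0' := ltW t0.
pose i n x := einfs (b ^~ x) n.
have i0 n x : (0 <= i n x)%E.
  by apply: le_ereal_inf_tmp => _ [k _ <-]; exact: (nb k).1.
have mi n : measurable_fun setT (i n).
  by apply: measurable_fun_einfs => k; exact: (nb k).2.
have ni n : nnm (i n) by split.
have ib n x : (i n x <= b n x)%E by apply: ereal_inf_lbound; exists n => //=.
have ind x m n : (m <= n)%N -> (i m x <= i n x)%E by move=> mn; exact: nondecreasing_einfs.
pose g x := limn (i ^~ x).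
have cg x : (fun n => i n x) @ \oo --> g x by exact: is_cvg_einfs.
have ng : nnm g.
  split; first by move=> x; apply: lime_ge; [exact: is_cvg_einfs|exact: nearW].
  by apply: (emeasurable_fun_cvg i) => // x _; exact: cg.
have fg : {ae mu, forall x : BH H, E x -> (f x <= g x)%E}.
  move: bf; apply: filterS => x h Ex; rewrite /g.
  by rewrite (cvg_lim (@ereal_hausdorff R) (cvg_einfs (h Ex))).
have Qfg := Qe_mono HZmeas HPmeas Hinv HEmeas Htaumeas t0 nf ng fg.
have Qig x : (fun n => Qe P Z E t (i n) x) @ \oo --> Qe P Z E t g x.
  apply: mct_cvg => //.
  - exact: measurable_alive.
  - move=> n; apply: measurable_funTS; exact: (measurable_fun_Ze HZmeas t0' (mi n)).
  - by move=> w _ m n mn; exact: ind.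
have := ae_and3 Qfg bc cl; apply: filterS => x [h1 h2 h3] Ex.
apply: le_trans (h1 Ex) _; apply: (cvge_le _ (Qig x)); apply: nearW => m.
apply: (cvge_ge _ (h3 Ex)); exists m => // n /= mn.
apply: le_trans (h2 Ex n); apply: (Qe_le P HZmeas Htaumeas t0) => //.
by move=> y _; apply: le_trans (ib n y); exact: ind.
Qed.

End Fatou.

(** * Convergence of conditional expectations *)

Lemma cvg_pos_lbound (R : realType) (r : nat -> R) (L : R) : (forall n, 0 < r n) ->
  0 < L -> r @ \oo --> L -> exists2 c, 0 < c & forall n, c <= r n.
Proof.
move=> r0 L0 rL.
have [N _ hN] : \forall n \near \oo, L / 2 < r n.
  by apply: (cvgr_gt _ rL); rewrite ltr_pdivrMr// ltr_pMr// ltr1n.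
have [c c0 hc] : exists2 c, 0 < c & forall n, (n < N)%N -> c <= r n.
  elim: N {hN} => [|N [c c0 hc]]; first by exists 1.
  exists (Num.min c (r N)); first by rewrite lt_min c0 r0.
  move=> n; rewrite ltnS leq_eqVlt => /predU1P[->|/hc h]; first by rewrite ge_min lexx orbT.
  by rewrite ge_min h.
exists (Num.min c (L / 2)); first by rewrite lt_min c0 divr_gt0.
move=> n; case: (ltnP n N) => [/hc h|Nn]; first by rewrite ge_min h.
by rewrite ge_min (ltW (hN _ Nn)) orbT.
Qed.

(** With weight [e^((L + g) n)] and rate [r = e^(-(3 L + 2 g))], the three terms carry the exponents
    [-g n], [-(4 L + 3 g) n] and [-g n]. The last fixes the weight, the first then fixes [r]. *)
Lemma tail_exponents (R : realType) (L g t k v w : R) (n : nat) : 0 <= L -> 0 < g ->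
  0 <= v -> 0 <= w -> t <= n%:R ->
  expR ((L + g) * n%:R) *
   (2 * (k ^+ 2 * expR L ^+ (2 * n)) * expR (- (3 * L + 2 * g)) ^+ n +
    2 * expR L ^+ n * expR (- (3 * L + 2 * g)) ^+ (2 * n) * v) +
  expR L ^+ n / expR ((L + g) * n%:R) * w <= (2 * k ^+ 2 + 2 * v + w) * expR (- g * t).
Proof.
move=> L0 g0 v0 w0 tn.
set r := expR (- (3 * L + 2 * g)).
have e1 : expR ((L + g) * n%:R) * (expR L ^+ (2 * n) * r ^+ n) = expR (- g * n%:R).
  by rewrite /r -!expRM_natl -!expRD natrM; congr expR; ring.
have e2 : expR ((L + g) * n%:R) * (expR L ^+ n * r ^+ (2 * n)) <= expR (- g * n%:R).
  rewrite /r -!expRM_natl -!expRD natrM ler_expR -subr_ge0.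
  rewrite (_ : _ - _ = (4 * L + 2 * g) * n%:R); last by ring.
  by rewrite mulr_ge0// addr_ge0// mulr_ge0// ltW.
have e3 : expR L ^+ n / expR ((L + g) * n%:R) = expR (- g * n%:R).
  by rewrite -!expRM_natl -expRN -!expRD; congr expR; ring.
have e4 : expR (- g * n%:R) <= expR (- g * t) by rewrite ler_expR ler_wnM2l// oppr_le0 ltW.
have k20 : 0 <= 2 * k ^+ 2 by rewrite mulr_ge0// sqr_ge0.
rewrite (_ : _ + _ = 2 * k ^+ 2 * (expR ((L + g) * n%:R) * (expR L ^+ (2 * n) * r ^+ n)) +
  2 * v * (expR ((L + g) * n%:R) * (expR L ^+ n * r ^+ (2 * n))) +
  w * (expR L ^+ n / expR ((L + g) * n%:R))); last by ring.
rewrite e1 e3 [leRHS]mulrDl (mulrDl (2 * k ^+ 2)).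
have v20 : 0 <= 2 * v by rewrite mulr_ge0.
by rewrite !lerD// ?(ler_wpM2l k20 e4)// ?(ler_wpM2l w0 e4)// (ler_wpM2l v20 (le_trans e2 e4)).
Qed.

(** * Consequences of the spectral gap *)

Section Spectral.
Context {R : realType} {H : normedModType R}.
Context {dO : measure_display} {Omega : measurableType dO}.
Variables (P : H -> probability Omega R) (Z : R -> Omega -> H).
Hypothesis HZmeas : forall t, 0 <= t -> measurable_fun setT (Z t : Omega -> BH H).
Hypothesis HPmeas : forall A : set Omega, measurable A ->
  measurable_fun [set: BH H] (fun x : BH H => P x A).
Variables (mu : probability (BH H) R).
Hypothesis Hinv : forall t f, 0 <= t -> bmeas f ->
     (\int[mu]_x (Psg P Z t f x)%:E = \int[mu]_x (f x)%:E)%E.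
Variable (E : set H).
Hypothesis HEmeas : measurable (E : set (BH H)).
Hypothesis Htaumeas : forall t : R, measurable [set w | (t%:E < tau Z E w)%E].
Hypothesis Hpos : forall x t, E x -> 0 < t -> (0 < P x (alive Z E t))%E.
Hypothesis Hsuper : forall n : nat, {ae mu, forall x : BH H, E x ->
  (Qe P Z E 1 (fun y => P y (alive Z E n%:R)) x <= P x (alive Z E (n%:R + 1)))%E}.

Let EB : set (BH H) := E.

Variables (lam gamma : R) (phi phis : BH H -> R).
Hypotheses (Lphi : L2E mu E phi) (phi0 : forall x, E x -> 0 < phi x).
Hypotheses (Lphis : L2E mu E phis) (phis0 : forall x, E x -> 0 < phis x).
Hypothesis Hdual : forall t f, 0 <= t -> L2E mu E f ->
          (\int[mu]_(x in EB) (phis x * Qsg P Z E t f x)%:E =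
           (expR (- lam * t))%:E * \int[mu]_(x in EB) (phis x * f x)%:E)%E.
Hypothesis Hn1 : (\int[mu]_(x in EB) (phi x)%:E = 1)%E.
Hypothesis Hn2 : (\int[mu]_(x in EB) (phis x)%:E = 1)%E.
Hypothesis Hgamma : 0 < gamma.

Let M := fine (\int[mu]_(x in EB) (phi x * phis x)%:E)%E.
Let alpha := fun f : BH H -> R => fine (\int[mu]_(x in EB) (phis x * f x)%:E)%E.

Variable (T0 : R).
Hypothesis Hgap : forall t f, T0 <= t -> L2E mu E f ->
     L2n mu E (fun x => expR (lam * t) * Qsg P Z E t f x - M^-1 * phi x * alpha f)
       <= expR (- gamma * t) * (1 + M^-1) * L2n mu E f.

Let mphi : measurable_fun EB phi. Proof. by case: Lphi. Qed.
Let mphis : measurable_fun EB phis. Proof. by case: Lphis. Qed.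

Lemma eigen_mass_fin : (\int[mu]_(x in EB) (phi x * phis x)%:E = M%:E)%E.
Proof.
rewrite fineK// ge0_fin_numE; last first.
  by apply: integral_ge0 => x Ex; rewrite lee_fin mulr_ge0// ltW// ?phi0// phis0.
apply: (@le_lt_trans _ _ (\int[mu]_(x in EB) ((phi x ^+ 2)%:E + (phis x ^+ 2)%:E))%E).
  apply: ge0_le_integral => //.
  - by move=> x Ex; rewrite lee_fin mulr_ge0// ltW// ?phi0// phis0.
  - by apply/measurable_EFinP; exact: measurable_funM.
  - by apply: emeasurable_funD; exact: measurable_sqr.
  - move=> x Ex; rewrite -EFinD lee_fin.
    have := sqr_ge0 (phi x - phis x); have := sqr_ge0 (phi x + phis x).
    by rewrite !expr2; lra.
rewrite ge0_integralD//; first last.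
- exact: measurable_sqr.
- by move=> x _; rewrite lee_fin sqr_ge0.
- exact: measurable_sqr.
- by move=> x _; rewrite lee_fin sqr_ge0.
by apply: lte_add_pinfty; [case: Lphi|case: Lphis].
Qed.

(** The integrand is positive on [E], so [M = 0] would make [E] a null set, against the
    normalization of [phi]. *)
Lemma eigen_mass_gt0 : 0 < M.
Proof.
have M0 : 0 <= M.
  rewrite -lee_fin -eigen_mass_fin; apply: integral_ge0 => x Ex.
  by rewrite lee_fin mulr_ge0// ltW// ?phi0// phis0.
rewrite lt_neqAle M0 andbT; apply/negP => /eqP M00.
have nf : nnm (absE E (fun x => phi x * phis x)) by apply: absE_nnm => //; exact: measurable_funM.
have absEE x : EB x -> absE E (fun x => phi x * phis x) x = (phi x * phis x)%:E.
  move=> Ex; rewrite /absE patchE mem_set// ger0_norm//.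
  by rewrite mulr_ge0// ltW// ?phi0// phis0.
have := ae_eq0_integral HEmeas nf (mu := mu).
have -> : (\int[mu]_(x in EB) absE E (fun x => phi x * phis x)%R x = 0)%E.
  rewrite -[RHS]/(0%:E) M00 -eigen_mass_fin; apply: eq_integral => x; rewrite inE => Ex.
  exact: absEE.
move=> /(_ (lexx _)) [N [mN N0 hN]].
have EN : EB `<=` N.
  move=> x Ex; apply: hN => /= /(_ Ex); rewrite absEE// => -[] /eqP.
  by rewrite mulf_eq0 !gt_eqF// ?phi0// phis0.
have mu0 : mu EB = 0%E.
  apply/eqP; rewrite eq_le measure_ge0 andbT -N0.
  by apply: le_measure; rewrite ?inE.
have : (\int[mu]_(x in EB) (phi x)%:E = 0)%E.
  have mphiE : measurable_fun EB (fun x => (phi x)%:E) by apply/measurable_EFinP.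
  rewrite (ge0_negligible_integral (mu := mu) (N := EB) HEmeas HEmeas mphiE _ mu0).
    by rewrite setDv integral_set0.
  by move=> x Ex; rewrite lee_fin ltW// phi0.
by rewrite Hn1 => /eqP; rewrite onee_eq0.
Qed.

Lemma gap_sqr t f : T0 <= t -> 0 < t -> L2E mu E f ->
  (\int[mu]_(x in EB) ((expR (lam * t) * Qsg P Z E t f x - M^-1 * phi x * alpha f) ^+ 2)%:E <=
   ((expR (- gamma * t) * ((1 + M^-1) * L2n mu E f)) ^+ 2)%:E)%E.
Proof.
move=> Tt t0 Lf; apply: L2n_sqr.
- have LQ := L2E_Qsg HZmeas HPmeas Hinv HEmeas Htaumeas t0 Lf.
  have := L2E_add HEmeas (L2E_scale HEmeas (expR (lam * t)) LQ)
    (L2E_scale HEmeas (- (M^-1 * alpha f)) Lphi).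
  congr (L2E _ _ _); apply/funext => x; rewrite mulNr.
  by congr (_ - _); rewrite mulrAC.
- rewrite mulr_ge0 ?expR_ge0// mulr_ge0 ?sqrtr_ge0//.
  by rewrite addr_ge0// invr_ge0 ltW// eigen_mass_gt0.
- by rewrite mulrA; exact: Hgap.
Qed.

Definition rescaled_survival n : BH H -> \bar R :=
  fun x => ((expR (lam * n%:R))%:E * P x (alive Z E n%:R))%E.

Let mA t := measurable_alive Htaumeas t.

Let nnP t : nnm (fun x : BH H => P x (alive Z E t)).
Proof. by split=> //; exact: HPmeas. Qed.

Lemma rescaled_survival_nnm n : nnm (rescaled_survival n).
Proof. by apply: nnm_scale; [exact: expR_ge0|exact: nnP]. Qed.

Lemma rescaled_survivalE n x : rescaled_survival n x =
  (expR (lam * n%:R) * fine (P x (alive Z E n%:R)))%:E.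
Proof. by rewrite EFinM fineK//; exact: fin_num_measure. Qed.

Lemma alpha1 : alpha (fun=> 1) = 1.
Proof.
by rewrite /alpha; under eq_integral do rewrite mulr1; rewrite Hn2.
Qed.

(** The gap applied to the constant 1, for which [alpha] is 1, gives squared L2 errors of ratio
    [e^(-2 gamma)], summable along integer times. *)
Lemma ae_cvg_rescaled_survival : {ae mu, forall x : BH H, E x ->
  (fun n => rescaled_survival n x) @ \oo --> (M^-1 * phi x)%:E}.
Proof.
pose g n (x : BH H) := expR (lam * n%:R) * fine (P x (alive Z E n%:R)) - M^-1 * phi x.
have L1 : L2E mu E (fun=> 1) by exact: L2E_cst.
pose c := ((1 + M^-1) * L2n mu EB (fun=> 1)) ^+ 2.
pose q := expR (- (2 * gamma)).
have q01 : 0 <= q < 1 by rewrite expR_ge0 /= expR_lt1// oppr_lt0 mulr_gt0.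
(* Beyond [T0], and at least 1, so that the times considered are positive. *)
pose N := (Num.truncn `|T0|).+1.
have TN n : (N <= n)%N -> T0 <= n%:R.
  move=> Nn; apply: le_trans (ler_norm _) _.
  have /andP[_ h] := truncn_itv (normr_ge0 T0).
  by apply: le_trans (ltW h) _; rewrite ler_nat.
have mg n : measurable_fun EB (g n).
  apply: measurable_funB; last exact: measurable_funM.
  apply: measurable_funM => //; apply: measurable_funTS.
  by apply: (measurableT_comp (fine_measurable measurableT)); exact: HPmeas.
have Ig n : (N <= n)%N -> (\int[mu]_(x in EB) (g n x ^+ 2)%:E <= (c * q ^+ n)%:E)%E.
  move=> Nn; have n0 : (0 : R) < n%:R by rewrite ltr0n (leq_trans _ Nn).
  have h := gap_sqr (TN n Nn) n0 L1.
  have eqc : (expR (- gamma * n%:R) * ((1 + M^-1) * L2n mu E (fun=> 1))) ^+ 2 = c * q ^+ n.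
    rewrite exprMn mulrC; congr (_ * _); rewrite /q -!expRM_natl; congr expR; ring.
  rewrite eqc in h; apply: le_trans h; rewrite le_eqVlt; apply/orP; left; apply/eqP.
  by apply: eq_integral => x _; rewrite /g (Qsg1 _ Htaumeas) alpha1 mulr1.
have := ae_cvg0_of_L2 HEmeas (sqr_ge0 _) q01 mg Ig; apply: filterS => x hx Ex.
under eq_fun do rewrite rescaled_survivalE.
apply: cvg_EFin; first exact: nearW.
rewrite (_ : fine \o _ = (fun n => g n x + M^-1 * phi x)).
  by rewrite -[X in _ --> X]add0r; apply: cvgD; [exact: hx|exact: cvg_cst].
by apply/funext => n /=; rewrite /g subrK.
Qed.

Lemma rescaled_survival_super n : {ae mu, forall x : BH H, E x ->
  ((expR lam)%:E * Qe P Z E 1 (rescaled_survival n) x <= rescaled_survival n.+1 x)%E}.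
Proof.
have := Hsuper n; apply: filterS => x hx Ex.
rewrite /rescaled_survival (Qe_scale _ HZmeas Htaumeas ltr01)//.
rewrite muleA -EFinM -expRD -natr1 (mulrDr lam) mulr1 (addrC lam).
by apply: lee_wpmul2l; [rewrite lee_fin expR_ge0|exact: hx].
Qed.

Let phiE := absE E phi.

Let nphiE : nnm phiE. Proof. exact: absE_nnm. Qed.

Let phiEE x : E x -> phiE x = (phi x)%:E.
Proof. by move=> Ex; rewrite /phiE /absE patchE mem_set// ger0_norm// ltW// phi0. Qed.

(** The limit of [rescaled_survival_super] by Fatou, both sides converging to multiples of [phi]
    with the same factor [M^-1], which then cancels. *)
Lemma eigen_super : {ae mu, forall x : BH H, E x ->
  ((expR lam)%:E * Qe P Z E 1 phiE x <= (phi x)%:E)%E}.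
Proof.
have M0 := eigen_mass_gt0; have Mi0 : 0 <= M^-1 by rewrite invr_ge0 ltW.
have := @Qe_fatou _ _ _ _ P Z HZmeas HPmeas mu Hinv E HEmeas Htaumeas 1 rescaled_survival
  (fun n x => (expR (- lam))%:E * rescaled_survival n.+1 x)%E
  (fun x => (M^-1)%:E * phiE x)%E (fun x => (expR (- lam))%:E * (M^-1 * phi x)%:E)%E ltr01
  rescaled_survival_nnm (nnm_scale Mi0 nphiE).
case.
- have := ae_cvg_rescaled_survival; apply: filterS => x hx Ex.
  by rewrite phiEE// -EFinM; exact: hx.
- have := ae_foralln rescaled_survival_super; apply: filterS => x hx Ex n.
  have := lee_wpmul2l (_ : (0 <= (expR (- lam))%:E)%E) (hx n Ex).
  by rewrite lee_fin expR_ge0 muleA -EFinM -expRD addNr expR0 mul1e; exact.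
- have := ae_cvg_rescaled_survival; apply: filterS => x hx Ex.
  apply: cvgeZl => //.
  by have := hx Ex; rewrite -(cvg_shiftS (fun n => rescaled_survival n x)).
move=> N [mN N0 hN]; exists N; split=> // x /= nx; apply: hN => /= h; apply: nx => Ex.
have := h Ex; rewrite (Qe_scale _ HZmeas Htaumeas ltr01)//.
have := (Qe_nnm HZmeas HPmeas Htaumeas ltr01 nphiE).1 x.
case: (Qe P Z E 1 phiE x) => [r| |] //; last first.
  by move=> _; rewrite gt0_muley ?lte_fin ?invr_gt0// -EFinM leye_eq.
rewrite -!EFinM !lee_fin => r0; rewrite mulrCA ler_pM2l ?invr_gt0// => rl.
have := ler_wpM2l (expR_ge0 lam) rl.
by rewrite mulrA -expRD subrr expR0 mul1r.
Qed.

Lemma eigen_ae : {ae mu, forall x : BH H, E x ->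
  (phiE x <= (expR lam)%:E * Qe P Z E 1 phiE x)%E}.
Proof.
pose q := (Qsg P Z E 1 phi : BH H -> R).
have mq : measurable_fun EB q.
  by apply: measurable_funTS; exact: (measurable_Qsg HZmeas HPmeas HEmeas Htaumeas ltr01 mphi).
have qE x : q x = fine (Qe P Z E 1 phiE x).
  by rewrite /q /phiE; apply: Qsg_Qe => // y Ey; rewrite ltW// phi0.
have nQ := Qe_nnm HZmeas HPmeas Htaumeas ltr01 nphiE.
have q0 x : 0 <= q x by rewrite qE fine_ge0// nQ.1.
pose u x := phis x * (phi x - expR lam * q x).
have mu_ : measurable_fun EB u.
  by apply: measurable_funM => //; apply: measurable_funB => //; exact: measurable_funM.
have nu := absE_nnm HEmeas mu_.
have sup : {ae mu, forall x : BH H, E x ->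
    Qe P Z E 1 phiE x = (q x)%:E /\ expR lam * q x <= phi x}.
  have := eigen_super; apply: filterS => x hx Ex; have := hx Ex; rewrite qE.
  have := nQ.1 x; case: (Qe P Z E 1 phiE x) => [r| |] //=.
  by move=> _; rewrite gt0_muley ?lte_fin ?expR_gt0// leye_eq.
pose v x := (phis x * (expR lam * q x))%:E.
have v0 x : EB x -> (0 <= v x)%E.
  by move=> Ex; rewrite lee_fin mulr_ge0 ?mulr_ge0 ?expR_ge0// ltW// phis0.
have mv : measurable_fun EB v.
  by apply/measurable_EFinP; apply: measurable_funM => //; exact: measurable_funM.
have Iv : (\int[mu]_(x in EB) v x = M%:E)%E.
  have := Hdual ler01 Lphi; rewrite -/q.
  have -> : (\int[mu]_(x in EB) (phis x * phi x)%:E = M%:E)%E.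
    by rewrite -eigen_mass_fin; apply: eq_integral => x _; rewrite mulrC.
  move=> hq.
  rewrite (_ : (\int[mu]_(x in EB) v x)%E =
     ((expR lam)%:E * \int[mu]_(x in EB) (phis x * q x)%:E)%E).
    by rewrite hq muleA -!EFinM -expRD mulr1 subrr expR0 mul1r.
  rewrite -ge0_integralZl_EFin ?expR_ge0//.
  - by apply: eq_integral => x _; rewrite /v -EFinM mulrCA.
  - by move=> x Ex; rewrite lee_fin mulr_ge0// ltW// phis0.
  - by apply/measurable_EFinP; exact: measurable_funM.
(* [u] is the defect [phi - e^lam Q_1 phi] weighted by [phis], nonnegative almost everywhere. By
   duality at time 1, [phi] and [e^lam Q_1 phi] have the same weighted integral [M]. *)
have Iu : (\int[mu]_(x in EB) absE E u x + M%:E = M%:E)%E.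
  rewrite -[in LHS]Iv -ge0_integralD//; last 2 first.
  - by move=> x _; exact: nu.1.
  - by apply: measurable_funTS; exact: nu.2.
  rewrite -eigen_mass_fin; apply: ge0_ae_eq_integral => //.
  - by apply: emeasurable_funD => //; apply: measurable_funTS; exact: nu.2.
  - by apply/measurable_EFinP; exact: measurable_funM.
  - by move=> x Ex; apply: adde_ge0; [exact: nu.1|exact: v0].
  - by move=> x Ex; rewrite lee_fin mulr_ge0// ltW// ?phi0// phis0.
  - have := sup; apply: filterS => x hx Ex; have [_ h] := hx Ex.
    rewrite /absE patchE mem_set// /v -EFinD ger0_norm; last first.
      by rewrite mulr_ge0 ?subr_ge0// ltW// phis0.
    by rewrite /u -mulrDr subrK mulrC.
have Iu0 : (\int[mu]_(x in EB) absE E u x <= 0)%E.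
  have I0 : (0 <= \int[mu]_(x in EB) absE E u x)%E.
    by apply: integral_ge0 => x _; exact: nu.1.
  move: I0 Iu; case: (\int[mu]_(x in EB) absE E u x)%E => [r| |] //.
  rewrite -EFinD => _ [h]; rewrite lee_fin (_ : r = 0)//.
  by apply: (@addIr _ M); rewrite add0r.
have := ae_and (ae_eq0_integral HEmeas nu Iu0) sup; apply: filterS => x [h1 h2] Ex.
have := h1 Ex; have [-> h3] := h2 Ex; rewrite /absE patchE mem_set// => -[] /eqP.
rewrite normr_eq0 mulf_eq0 gt_eqF ?phis0//= subr_eq0 => /eqP e.
by rewrite phiEE// e EFinM.
Qed.

Definition bad_set (k : nat) : set (BH H) :=
  EB `&` \bigcup_n [set x | (k.+1%:R%:E * rescaled_survival n x < phiE x)%E].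

Lemma bad_setE k : bad_set k `<=` EB. Proof. by move=> x []. Qed.

Lemma measurable_bad_set k : measurable (bad_set k).
Proof.
apply: measurableI => //; apply: bigcupT_measurable => n.
have m1 : measurable_fun setT (fun x => (k.+1%:R%:E * rescaled_survival n x)%E).
  by apply: measurable_funeM; exact: (rescaled_survival_nnm n).2.
rewrite -[X in measurable X]setTI.
by apply: measurable_lte => //; exact: nphiE.2.
Qed.

(** Where [b_n] tends to [phi / M], which is positive, the sequence has a positive lower bound, all
    its terms being positive; such a point leaves [bad_set k] for large [k]. *)
Lemma bad_set_cvg0 : (fun k => mu (bad_set k)) @ \oo --> 0%E.
Proof.
have nd : {homo bad_set : k l / (k <= l)%N >-> (l <= k)%O}.
  move=> k l kl; apply/subsetPset => x [Ex [n _ /= hn]]; split=> //; exists n => //=.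
  apply: le_lt_trans hn; apply: lee_wpmul2r; first exact: (rescaled_survival_nnm n).1.
  by rewrite lee_fin ler_nat.
have mcap : measurable (\bigcap_k bad_set k).
  by apply: bigcapT_measurable => k; exact: measurable_bad_set.
suff <- : mu (\bigcap_k bad_set k) = 0%E.
  apply: nonincreasing_cvg_mu => //.
    by rewrite (le_lt_trans (probability_le1 _ (measurable_bad_set 0)))// ltry.
  exact: measurable_bad_set.
have [N [mN N0 hN]] := ae_cvg_rescaled_survival.
apply/eqP; rewrite eq_le measure_ge0 andbT -N0.
apply: le_measure; rewrite ?inE//.
move=> x xk; have Ex : E x by case: (xk 0%N I).
apply: hN => /= h; have {h} := h Ex.
have fS t : P x (alive Z E t) \is a fin_num by exact: fin_num_measure.
(* Positivity is assumed for positive times; comparison with time [n + 1] covers [n = 0] too. *)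
have S0 (n : nat) : 0 < fine (P x (alive Z E n%:R)).
  rewrite -lte_fin fineK//.
  apply: (@lt_le_trans _ _ (P x (alive Z E n.+1%:R))); first by apply: Hpos => //; rewrite ltr0n.
  by apply: le_measure; rewrite ?inE//; apply: alive_nd; rewrite ler_nat.
under eq_fun do rewrite rescaled_survivalE.
move=> /fine_cvg hc.
have r0 (n : nat) : 0 < expR (lam * n%:R) * fine (P x (alive Z E n%:R)).
  by rewrite mulr_gt0 ?expR_gt0.
have L0 : 0 < M^-1 * phi x by rewrite mulr_gt0 ?phi0// invr_gt0 eigen_mass_gt0.
have [c c0 hcn] := cvg_pos_lbound r0 L0 hc.
have [_ [n _ /=]] := xk (Num.truncn (phi x / c)) I.
rewrite rescaled_survivalE phiEE// -EFinM lte_fin ltNge => /negP; apply.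
apply: (@le_trans _ _ ((Num.truncn (phi x / c)).+1%:R * c)).
  by rewrite -ler_pdivrMr// ltW// truncnS_gt.
by rewrite ler_pM2l// ltr0n.
Qed.

Section Tail.
Variable k : nat.

Let W := restricted_step P Z E (bad_set k) (expR lam).

Let hW : nn_operator mu EB W.
Proof.
apply: restricted_step_operator => //; exact: measurable_bad_set.
Qed.

Let hQ := Qe_operator HZmeas HPmeas Hinv HEmeas Htaumeas ltr01.

(* This fails at exponent 0, since P_x(0 < tau) may be smaller than 1. *)
Lemma iter_step_one n : {ae mu, forall x : BH H, E x ->
  (iter n.+1 W (fun=> 1) x <= rescaled_survival n.+1 x)%E}.
Proof.
have n1 : nnm (fun _ : BH H => 1%E : \bar R) by apply: nnm_cst.
have le1 (f : BH H -> \bar R) x : nnm f -> (W f x <= (expR lam)%:E * Qe P Z E 1 f x)%E.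
  by move=> nf; apply: restricted_step_le => //; exact: expR_ge0.
elim: n => [|n IH].
  apply: aeW => x Ex /=; apply: le_trans (le1 _ x n1) _.
  by rewrite (Qe1 P Htaumeas) /rescaled_survival mulr1.
have nIt := nno_nnm (nn_operator_iter n.+1 hW) n1.
have IHQ := nno_mono hQ nIt (rescaled_survival_nnm n.+1) IH.
have := ae_and IHQ (rescaled_survival_super n.+1); apply: filterS => x [h1 h2] Ex.
rewrite iterS; apply: le_trans (le1 _ x nIt) _; apply: le_trans (h2 Ex).
by apply: lee_wpmul2l; [rewrite lee_fin expR_ge0|exact: h1].
Qed.

Lemma eigen_tail n : {ae mu, forall x : BH H, E x ->
  (phiE x <= k.+1%:R%:E * rescaled_survival n x + iter n W phiE x)%E}.
Proof.
have k0 : (0 : R) <= k.+1%:R by [].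
elim: n => [|n IH].
  apply: aeW => x Ex /=; rewrite leeDr// mule_ge0 ?lee_fin//.
  exact: (rescaled_survival_nnm 0).1.
have nb := rescaled_survival_nnm n.
have nkb := nnm_scale k0 nb.
have nIt := nno_nnm (nn_operator_iter n hW) nphiE.
have IHQ := nno_mono hQ nphiE (nnm_add nkb nIt) IH.
have := ae_and3 IHQ eigen_ae (rescaled_survival_super n).
apply: filterS => x [h1 h2 h3] Ex.
have nItS := nno_nnm (nn_operator_iter n.+1 hW) nphiE.
(* Off [bad_set k] the first term alone dominates [phi]. On it, [W] is the full step [e^lam Q_1],
   applied to the induction hypothesis, and [rescaled_survival_super] raises [n] to [n + 1]. *)
have [xB|xB] := pselect (bad_set k x); last first.
  apply: (@le_trans _ _ (k.+1%:R%:E * rescaled_survival n.+1 x)%E); last first.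
    by rewrite leeDl// nItS.1.
  rewrite leNgt; apply/negP => hlt; apply: xB; split=> //.
  by exists n.+1.
apply: le_trans (h2 Ex) _.
have eWx : iter n.+1 W phiE x = ((expR lam)%:E * Qe P Z E 1 (iter n W phiE) x)%E.
  by rewrite iterS {1}/W /restricted_step indicE mem_set// mul1r.
rewrite eWx.
apply: (@le_trans _ _ ((expR lam)%:E * (k.+1%:R%:E * Qe P Z E 1 (rescaled_survival n) x +
    Qe P Z E 1 (iter n W phiE) x))%E).
  apply: lee_wpmul2l; first by rewrite lee_fin expR_ge0.
  apply: le_trans (h1 Ex) _; rewrite (Qe_add _ HZmeas Htaumeas ltr01)//.
  by rewrite (Qe_scale _ HZmeas Htaumeas ltr01).
have nQb := Qe_nnm HZmeas HPmeas Htaumeas ltr01 nb.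
have nQI := Qe_nnm HZmeas HPmeas Htaumeas ltr01 nIt.
rewrite muleDr//; last first.
  apply: ge0_adde_def; rewrite inE; last exact: nQI.1.
  by apply: mule_ge0; [rewrite lee_fin|exact: nQb.1].
rewrite leeD2r// muleCA; apply: lee_wpmul2l; first by rewrite lee_fin.
exact: h3.
Qed.

End Tail.

(** * Convergence rate of the conditional expectations *)

Section Final.
Hypothesis Hcompact : forall t (u : nat -> BH H -> R), 0 < t ->
     (forall n, bmeas (u n) /\ L2n mu setT (u n) <= 1) ->
     exists s : nat -> nat, (forall n, (s n < s n.+1)%N) /\
       forall e : R, 0 < e -> exists N, forall m n, (N <= m)%N -> (N <= n)%N ->
         L2n mu setT (fun x => Psg P Z t (u (s m)) x - Psg P Z t (u (s n)) x) < e.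
Variables (f : BH H -> R) (Lf : L2E mu E f).

Let a := alpha f.
Let mf : measurable_fun EB f. Proof. by case: Lf. Qed.
Let S t (x : BH H) := fine (P x (alive Z E t)).
(** The deviation of the conditional expectation from [a], multiplied by
    [e^(lam t) P_x(t < tau)]. *)
Let u t x := expR (lam * t) * (Qsg P Z E t f x - a * S t x).

Let mS t : measurable_fun setT (S t).
Proof. by apply: (measurableT_comp (fine_measurable measurableT)); exact: HPmeas. Qed.

Let SE t x : P x (alive Z E t) = (S t x)%:E.
Proof. by rewrite fineK//; exact: fin_num_measure. Qed.

Let S0 t x : E x -> 0 < t -> 0 < S t x.
Proof. by move=> Ex t0; rewrite -lte_fin -SE; exact: Hpos. Qed.

Let mu_ t : 0 < t -> measurable_fun EB (u t).
Proof.
move=> t0; apply: measurable_funM => //; apply: measurable_funB.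
  by apply: measurable_funTS; exact: (measurable_Qsg HZmeas HPmeas HEmeas Htaumeas t0 mf).
by apply: measurable_funM => //; apply: measurable_funTS; exact: mS.
Qed.

(** In the gap estimates for [f] and for 1, the projections on [phi] cancel in [D1 - a D2], since
    [alpha] of the constant 1 is 1. *)
Lemma deviation_L1 : exists2 C, 0 <= C & forall t, T0 <= t -> 0 < t ->
  (\int[mu]_(x in EB) `|u t x|%:E <= (C * expR (- gamma * t))%:E)%E.
Proof.
pose c1 := ((1 + M^-1) * L2n mu E f) ^+ 2.
pose c2 := ((1 + M^-1) * L2n mu E (fun=> 1)) ^+ 2.
have c10 : 0 <= c1 by exact: sqr_ge0.
have c20 : 0 <= c2 by exact: sqr_ge0.
have a20 : 0 <= a ^+ 2 by exact: sqr_ge0.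
exists (2 * c1 + 2 * (a ^+ 2 * c2) + 1).
  by rewrite addr_ge0// addr_ge0// mulr_ge0// mulr_ge0.
move=> t Tt t0.
pose D1 (x : BH H) := expR (lam * t) * Qsg P Z E t f x - M^-1 * phi x * a.
pose D2 (x : BH H) := expR (lam * t) * Qsg P Z E t (fun=> 1) x - M^-1 * phi x * alpha (fun=> 1).
have L1 : L2E mu E (fun=> 1) by exact: L2E_cst.
have LD h c : L2E mu E h ->
    L2E mu E (fun x => expR (lam * t) * Qsg P Z E t h x - M^-1 * phi x * c).
  move=> Lh; have LQ := L2E_Qsg HZmeas HPmeas Hinv HEmeas Htaumeas t0 Lh.
  have := L2E_add HEmeas (L2E_scale HEmeas (expR (lam * t)) LQ)
    (L2E_scale HEmeas (- (M^-1 * c)) Lphi).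
  congr (L2E _ _ _); apply/funext => x; rewrite mulNr.
  by congr (_ - _); rewrite mulrAC.
have I1 := gap_sqr Tt t0 Lf; have I2 := gap_sqr Tt t0 L1.
have e1 : (expR (- gamma * t) * ((1 + M^-1) * L2n mu E f)) ^+ 2 = c1 * expR (- gamma * t) ^+ 2.
  by rewrite exprMn mulrC.
have e2 : (expR (- gamma * t) * ((1 + M^-1) * L2n mu E (fun=> 1))) ^+ 2 =
    c2 * expR (- gamma * t) ^+ 2 by rewrite exprMn mulrC.
rewrite e1 in I1; rewrite e2 in I2.
set E2 := expR (- gamma * t) in I1 I2 *.
have E0 : 0 < E2 by exact: expR_gt0.
have LD1 : L2E mu E D1 by exact: LD.
have LD2 : L2E mu E D2 by exact: LD.
have LaD2 := L2E_scale HEmeas (- a) LD2.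
have uE (x : BH H) : u t x = D1 x + - a * D2 x.
  by rewrite /u /D1 /D2 alpha1 (Qsg1 _ Htaumeas) -/(S t x); ring.
have Iu : (\int[mu]_(x in EB) (u t x ^+ 2)%:E <= ((2 * c1 + 2 * (a ^+ 2 * c2)) * E2 ^+ 2)%:E)%E.
  under eq_integral do rewrite uE.
  apply: le_trans (L2E_integral_add HEmeas LD1 LaD2) _.
  rewrite mulrDl [leRHS]EFinD; apply: leeD.
    by rewrite -mulrA (EFinM 2); apply: lee_wpmul2l.
  rewrite -mulrA (EFinM 2); apply: lee_wpmul2l => //.
  under eq_integral do rewrite exprMn sqrrN EFinM.
  rewrite ge0_integralZl_EFin//; last 2 first.
  - by move=> x _; rewrite lee_fin sqr_ge0.
  - by apply: measurable_sqr; case: LD2.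
  by rewrite -mulrA [leRHS]EFinM; apply: lee_wpmul2l.
(* The weight [E2^-1] balances both terms: a square of size [E2^2] yields an L1 norm of size
   [E2]. *)
have := integral_abs_le HEmeas (mu_ t0) (_ : 0 < E2^-1) Iu.
rewrite invr_gt0 => /(_ E0); rewrite invrK => /le_trans; apply.
rewrite lee_fin mulrCA expr2 mulKf ?gt_eqF// [leRHS]mulrDl mul1r.
by rewrite lerD2r mulrC.
Qed.

Lemma quasi_ergodic : exists T C : R, 0 < T /\ 0 < C /\ forall t, T <= t ->
  (\int[mu]_(x in EB) (`|condE P Z E t f x - a| * phi x)%:E <= (C * expR (- gamma * t))%:E)%E.
Proof.
pose L := `|lam|; pose A := expR L; pose r := expR (- (3 * L + 2 * gamma)).
have L0 : 0 <= L by exact: normr_ge0.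
have A1 : 1 <= A by rewrite -expR0 ler_expR.
have A0 : 0 <= A by exact: expR_ge0.
have lA : expR lam <= A by rewrite ler_expR ler_norm.
have r0 : 0 < r by exact: expR_gt0.
(* Chosen so that [W], which carries the factor [e^lam], has L2 norm at most [r]. *)
pose e := r ^+ 2 / expR lam ^+ 2.
have e0 : 0 < e by rewrite divr_gt0// exprn_gt0// expR_gt0.
have [k hk] := compact_small HZmeas HPmeas Hinv Hcompact ltr01 measurable_bad_set bad_set_cvg0 e0.
pose W := restricted_step P Z E (bad_set k) (expR lam).
have mB := measurable_bad_set k.
have l0 : 0 <= expR lam by exact: expR_ge0.
have hW : nn_operator mu EB W by apply: restricted_step_operator.
have WL1 h : nnm h -> (\int[mu]_(x in EB) W h x <= A%:E * \int[mu]_(x in EB) h x)%E.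
  move=> nh; apply: le_trans (restricted_step_L1 HZmeas HPmeas Hinv HEmeas Htaumeas mB l0 nh) _.
  by apply: lee_wpmul2r; [apply: integral_ge0 => x _; exact: nh.1|rewrite lee_fin].
have WL2 h : nnm h -> (\int[mu]_(x in EB) (W h x * W h x) <=
    (r ^+ 2)%:E * \int[mu]_(x in EB) (h x * h x))%E.
  move=> nh.
  have := restricted_step_L2 HZmeas HPmeas Hinv HEmeas Htaumeas mB (@bad_setE k) l0 hk nh.
  by rewrite /e mulrCA mulfV ?mulr1// expf_neq0// gt_eqF// expR_gt0.
pose gR (x : BH H) := `|f x| + `|a|.
have LgR : L2E mu EB gR.
  apply: (L2E_add HEmeas); last exact: L2E_cst.
  split; first exact: measurableT_comp.
  by under eq_integral do rewrite real_normK ?num_real//; case: Lf.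
pose g (y : BH H) := (absE E f y + `|a|%:E)%E.
have na : nnm (fun _ : BH H => `|a|%:E) by exact: nnm_cst.
have ng : nnm g by apply: nnm_add => //; exact: absE_nnm.
have ngg := nnm_mul ng ng.
have gE : (\int[mu]_(x in EB) (g x * g x) = \int[mu]_(x in EB) (gR x ^+ 2)%:E)%E.
  by apply: eq_integral => x xE; rewrite /g /absE patchE xE -EFinD -EFinM -expr2.
pose w := fine (\int[mu]_(x in EB) (gR x ^+ 2)%:E)%E.
pose v := fine (\int[mu]_(x in EB) (phi x ^+ 2)%:E)%E.
have wE : (\int[mu]_(x in EB) (gR x ^+ 2)%:E = w%:E)%E.
  by rewrite fineK// ge0_fin_numE ?integral_sqr_ge0//; case: LgR.
have vE : (\int[mu]_(x in EB) (phi x ^+ 2)%:E = v%:E)%E.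
  by rewrite fineK// ge0_fin_numE ?integral_sqr_ge0//; case: Lphi.
have w0 : 0 <= w by rewrite -lee_fin -wE integral_sqr_ge0.
have v0 : 0 <= v by rewrite -lee_fin -vE integral_sqr_ge0.
have [Cu Cu0 hCu] := deviation_L1.
pose K : R := k.+1%:R; have K0 : 0 <= K by [].
pose T := Num.max T0 0 + 1.
(* [K A Cu] comes from the part of [phi] dominated by [b_n], the bracket from [tail_exponents]; the
   final 1 makes [C] positive. *)
pose C := K * A * Cu + (2 * K ^+ 2 + 2 * v + w) + 1.
exists T, C; split; first by rewrite ltr_wpDl// le_max lexx orbT.
split.
  rewrite ltr_wpDl// addr_ge0//; first by rewrite mulr_ge0// mulr_ge0.
  by rewrite addr_ge0// addr_ge0// mulr_ge0// sqr_ge0.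
move=> t Tt.
have Mt : Num.max T0 0 < t by apply: lt_le_trans Tt; rewrite /T ltrDl.
have t0 : 0 < t by apply: le_lt_trans Mt; rewrite le_max lexx orbT.
have T0t : T0 <= t by apply: ltW; apply: le_lt_trans Mt; rewrite le_max lexx.
(* An integer with [t <= n <= t + 1]: survival to [n] implies survival to [t], and rescaling at [n]
   instead of [t] costs at most the factor [A]. It is a successor, as [iter_step_one] requires. *)
pose n' := Num.truncn t; pose n := n'.+1.
have tn : t <= n%:R by apply/ltW; exact: truncnS_gt.
have nt : n%:R <= t + 1.
  by rewrite /n -natr1 lerD2r; have /andP[] := truncn_itv (ltW t0).
pose th := expR ((L + gamma) * n%:R).
have th0 : 0 < th by exact: expR_gt0.
pose B := rescaled_survival n.
have nB : nnm B by exact: rescaled_survival_nnm.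
have nQg := Qe_nnm HZmeas HPmeas Htaumeas t0 ng.
pose G : BH H -> \bar R := Qe P Z E t (fun y => (g y * g y)%E).
have nG : nnm G by exact: (Qe_nnm HZmeas HPmeas Htaumeas t0 ngg).
(* The inverse is written as [exp (- ln S)], legitimate because [S] is positive on [E]. *)
have mSi : measurable_fun EB (fun x => (S t x)^-1).
  apply: (eq_measurable_fun (fun x => expR (- ln (S t x)))).
    by move=> x; rewrite inE => Ex; rewrite expRN lnK// posrE S0.
  apply: measurableT_comp => //; apply: measurableT_comp => //.
  by apply: measurableT_comp => //; apply: measurable_funTS; exact: mS.
pose Y : BH H -> \bar R := (fun x => ((S t x)^-1)%:E * Qe P Z E t g x)%E \_ EB.
have YE x : E x -> Y x = (((S t x)^-1)%:E * Qe P Z E t g x)%E.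
  by move=> Ex; rewrite /Y patchE mem_set.
have nY : nnm Y.
  split.
    apply: erestrict_ge0 => x Ex; apply: mule_ge0; last exact: nQg.1.
    by rewrite lee_fin invr_ge0 ltW// S0.
  apply: (measurable_restrictT _ HEmeas).1; apply: emeasurable_funM.
    by apply/measurable_EFinP.
  by apply: measurable_funTS; exact: nQg.2.
have SnS x : S n%:R x <= S t x.
  by rewrite -lee_fin -!SE; apply: le_measure; rewrite ?inE//; exact: alive_nd.
have Sn0 x : 0 <= S n%:R x by rewrite fine_ge0.
have elam : expR (lam * n%:R) <= A ^+ n.
  rewrite -expRM_natl ler_expR mulrC; apply: ler_wpM2l => //; exact: ler_norm.
have elamt : expR (lam * n%:R) <= A * expR (lam * t).
  rewrite -expRD ler_expR -lerBlDr -mulrBr.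
  apply: le_trans (ler_norm _) _; rewrite normrM -[leRHS]mulr1; apply: ler_wpM2l => //.
  by rewrite ger0_norm ?subr_ge0// lerBlDl.
have BA x : (B x <= (A ^+ n)%:E)%E.
  rewrite /B rescaled_survivalE lee_fin -[leRHS]mulr1; apply: ler_pM => //.
    exact: Sn0.
  by rewrite -lee_fin -/(S _ _) -SE; exact: probability_le1.
have GI : (\int[mu]_(x in EB) G x <= w%:E)%E.
  by rewrite -wE -gE; exact: (Qe_L1 HZmeas HPmeas Hinv HEmeas Htaumeas t0 ngg).
have Gfin : {ae mu, forall x : BH H, E x -> G x \is a fin_num}.
  by apply: (ae_fin_num_integral HEmeas nG); exact: le_lt_trans GI (ltry _).
have Qcs x := Qe_cs P HZmeas Htaumeas t0 x ng.
have Qfin : {ae mu, forall x : BH H, E x -> Qe P Z E t g x \is a fin_num}.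
  apply: filterS Gfin => x hx Ex; have := hx Ex; have := Qcs x; rewrite SE -/(G x).
  have := nQg.1 x; case: (Qe P Z E t g x) => [q| |] //.
  by move=> _; rewrite mulyy leye_eq => /eqP + Gf; rewrite -(fineK Gf) -EFinM.
have Yfin : {ae mu, forall x : BH H, E x -> Y x \is a fin_num}.
  by apply: filterS Qfin => x hx Ex; rewrite YE// fin_numM//; exact: hx.
have W1B := iter_step_one k n'; rewrite -/W -/n in W1B.
have nW1 : nnm (iter n W (fun=> 1%E)).
  by apply: (nno_nnm (nn_operator_iter n hW)); exact: nnm_cst.
(* [W^n 1 <= b_n <= A^n S_t] cancels one factor [1 / S_t] of [Y^2], and Cauchy-Schwarz cancels the
   other. *)
have YG : {ae mu, forall x : BH H, E x ->
    (Y x * Y x * iter n W (fun=> 1) x <= (A ^+ n)%:E * G x)%E}.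
  have := ae_and3 Qfin Gfin W1B; apply: filterS => x [h1 h2 h3] Ex.
  have h4 : (iter n W (fun=> 1) x <= (A ^+ n * S t x)%:E)%E.
    apply: le_trans (h3 Ex) _; rewrite rescaled_survivalE lee_fin.
    exact: (ler_pM (expR_ge0 _) (Sn0 x) elam (SnS x)).
  have Sx := S0 Ex t0.
  apply: (@le_trans _ _ (Y x * Y x * (A ^+ n * S t x)%:E)%E).
    by apply: lee_wpmul2l => //; apply: mule_ge0; exact: nY.1.
  have := Qcs x; rewrite SE -/(G x) YE//.
  rewrite -(fineK (h1 Ex)) -(fineK (h2 Ex)) -!EFinM !lee_fin.
  move: (fine (Qe P Z E t g x)) (fine (G x)) => q G' qG.
  rewrite (_ : _ * _ * _ = A ^+ n * ((S t x)^-1 * (q * q))); last first.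
    by field; rewrite gt_eqF.
  by apply: ler_wpM2l; rewrite ?exprn_ge0// ler_pdivrMl.
have tail := eigen_tail k n; rewrite -/W -/B -/K in tail.
have phiI : (\int[mu]_(x in EB) (phiE x * phiE x) <= v%:E)%E.
  by rewrite integral_absE_sqr vE.
have := iter_tail_bound HEmeas hW (probability_le1 mu HEmeas) A1 r0 K0 th0 WL1 WL2
  nphiE nB nY nG BA tail Yfin YG phiI GI.
set V := iter n W phiE => VY.
have nV : nnm V by exact: (nno_nnm (nn_operator_iter n hW) nphiE).
have KA0 : 0 <= K * A by rewrite mulr_ge0.
(* By [eigen_tail], [phi] is split into [K b_n], where the exact deviation is kept and its
   denominator cancels, and [W^n phi], where the deviation is replaced by [Y]. *)
apply: (@le_trans _ _ (\int[mu]_(x in EB) ((K * A)%:E * `|u t x|%:E + V x * Y x))%E).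
  apply: ae_ge0_le_integral => //.
  - by move=> x Ex; rewrite lee_fin mulr_ge0// ltW// phi0.
  - apply/measurable_EFinP; apply: measurable_funM => //.
    apply: measurableT_comp => //; apply: measurable_funB => //; rewrite /condE.
    apply: measurable_funM; last exact: mSi.
    by apply: measurable_funTS; exact: (measurable_Qsg HZmeas HPmeas HEmeas Htaumeas t0 mf).
  - move=> x _; apply: adde_ge0; last by apply: mule_ge0; [exact: nV.1|exact: nY.1].
    by rewrite -EFinM lee_fin mulr_ge0.
  - apply: emeasurable_funD.
      apply: measurable_funeM; apply/measurable_EFinP; apply: measurableT_comp => //.
      exact: mu_.
    by apply: measurable_funTS; exact: (nnm_mul nV nY).2.
  apply: filterS tail => x hx Ex.
  have Sx := S0 Ex t0.
  have DY := cond_dev_le HZmeas HEmeas Htaumeas t0 a mf (Hpos Ex t0).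
  rewrite -/(S t x) -/g -YE// in DY.
  set D := `|_ - a| in DY *.
  have D0 : 0 <= D by exact: normr_ge0.
  rewrite EFinM -phiEE//.
  apply: (@le_trans _ _ (D%:E * (K%:E * B x + V x))%E).
    by apply: lee_wpmul2l; [rewrite lee_fin|exact: hx].
  rewrite ge0_muleDr; last 2 first.
  - by apply: mule_ge0; [rewrite lee_fin|exact: nB.1].
  - exact: nV.1.
  apply: leeD; last by rewrite muleC; apply: lee_wpmul2l => //; exact: nV.1.
  rewrite /B rescaled_survivalE -/(S n%:R x) -!EFinM lee_fin.
  have DS : `|u t x| = expR (lam * t) * (D * S t x).
    rewrite /u normrM ger0_norm ?expR_ge0//; congr (_ * _).
    rewrite /D /condE -/(alive Z E t) -/(S t x).
    by rewrite -[X in _ = _ * X](ger0_norm (ltW Sx)) -normrM mulrBl divfK// gt_eqF.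
  rewrite DS.
  rewrite [leLHS]mulrCA -mulrA; apply: ler_wpM2l => //.
  rewrite (_ : A * (expR (lam * t) * (D * S t x)) = D * (A * expR (lam * t) * S t x)); last by ring.
  apply: ler_wpM2l => //; exact: (ler_pM (expR_ge0 _) (Sn0 x) elamt (SnS x)).
rewrite ge0_integralD//; last 4 first.
- by move=> x _; rewrite -EFinM lee_fin mulr_ge0.
- apply: measurable_funeM; apply/measurable_EFinP; apply: measurableT_comp => //.
  exact: mu_.
- by move=> x _; apply: mule_ge0; [exact: nV.1|exact: nY.1].
- by apply: measurable_funTS; exact: (nnm_mul nV nY).2.
rewrite ge0_integralZl_EFin//; last first.
  by apply/measurable_EFinP; apply: measurableT_comp => //; exact: mu_.
apply: (@le_trans _ _ ((K * A)%:E * (Cu * expR (- gamma * t))%:E +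
    ((2 * K ^+ 2 + 2 * v + w) * expR (- gamma * t))%:E)%E).
  apply: leeD; first by apply: lee_wpmul2l; [rewrite lee_fin|exact: hCu].
  apply: le_trans VY _; rewrite lee_fin.
  exact: tail_exponents.
rewrite -EFinM -EFinD lee_fin /C mulrA -mulrDl; apply: ler_wpM2r; first exact: expR_ge0.
by rewrite lerDl.
Qed.

End Final.
End Spectral.

Theorem mainTheorem6 (R : realType) (H : normedModType R)
  (HHilb : is_separable_Hilbert H)
  (dO : measure_display) (Omega : measurableType dO)
  (P : H -> probability Omega R) (Z : R -> Omega -> H)
  (HZmeas : forall t, 0 <= t -> measurable_fun setT (Z t : Omega -> BH H))
  (HPmeas : forall A : set Omega, measurable A -> measurable_fun [set: BH H] (fun x : BH H => P x A))
  (HZcont : forall w, {within [set t : R | 0 <= t], continuous (fun t => Z t w)})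
  (HZ0 : forall x : H, P x [set w | Z 0 w = x] = 1%E)
  (Hmarkov : markov_property P Z)
  (mu : probability (BH H) R)
  (Hinv : forall t f, 0 <= t -> bmeas f ->
     (\int[mu]_x (Psg P Z t f x)%:E = \int[mu]_x (f x)%:E)%E)
  (Hcompact : forall t (u : nat -> BH H -> R), 0 < t ->
     (forall n, bmeas (u n) /\ L2n mu setT (u n) <= 1) ->
     exists s : nat -> nat, (forall n, (s n < s n.+1)%N) /\
       forall e : R, 0 < e -> exists N, forall m n, (N <= m)%N -> (N <= n)%N ->
         L2n mu setT (fun x => Psg P Z t (u (s m)) x - Psg P Z t (u (s n)) x) < e)
  (Hirred : forall (x : H) (t : R) (F : set (BH H)), 0 < t -> measurable F ->
     (0 < mu F)%E -> (0 < P x [set w | F (Z t w)])%E)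
  (E : set H)
  (HEmeas : measurable (E : set (BH H)))
  (HEbdd : exists r : R, forall x, E x -> `|x| <= r)
  (HEconn : connected E)
  (HEsupp : E `<=` msupport mu)
  (Htaumeas : forall t : R, measurable [set w | (t%:E < tau Z E w)%E])
  (Hkill1 : forall x, E x -> P x [set w | (tau Z E w < +oo)%E] = 1%E)
  (Hkill2 : forall x t, E x -> 0 < t -> (0 < P x [set w | (t%:E < tau Z E w)%E])%E)
  (lam1 : R) (phi phis : BH H -> R)
  (Hspec1 : specE P Z mu E (- lam1))
  (Hspec2 : forall l, specE P Z mu E l -> l <= - lam1)
  (Hphi : L2E mu E phi /\ (forall x, E x -> 0 < phi x) /\
          genE P Z mu E phi (fun x => - lam1 * phi x))
  (Hphis : L2E mu E phis /\ (forall x, E x -> 0 < phis x) /\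
          forall t f, 0 <= t -> L2E mu E f ->
          (\int[mu]_(x in E) (phis x * Qsg P Z E t f x)%:E =
           (expR (- lam1 * t))%:E * \int[mu]_(x in E) (phis x * f x)%:E)%E)
  (Hnorm : (\int[mu]_(x in E) (phi x)%:E = 1)%E /\
           (\int[mu]_(x in E) (phis x)%:E = 1)%E)
  (gamma : R) (Hgamma : 0 < gamma) :
  let M := fine (\int[mu]_(x in E) (phi x * phis x)%:E)%E in
  let alpha := fun f : BH H -> R => fine (\int[mu]_(x in E) (phis x * f x)%:E)%E in
  (exists T0 : R, forall t f, T0 <= t -> L2E mu E f ->
     L2n mu E (fun x => expR (lam1 * t) * Qsg P Z E t f x - M^-1 * phi x * alpha f)
       <= expR (- gamma * t) * (1 + M^-1) * L2n mu E f) ->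
  forall f, L2E mu E f ->
  exists T : R, exists C : R, 0 < T /\ 0 < C /\
    forall t, T <= t ->
      (\int[mu]_(x in E) (`|condE P Z E t f x - alpha f| * phi x)%:E
         <= (C * expR (- gamma * t))%:E)%E.
Proof.
move=> M alpha [T0 Hgap] f Lf.
have Hsuper n := alive_super HZmeas HPmeas HZcont HZ0 Hmarkov mu HEmeas Htaumeas n.
have [Lphi [phi0 _]] := Hphi; have [Lphis [phis0 Hdual]] := Hphis.
have [Hn1 Hn2] := Hnorm.
exact: (quasi_ergodic HZmeas HPmeas Hinv HEmeas Htaumeas Hkill2 Hsuper Lphi phi0 Lphis
  phis0 Hdual Hn1 Hn2 Hgamma Hgap Hcompact Lf).
Qed.
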